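(* Fix $m\ge 2$ and integers $1\le j<k$. Let $\mathcal C$ be the set of compact, connected quantum graphs that have at most $m$ edges, with any combination of Dirichlet and Neumann conditions at any leaves and Kirchhoff conditions at all other vertices, where, if $j=1$, we also require that there is at least one Dirichlet leaf. Then there exist a graph minimizing the ratio $\lambda_k/\lambda_j$ and a graph maximizing this ratio, although the minimizing/maximizing graph may have a Dirichlet condition at a non-leaf. That is, there exist compact connected quantum graphs $\Gamma_\ast$ and $\Gamma^\ast$ with at most $m$ edges, each of whose vertices is equipped with either a Dirichlet or a Kirchhoff condition (a Dirichlet condition being permitted also at non-leaf vertices), with at least one Dirichlet vertex if $j=1$, such that $$\frac{\lambda_k(\Gamma_\ast)}{\lambda_j(\Gamma_\ast)}=\inf_{\Gamma\in\mathcal C}\frac{\lambda_k(\Gamma)}{\lambda_j(\Gamma)},\qquad \frac{\lambda_k(\Gamma^\ast)}{\lambda_j(\Gamma^\ast)}=\sup_{\Gamma\in\mathcal C}\frac{\lambda_k(\Gamma)}{\lambda_j(\Gamma)}.$$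
   Context: A compact metric graph $\Gamma=(\mathcal V,\mathcal E)$ has finitely many vertices and edges; each edge $e$ is identified with an interval $[0,\ell_e]$, $0<\ell_e<\infty$, whose endpoints are attached to vertices; loops and parallel edges are permitted. A leaf is a vertex of degree one (a loop counts twice in the degree). $C(\Gamma)$ denotes the continuous functions on $\Gamma$ and $H^1(\Gamma)=\{f\in C(\Gamma): f|_e\in H^1(e)\ \forall e\in\mathcal E\}$. A quantum graph is a compact metric graph together with a (possibly empty) set $V_D$ of Dirichlet vertices, equipped with the Laplacian: the self-adjoint operator on $L^2(\Gamma)$ associated with the form $\int_\Gamma f'\overline{g}'\,dx$ on the set of $f\in H^1(\Gamma)$ vanishing on $V_D$. It acts as $-f''$ on each edge; functions in its domain vanish on $V_D$ and satisfy at all other vertices the Kirchhoff condition (continuity, and the sum of the derivatives along all incident edges, all oriented into the vertex, is zero), which at a leaf is the Neumann condition. The eigenvalues, counted with multiplicity, are $\lambda_1(\Gamma)\le\lambda_2(\Gamma)\le\dots$. Degree-two vertices with Kirchhoff conditions are regarded as suppressed, as they do not affect the graph or the operator. Connectedness refers to the metric graph, irrespective of Dirichlet conditions. *)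

(* Defs.v *)
From HB Require Import structures.
From mathcomp Require Import all_boot all_order all_algebra.
From mathcomp Require Import complex.
From mathcomp Require Import all_classical all_reals all_analysis.

Set Implicit Arguments.
Unset Strict Implicit.
Unset Printing Implicit Defensive.

Import Order.TTheory GRing.Theory Num.Theory.
Import numFieldNormedType.Exports.

Local Open Scope classical_set_scope.
Local Open Scope ring_scope.
Local Open Scope complex_scope.

Section ComplexLebesgue.
Variable R : realType.

Definition cintegral (D : set R) (f : R -> R[i]) : R[i] :=
  Complex (Rintegral lebesgue_measure D (fun x => complex.Re (f x)))
          (Rintegral lebesgue_measure D (fun x => complex.Im (f x))).

Definition real_square_integrable (D : set R) (f : R -> R) : Prop :=
  measurable_fun D f /\
  lebesgue_measure.-integrable D (fun x => (f x ^+ 2)%:E).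

Definition square_integrable (D : set R) (f : R -> R[i]) : Prop :=
  real_square_integrable D (fun x => complex.Re (f x)) /\
  real_square_integrable D (fun x => complex.Im (f x)).

(* [f] is (the continuous representative of) an element of H^1(0, l), with
   weak derivative [f']; in dimension one, H^1 consists of the absolutely
   continuous functions with square integrable derivative. *)
Definition H1_deriv (l : R) (f f' : R -> R[i]) : Prop :=
  square_integrable `[0, l] f' /\
  forall x, x \in `[0, l] -> f x = f 0 + cintegral `[0, x] f'.

End ComplexLebesgue.

(* The edge [e] is the interval [0, len e]; its end 0 is attached to the vertex
   [ends e false] and its end [len e] to [ends e true].  Loops and parallel
   edges are allowed.  Vertices outside [dirichlet] carry the Kirchhoff
   condition.  There is at least one edge: otherwise L^2 is zero and there are
   no eigenvalues. *)
Record qgraph (R : realType) := QGraph {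
  nvertices : nat;
  nedges : nat;
  ends : 'I_nedges -> bool -> 'I_nvertices;
  len : 'I_nedges -> R;
  dirichlet : {set 'I_nvertices};
  nedges_gt0 : (0 < nedges)%N;
  len_gt0 : forall e, 0 < len e }.

Notation vertex G := 'I_(nvertices G).
Notation edge G := 'I_(nedges G).

Section QuantumGraph.
Variables (R : realType) (G : qgraph R).

Definition degree (v : vertex G) : nat :=
  #|[pred p : edge G * bool | ends p.1 p.2 == v]|.

Definition leaf (v : vertex G) : bool := degree v == 1%N.

Definition vertex_adj : rel (vertex G) := fun u v =>
  [exists e : edge G, [exists b, (ends e b == u) && (ends e (~~ b) == v)]].

Definition connected_qgraph : Prop :=
  forall u v : vertex G, connect vertex_adj u v.

(* A function on the graph is given by its restrictions to the edges; the
   values of [f e] outside [0, len e] are never used. *)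
Definition gfun := edge G -> R -> R[i].

Definition end_pos (e : edge G) (b : bool) : R := if b then len e else 0.

Definition gL2 (f : gfun) : Prop :=
  forall e, square_integrable `[0, len e] (f e).

Definition ginner (f g : gfun) : R[i] :=
  \sum_(e : edge G) cintegral `[0, len e] (fun x => f e x * conjc (g e x)).

Definition gcontinuous_at_vertices (f : gfun) : Prop :=
  forall e b e' b', ends e b = ends e' b' ->
    f e (end_pos e b) = f e' (end_pos e' b').

(* [f] belongs to H^1 of the graph and has edgewise weak derivative [f'];
   continuity inside the edges is part of [H1_deriv]. *)
Definition gH1_deriv (f f' : gfun) : Prop :=
  (forall e, H1_deriv (len e) (f e) (f' e)) /\ gcontinuous_at_vertices f.

Definition form_domain (f f' : gfun) : Prop :=
  gH1_deriv f f' /\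
  forall e b, ends e b \in dirichlet G -> f e (end_pos e b) = 0.

(* The operator on L^2 associated with the form of f'.conj(g'): [f] is in its
   domain and is mapped to [h]. *)
Definition laplacian (f h : gfun) : Prop :=
  gL2 h /\
  exists2 f', form_domain f f' &
    forall g g', form_domain g g' -> ginner f' g' = ginner h g.

Definition eigenspace_at (mu : R) : set gfun :=
  [set f | laplacian f (fun e x => mu%:C * f e x)].

Definition gfun_eq (f g : gfun) : Prop :=
  forall e x, x \in `[0, len e] -> f e x = g e x.

Definition lincomb d (c : 'I_d -> R[i]) (u : 'I_d -> gfun) : gfun :=
  fun e x => \sum_(i < d) c i * u i e x.

(* The complex dimension of the eigenspace of [mu] is [d]; this is [d = 0]
   when [mu] is not an eigenvalue. *)
Definition has_multiplicity (mu : R) (d : nat) : Prop :=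
  exists u : 'I_d -> gfun,
    [/\ forall i, eigenspace_at mu (u i),
        forall c, gfun_eq (lincomb c u) (fun _ _ => 0) -> forall i, c i = 0 &
        forall f, eigenspace_at mu f -> exists c, gfun_eq f (lincomb c u)].

(* [lam] lists the eigenvalues in nondecreasing order, each repeated according
   to its multiplicity; these conditions determine [lam]. *)
Definition is_spectrum (lam : nat -> R) : Prop :=
  {homo lam : n p / (n <= p)%N >-> n <= p} /\
  forall mu, exists2 d,
    has_multiplicity mu d & ([set n | lam n = mu] #= `I_d)%card.

(* The k-th eigenvalue, [k >= 1]. The default value of [xget] is never used,
   since the Laplacian has discrete spectrum bounded below. *)
Definition eigval (k : nat) : R := xget (fun=> 0) is_spectrum k.-1.

Definition eigratio (k j : nat) : R := eigval k / eigval j.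

Definition admissible (m j : nat) : Prop :=
  [/\ connected_qgraph,
      (nedges G <= m)%N,
      forall v : vertex G, v \in dirichlet G -> leaf v &
      j = 1%N -> exists v : vertex G, v \in dirichlet G].

(* As [admissible], with Dirichlet conditions also permitted at non-leaves. *)
Definition weakly_admissible (m j : nat) : Prop :=
  [/\ connected_qgraph,
      (nedges G <= m)%N &
      j = 1%N -> exists v : vertex G, v \in dirichlet G].

End QuantumGraph.

(* Main.v *)
Require Import Defs.
From HB Require Import structures.
From mathcomp Require Import all_boot all_order all_algebra.
From mathcomp Require Import complex.
From mathcomp Require Import all_classical all_reals all_analysis.
From mathcomp Require Import measurable_realfun.
From mathcomp Require Import zify ring lra.

Set Implicit Arguments.
Unset Strict Implicit.
Unset Printing Implicit Defensive.

Import Order.TTheory GRing.Theory Num.Theory.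
Import numFieldNormedType.Exports.

Local Open Scope classical_set_scope.
Local Open Scope ring_scope.

(** A graph with edges cut into pieces of length h is studied at the nodes only.
    For s h < pi, an eigenfunction for the eigenvalue s^2 is determined by its
    node values, and its form equals an explicit quadratic form of these values,
    whose kernel on the node space is isomorphic to the eigenspace. This form is
    continuous and strictly decreasing in s, so that its Morse index counts the
    eigenvalues in [0, s^2). This gives the existence of the spectrum as well as
    a description of the k-th eigenvalue through finite-dimensional forms.

    For a sequence of graphs of bounded size, normalize the longest edge to 1 and
    pass to the limit along an ultrafilter: the combinatorial type becomes
    constant and the lengths converge. Contract the edges whose length tends to
    0; a class of vertices containing a Dirichlet vertex becomes a Dirichlet
    vertex. A function of bounded form is asymptotically constant on a vanishing
    edge, so by compactness of the unit sphere the Morse indices, hence the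
    eigenvalues, converge to those of the contracted graph. *)

(** * Inertia of symmetric bilinear forms *)

(** For s h < pi the number s^2 lies below the first Dirichlet eigenvalue of every piece, so a
    solution vanishing at both ends of a piece vanishes on it. Written in squared differences and
    squared sums of neighbouring node values, the form has coefficients monotone in s. With N(s) the
    Morse index and M(s) the nullity, this gives N(s) + M(s) <= N(t) for s < t, while continuity
    gives N(t) <= N(s) + M(s) for t near s: N is a step function whose jumps are the multiplicities.
    Cutting all edges into equally many pieces puts the node values of all graphs of one
    combinatorial type into one matrix space. The obstacle in the limit is the coefficient of the
    differences, which diverges on vanishing edges: on vectors constant along these edges it
    multiplies 0, on all others it favours positivity. Ratios are scale invariant, and the longest
    edge survives. The limiting denominator is positive: a connected graph has a kernel of dimension
    at most one, and none with a Dirichlet vertex. Contracting the edge at a Dirichlet leaf may move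
    the condition to a vertex of higher degree, whence the larger class of extremal graphs. *)

Section Inertia.
Variables (R : realType) (vT : vectType R).
Implicit Types (U V W P : {vspace vT}) (b : vT -> vT -> R).

(** A subspace of maximal dimension inside [P] is all of [P], since adjoining a missing vector would
    raise the dimension. This turns linear conditions, stated as predicates, into subspaces. *)
Lemma vspace_of_pred (P : vT -> Prop) :
  P 0 -> (forall a x y, P x -> P y -> P (a *: x + y)) ->
  exists W : {vspace vT}, forall x, x \in W <-> P x.
Proof.
move=> P0 PD.
pose Q n := `[< exists W : {vspace vT}, \dim W = n /\ forall x, x \in W -> P x >].
have exQ : exists n, Q n.
  by exists 0%N; apply/asboolP; exists 0%VS; rewrite dimv0; split=> // x;
    rewrite memv0 => /eqP ->.
have ubQ n : Q n -> (n <= \dim (fullv : {vspace vT}))%N.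
  by move=> /asboolP[W [<- _]]; apply/dimvS/subvf.
case: (ex_maxnP exQ ubQ) => n /asboolP[W [dW WP]] nmax.
exists W => x; split=> [/WP //|Px].
apply: contrapT => /negP xW.
have : Q n.+1.
  apply/asboolP; exists (W + <[x]>)%VS; split.
    rewrite dimv_disjoint_sum ?dW ?dim_vline.
      by case: eqP xW => [->|_ _]; rewrite ?mem0v ?addn1.
    apply/eqP; rewrite -subv0; apply/subvP => y /memv_capP[yW /vlineP[k yk]].
    rewrite memv0 yk; case: (eqVneq k 0) => [->|k0]; first by rewrite scale0r.
    move: xW; rewrite (_ : x = k^-1 *: y) ?memvZ//.
    by rewrite yk scalerA mulVf ?scale1r.
  move=> y /memv_addP[w wW [_ /vlineP[k ->] ->]].
  by rewrite addrC; apply: PD => //; exact: WP.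
by move=> /nmax; rewrite ltnn.
Qed.

Definition symbilinear b :=
  (forall x y, b x y = b y x) /\
  (forall a x y z, b (a *: x + y) z = a * b x z + b y z).

Definition neg_on b W := forall x, x \in W -> x != 0 -> b x x < 0.
Definition pos_on b W := forall x, x \in W -> x != 0 -> 0 < b x x.
Definition radical b U x := x \in U /\ forall y, y \in U -> b x y = 0.

Lemma symbil0 b : symbilinear b -> forall y, b 0 y = 0.
Proof.
by move=> [_ l] y; have := l 1 0 0 y; rewrite scaler0 add0r mul1r; lra.
Qed.

Lemma symbilZ b : symbilinear b -> forall a x y, b (a *: x) y = a * b x y.
Proof.
by move=> h a x y; have := h.2 a x 0 y; rewrite addr0 (symbil0 h) addr0.
Qed.

Lemma symbilD b : symbilinear b -> forall x y z, b (x + y) z = b x z + b y z.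
Proof. by move=> [_ l] x y z; have := l 1 x y z; rewrite scale1r mul1r. Qed.

Lemma symbilDD b : symbilinear b ->
  forall x y, b (x + y) (x + y) = b x x + b x y *+ 2 + b y y.
Proof.
move=> h x y; rewrite symbilD// [b x (x + y)]h.1 [b y (x + y)]h.1 !symbilD//.
by rewrite [b y x]h.1 mulr2n; ring.
Qed.

Lemma dimv_leq_disjoint U V W :
  (V <= U)%VS -> (W <= U)%VS -> (forall x, x \in V -> x \in W -> x = 0) ->
  (\dim V + \dim W <= \dim U)%N.
Proof.
move=> VU WU VW.
rewrite -dimv_disjoint_sum; first by rewrite dimvS// subv_add VU.
apply/eqP; rewrite -subv0; apply/subvP => x /memv_capP[xV xW].
by rewrite (VW x)// mem0v.
Qed.

Lemma orth_split b U v : symbilinear b -> v \in U -> b v v != 0 ->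
  exists U', [/\ (U' <= U)%VS, (\dim U' + 1 = \dim U)%N,
     forall x, x \in U' -> b v x = 0 &
     forall x, x \in U -> exists a y, y \in U' /\ x = a *: v + y].
Proof.
move=> bb vU bvv.
have [||U' U'P] := @vspace_of_pred (fun x => x \in U /\ b v x = 0).
- by rewrite mem0v [b v _]bb.1 symbil0.
- move=> a x y [xU vx] [yU vy]; split; first by rewrite memvD ?memvZ.
  by rewrite bb.1 bb.2 [b x v]bb.1 [b y v]bb.1 vx vy mulr0 addr0.
have v0 : v != 0 by apply: contraNneq bvv => ->; rewrite symbil0.
have spl x : x \in U -> exists a y, y \in U' /\ x = a *: v + y.
  move=> xU; exists (b v x / b v v); exists (x - (b v x / b v v) *: v).
  split; last by rewrite addrC subrK.
  apply/U'P; split; first by rewrite memvB ?memvZ.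
  rewrite bb.1 symbilD// -scaleNr symbilZ// [b x v]bb.1; field.
  exact: bvv.
exists U'; split=> //; first by apply/subvP => x /U'P[].
  have -> : U = (U' + <[v]>)%VS.
    apply/eqP; rewrite eqEsubv subv_add; apply/andP; split; last first.
      by apply/andP; split; [apply/subvP => x /U'P[]|rewrite -memvE].
    apply/subvP => x /spl[a [y [yU' ->]]].
    by rewrite addrC memv_add// memvZ// memv_line.
  rewrite dimv_disjoint_sum ?dim_vline ?v0//.
  apply/eqP; rewrite -subv0; apply/subvP => x /memv_capP[/U'P[_ vx] /vlineP[k xk]].
  move: vx; rewrite xk bb.1 symbilZ// => /eqP.
  by rewrite mulf_eq0 (negPf bvv) orbF => /eqP ->; rewrite scale0r mem0v.
by move=> x /U'P[].
Qed.

(** Induction on the dimension: split off the orthogonal complement of a vector [v] with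
    [b v v != 0]. If there is none, polarization shows that [b] vanishes on [U], and all of [U] is
    radical. *)
Lemma sylvester b U : symbilinear b ->
  exists Wm K Wp : {vspace vT},
  [/\ [/\ (Wm <= U)%VS, (Wp <= U)%VS & (\dim Wm + \dim K + \dim Wp = \dim U)%N],
      forall x, x \in K <-> radical b U x, neg_on b Wm & pos_on b Wp].
Proof.
move=> bb; move: {2}(\dim U) (leqnn (\dim U)) => n.
elim: n U => [|n IHn] U dU.
  have -> : U = 0%VS by apply/eqP; rewrite -dimv_eq0 -leqn0.
  exists 0%VS, 0%VS, 0%VS; rewrite dimv0; split => //.
  - move=> x; split=> [|[//]]; rewrite memv0 => /eqP ->; split; rewrite ?mem0v//.
    by move=> y _; rewrite symbil0.
  - by move=> x; rewrite memv0 => ->.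
  - by move=> x; rewrite memv0 => ->.
case: (pselect (exists v, v \in U /\ b v v != 0)) => [[v [vU bvv]]|nv]; last first.
  exists 0%VS, U, 0%VS; rewrite !sub0v dimv0 addn0; split => //.
  - move=> x; split=> [xU|[//]]; split=> // y yU.
    have b0 z : z \in U -> b z z = 0.
      by move=> zU; apply: contrapT => /eqP zz; apply: nv; exists z.
    have := symbilDD bb x y.
    by rewrite (b0 x)// (b0 y)// (b0 (x + y)) ?memvD// mulr2n; lra.
  - by move=> x; rewrite memv0 => ->.
  - by move=> x; rewrite memv0 => ->.
have [U' [U'U dU' vU' spl]] := orth_split bb vU bvv.
have [|Wm [K [Wp [[mU pU dd] KP nm pp]]]] := IHn U'.
  by rewrite -ltnS -addn1 dU'.
have v0 : v != 0 by apply: contraNneq bvv => ->; rewrite symbil0.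
have vnU' x : x \in U' -> x \in <[v]>%VS -> x = 0.
  move=> xU' /vlineP[k xk]; have := vU' _ xU'.
  rewrite xk bb.1 symbilZ// => /eqP; rewrite mulf_eq0 (negPf bvv) orbF => /eqP ->.
  by rewrite scale0r.
have KP' x : x \in K <-> radical b U x.
  split=> [/KP[xU' xr]|[xU xr]].
    split; first exact: (subvP U'U).
    move=> y /spl[a [z [zU' ->]]]; rewrite bb.1 bb.2 vU'// mulr0 add0r bb.1.
    exact: xr.
  have [a [z [zU' xE]]] := spl x xU.
  have : b x v = 0 by apply: xr.
  rewrite xE bb.2 [b z v]bb.1 (vU' z)// addr0 => /eqP.
  rewrite mulf_eq0 (negPf bvv) orbF => /eqP a0.
  move: xE; rewrite a0 scale0r add0r => xE; apply/KP.
  by split=> [|y yU']; rewrite ?xE// -xE; apply: xr; apply: (subvP U'U).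
have dim1 W : (W <= U')%VS -> \dim (W + <[v]>) = (\dim W).+1.
  move=> WU'; rewrite dimv_disjoint_sum ?dim_vline ?v0 ?addn1//.
  apply/eqP; rewrite -subv0; apply/subvP => x /memv_capP[xW xv].
  by rewrite (vnU' x)// ?mem0v// (subvP WU').
have sub1 W : (W <= U')%VS -> (W + <[v]> <= U)%VS.
  by move=> WU'; rewrite subv_add (subv_trans WU' U'U) -memvE.
have bE w k : w \in U' -> b (w + k *: v) (w + k *: v) = b w w + k ^+ 2 * b v v.
  move=> wU'; rewrite symbilDD// [b w (k *: v)]bb.1 !(symbilZ bb k v) (vU' w)//.
  by rewrite [b v (k *: v)]bb.1 (symbilZ bb) mulr0 mul0rn addr0 mulrA expr2.
case: (ltgtP (b v v) 0) => [vneg|vpos|/eqP]; last by rewrite (negPf bvv).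
- exists (Wm + <[v]>)%VS, K, Wp; split => //.
    by split; rewrite ?sub1 ?(subv_trans pU U'U) ?dim1//; lia.
  move=> _ /memv_addP[w wW [_ /vlineP[k ->] ->]] nz; rewrite bE ?(subvP mU)//.
  case: (eqVneq w 0) => [w0|w0].
    move: nz; rewrite w0 add0r scaler_eq0 negb_or => /andP[k0 _].
    by rewrite symbil0// add0r nmulr_llt0// lt0r sqrf_eq0 k0 sqr_ge0.
  by have := nm _ wW w0; have := sqr_ge0 k; nra.
- exists Wm, K, (Wp + <[v]>)%VS; split => //.
    by split; rewrite ?sub1 ?(subv_trans mU U'U) ?dim1//; lia.
  move=> _ /memv_addP[w wW [_ /vlineP[k ->] ->]] nz; rewrite bE ?(subvP pU)//.
  case: (eqVneq w 0) => [w0|w0].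
    move: nz; rewrite w0 add0r scaler_eq0 negb_or => /andP[k0 _].
    by rewrite symbil0// add0r pmulr_lgt0// lt0r sqrf_eq0 k0 sqr_ge0.
  by have := pp _ wW w0; have := sqr_ge0 k; nra.
Qed.

Definition negdim b U d :=
  `[< exists W, [/\ (W <= U)%VS, \dim W = d & neg_on b W] >].

Definition morse b U : nat := \max_(d < (\dim U).+1 | negdim b U d) d.

(** The radical is a predicate, so its dimension is obtained by choosing a subspace that represents
    it; [nullity_dim] shows that the choice is immaterial. *)
Definition nullity b U : nat :=
  xget 0%N [set d | exists2 K : {vspace vT}, \dim K = d &
    forall x, x \in K <-> radical b U x].

Lemma morse_ge b U W : (W <= U)%VS -> neg_on b W -> (\dim W <= morse b U)%N.
Proof.
move=> WU nW; have lt : (\dim W < (\dim U).+1)%N by rewrite ltnS dimvS.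
apply: (@leq_bigmax_cond _ (fun d : 'I_(\dim U).+1 => negdim b U d)
  (fun d => nat_of_ord d) (Ordinal lt)).
by apply/asboolP; exists W.
Qed.

Lemma morse_witness b U : exists W,
  [/\ (W <= U)%VS, \dim W = morse b U & neg_on b W].
Proof.
have h0 : negdim b U 0.
  apply/asboolP; exists 0%VS; rewrite sub0v dimv0; split => // x.
  by rewrite memv0 => ->.
have : negdim b U (morse b U).
  rewrite /morse; elim/big_ind : _ => // x y; rewrite /maxn; case: ltnP => //.
by move=> /asboolP.
Qed.

(** A negative subspace meets [P] only in 0, so the two dimensions add up inside [U]. Upper bounds
    on Morse indices are obtained in this way, lower bounds by [morse_ge]. *)
Lemma morse_le b U P : (P <= U)%VS -> (forall x, x \in P -> 0 <= b x x) ->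
  (morse b U + \dim P <= \dim U)%N.
Proof.
move=> PU P0; have [W [WU <- nW]] := morse_witness b U.
apply: dimv_leq_disjoint => // x xW xP; apply: contrapT => /eqP x0.
by have := nW x xW x0; rewrite ltNge P0.
Qed.

Lemma nullity_dim b U (K : {vspace vT}) :
  (forall x, x \in K <-> radical b U x) -> nullity b U = \dim K.
Proof.
move=> KP; rewrite /nullity; case: xgetP => [_ -> [K' <- K'P]|]; last first.
  by move/(_ (\dim K)) => []; exists K.
congr (\dim _); apply/eqP; rewrite eqEsubv; apply/andP; split.
  by apply/subvP => x /K'P/KP.
by apply/subvP => x /KP/K'P.
Qed.

Lemma radical_ge b U x : symbilinear b -> radical b U x ->
  forall y, y \in U -> b (y + x) (y + x) = b y y.
Proof.
move=> bb [xU xr] y yU; rewrite symbilDD// [b y x]bb.1 !xr//.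
by rewrite mul0rn !addr0.
Qed.

(** The subspaces on which index comparisons are tested: a form smaller than [b] is compared on
    [Wm + K], a larger one on [K + Wp], and a small perturbation of [b] on [Wm] and [Wp]. *)
Lemma inertia b U : symbilinear b ->
  exists Wm K Wp : {vspace vT},
  [/\ [/\ (Wm <= U)%VS, (K <= U)%VS & (Wp <= U)%VS],
      [/\ neg_on b Wm, pos_on b Wp & forall x, x \in K <-> radical b U x],
      [/\ \dim Wm = morse b U, \dim K = nullity b U &
        (morse b U + nullity b U + \dim Wp = \dim U)%N],
      \dim (Wm + K) = (morse b U + nullity b U)%N /\
      (forall x, x \in (Wm + K)%VS -> b x x <= 0) &
      \dim (K + Wp) = (nullity b U + \dim Wp)%N /\
      (forall x, x \in (K + Wp)%VS -> 0 <= b x x)].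
Proof.
move=> bb; have [Wm [K [Wp [[mU pU dd] KP nm pp]]]] := sylvester U bb.
have KU : (K <= U)%VS by apply/subvP => x /KP[].
have dK : \dim K = nullity b U by rewrite (nullity_dim KP).
have q0 x : x \in K -> b x x = 0 by move=> /KP[xU]; apply.
have le0 x : x \in (Wm + K)%VS -> b x x <= 0.
  move=> /memv_addP[w wW [k /KP kK ->]]; rewrite (radical_ge bb kK) ?(subvP mU)//.
  by case: (eqVneq w 0) => [->|w0]; [rewrite symbil0|apply/ltW/nm].
have ge0 x : x \in (K + Wp)%VS -> 0 <= b x x.
  move=> /memv_addP[k /KP kK [w wW ->]]; rewrite addrC.
  rewrite (radical_ge bb kK) ?(subvP pU)//.
  by case: (eqVneq w 0) => [->|w0]; [rewrite symbil0|apply/ltW/pp].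
have dj1 : \dim (Wm + K) = (\dim Wm + \dim K)%N.
  rewrite dimv_disjoint_sum//; apply/eqP; rewrite -subv0; apply/subvP => x.
  move=> /memv_capP[xm xK]; rewrite memv0; apply: contrapT => /negP x0.
  by have := nm x xm x0; rewrite q0// ltxx.
have dj2 : \dim (K + Wp) = (\dim K + \dim Wp)%N.
  rewrite dimv_disjoint_sum//; apply/eqP; rewrite -subv0; apply/subvP => x.
  move=> /memv_capP[xK xp]; rewrite memv0; apply: contrapT => /negP x0.
  by have := pp x xp x0; rewrite q0// ltxx.
have im : \dim Wm = morse b U.
  apply/eqP; rewrite eqn_leq morse_ge//=.
  have := @morse_le b U (K + Wp)%VS; rewrite subv_add KU pU => /(_ isT ge0).
  by rewrite dj2 -dd -addnA leq_add2r.
exists Wm, K, Wp; split; split => //.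
- by rewrite -im -dK.
- by rewrite dj1 im dK.
- by rewrite dj2 dK.
Qed.

(** On [Wm + K] the form [b] is nonpositive, so the strictly smaller [b'] is negative there. *)
Lemma morse_nullity_le b b' U : symbilinear b ->
  (forall x, x \in U -> x != 0 -> b' x x < b x x) ->
  (morse b U + nullity b U <= morse b' U)%N.
Proof.
move=> bb lt; have [Wm [K [Wp [[mU KU pU] _ _ [<- le0] _]]]] := inertia U bb.
apply: morse_ge; first by rewrite subv_add mU.
move=> x xW x0; apply: lt_le_trans (le0 x xW); apply: lt => //.
by apply: subvP xW; rewrite subv_add mU.
Qed.

End Inertia.

Lemma hom_of_linear (R : realType) (vT wT : vectType R) (f : vT -> wT) :
  linear f -> exists L : 'Hom(vT, wT), forall x, L x = f x.
Proof.
move=> lf; pose fM := GRing.isLinear.Build R vT wT _ f lf.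
by pose fL : {linear vT -> wT} := HB.pack f fM; exists (linfun fL) => x; rewrite lfunE.
Qed.

Lemma morse_transport (R : realType) (vT vT' : vectType R)
    (b : vT -> vT -> R) (b' : vT' -> vT' -> R) (U : {vspace vT}) (U' : {vspace vT'})
    (f : vT -> vT') :
  linear f -> (forall x, x \in U -> f x = 0 -> x = 0) ->
  (forall x, x \in U -> f x \in U' /\ b' (f x) (f x) <= b x x) ->
  (morse b U <= morse b' U')%N.
Proof.
move=> lf inj fU; have [W [WU dW nW]] := morse_witness b U.
have [L LE] := hom_of_linear lf.
have dimW : \dim (L @: W) = \dim W.
  apply: limg_dim_eq; apply/eqP; rewrite -subv0; apply/subvP => x /memv_capP[xW].
  rewrite memv_ker LE memv0 => /eqP fx0; apply/eqP; apply: inj => //.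
  exact: (subvP WU).
rewrite -dW -dimW; apply: morse_ge.
  apply/subvP => _ /memv_imgP[x xW ->]; rewrite LE.
  by have [] := fU x (subvP WU _ xW).
move=> _ /memv_imgP[x xW ->]; rewrite LE => fx0.
apply: le_lt_trans (fU x (subvP WU _ xW)).2 _; apply: nW => //.
apply: contraNneq fx0 => ->.
by rewrite -LE linear0.
Qed.

Lemma morse_ext (R : realType) (vT : vectType R) (b b' : vT -> vT -> R) (U : {vspace vT}) :
  (forall x, x \in U -> (b x x < 0) = (b' x x < 0)) -> morse b U = morse b' U.
Proof.
move=> bb'; apply: eq_bigl => d; apply: asbool_equiv_eq; split=> -[W [WU dW nW]];
  exists W; split=> // x xW x0.
  by rewrite -bb' ?nW// (subvP WU).
by rewrite bb' ?nW// (subvP WU).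
Qed.

(** * Compactness and node forms *)

Lemma cvg_bigsum (R : realType) (T : Type) (F : set_system T) {FF : Filter F}
    (I : Type) (r : seq I) (f : I -> T -> R) (l : I -> R) :
  (forall i, f i x @[x --> F] --> l i) ->
  (\sum_(i <- r) f i x) @[x --> F] --> \sum_(i <- r) l i.
Proof.
move=> fl; elim: r => [|i r IHr].
  under eq_cvg do rewrite big_nil.
  by rewrite big_nil; exact: cvg_cst.
under eq_cvg do rewrite big_cons.
by rewrite big_cons; exact: cvgD.
Qed.

(** A compact segment provides a cluster point, and along an ultrafilter a cluster point is a
    limit. *)
Lemma ultra_bounded_cvg (R : realType) (T : Type) (G : set_system T)
    (f : T -> R) (a b : R) :
  UltraFilter G -> (\forall t \near G, a <= f t <= b) ->
  exists2 l, a <= l <= b & f t @[t --> G] --> l.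
Proof.
move=> GU fab.
have GP : ProperFilter G := ultra_proper.
have [|l [lab lcl]] := @segment_compact R a b (f @ G) _.
  by near=> t; rewrite /= in_itv/=; near: t.
exists l; first by move: lab; rewrite /= in_itv.
move=> B lB; case: (in_ultra_setVsetC (f @^-1` B) GU) => // nB.
by have [y [yB /yB]] := lcl (~` B) B nB lB.
Unshelve. all: by end_near.
Qed.

Section Compactness.
Variables (R : realType) (n m : nat).
Local Notation vT := 'M[R]_(n, m).
Implicit Types x : vT.

Definition sqnorm (x : vT) : R := \sum_i \sum_j x i j ^+ 2.

Lemma sqnorm_ge0 x : 0 <= sqnorm x.
Proof. by apply: sumr_ge0 => i _; apply: sumr_ge0 => j _; exact: sqr_ge0. Qed.

Lemma sqnorm_eq0 x : sqnorm x = 0 -> x = 0.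
Proof.
move=> /eqP; rewrite psumr_eq0; last first.
  by move=> i _; apply: sumr_ge0 => j _; exact: sqr_ge0.
move=> /allP h; apply/matrixP => i j; rewrite mxE.
have := h i (mem_index_enum i); rewrite /= psumr_eq0; last first.
  by move=> k _; exact: sqr_ge0.
by move=> /allP/(_ j (mem_index_enum j)); rewrite /= sqrf_eq0 => /eqP.
Qed.

Lemma sqnormZ c x : sqnorm (c *: x) = c ^+ 2 * sqnorm x.
Proof.
rewrite /sqnorm mulr_sumr; apply: eq_bigr => i _; rewrite mulr_sumr.
by apply: eq_bigr => j _; rewrite mxE exprMn.
Qed.

Lemma entry_le_sqnorm x i j : x i j ^+ 2 <= sqnorm x.
Proof.
rewrite /sqnorm (bigD1 i)//= (bigD1 j)//= -addrA lerDl addr_ge0//.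
  by apply: sumr_ge0 => k _; exact: sqr_ge0.
by apply: sumr_ge0 => k _; apply: sumr_ge0 => l _; exact: sqr_ge0.
Qed.

(** [P] is the kernel of the identity minus the projection onto [P], whose entries are finite linear
    combinations of the entries of its argument and so pass to the limit. *)
Lemma vspace_closed (T : Type) (G : set_system T) (P : {vspace vT})
    (x_ : T -> vT) (x : vT) : ProperFilter G ->
  (forall t, x_ t \in P) -> (forall i j, x_ t i j @[t --> G] --> x i j) ->
  x \in P.
Proof.
move=> GP xP xx; pose L : 'End(vT) := (\1 - projv P)%VF.
have LE (y : vT) : L y = y - projv P y by rewrite !lfunE /= !lfunE.
have Lsum (y : vT) i j :
    L y i j = \sum_k \sum_l y k l * L (delta_mx k l) i j.
  rewrite {1}(matrix_sum_delta y) linear_sum summxE; apply: eq_bigr => k _.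
  by rewrite linear_sum summxE; apply: eq_bigr => l _; rewrite linearZ mxE.
have L0 t : L (x_ t) = 0 by rewrite LE projv_id// subrr.
suff Lx : L x = 0.
  by move/eqP: Lx; rewrite LE subr_eq0 => /eqP ->; rewrite memv_proj.
apply/matrixP => i j; rewrite [in RHS]mxE.
have c1 : L (x_ t) i j @[t --> G] --> L x i j.
  rewrite Lsum; under eq_cvg do rewrite Lsum.
  by apply: cvg_bigsum => k; apply: cvg_bigsum => l; apply: cvgMr_tmp; exact: xx.
have c2 : L (x_ t) i j @[t --> G] --> (0 : R).
  by under eq_cvg do rewrite L0 mxE; exact: cvg_cst.
exact: (cvg_unique _ c1 c2).
Qed.

(* If positivity failed frequently along [F], normalized witnesses would
   converge along an ultrafilter finer than [F]. *)
Lemma near_pos_on (T : Type) (F : set_system T) (q : T -> vT -> R)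
    (P : {vspace vT}) : Filter F ->
  (forall t c x, q t (c *: x) = c ^+ 2 * q t x) ->
  (forall G, UltraFilter G -> F `<=` G -> forall (x_ : T -> vT) x,
     (forall t, x_ t \in P) -> x \in P -> x != 0 ->
     (forall i j, x_ t i j @[t --> G] --> x i j) ->
     ~ (\forall t \near G, q t (x_ t) <= 0)) ->
  \forall t \near F, forall x, x \in P -> x != 0 -> 0 < q t x.
Proof.
move=> FF qZ H; apply: contrapT => nF.
set A := (X in ~ F X) in nF.
have HP : ProperFilter (within (~` A) F).
  apply: (Build_ProperFilter_ex _ (within_filter _ FF)) => B FB.
  apply: contrapT => nB; apply: nF; apply: (@filterS _ F FF _ A _ FB) => t ht.
  by apply: contrapT => nAt; apply: nB; exists t; exact: ht.
have [G [GU HG]] := ultraFilterLemma HP.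
have FG : F `<=` G.
  by move=> B FB; apply: HG; apply: (@filterS _ F FF _ _ _ FB) => t Bt _.
have GA : G (~` A) by apply: HG; apply: (@filterE _ F FF).
(* Where positivity holds there is no witness, and 0 is a placeholder. The bound [sqnorm x <= 1]
   holds for every [t], so that all entries stay in [-1, 1]. *)
have /choice[x_ x_P] : forall t, exists x, [/\ x \in P, sqnorm x <= 1 &
    ~ A t -> sqnorm x = 1 /\ q t x <= 0].
  move=> t; case: (pselect (A t)) => At.
    exists 0; split => //; first exact: mem0v.
    by rewrite /sqnorm big1 ?ler01// => i _; rewrite big1// => j _;
      rewrite mxE expr0n.
  have [x [xP x0 qx]] : exists x, [/\ x \in P, x != 0 & q t x <= 0].
    apply: contrapT => nx; apply: At => x xP x0; rewrite ltNge.
    by apply/negP => qx; apply: nx; exists x.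
  have nx : 0 < sqnorm x.
    rewrite lt_neqAle sqnorm_ge0 andbT eq_sym.
    by apply: contra_neq x0; exact: sqnorm_eq0.
  have e : sqnorm ((Num.sqrt (sqnorm x))^-1 *: x) = 1.
    by rewrite sqnormZ exprVn sqr_sqrtr ?ltW// mulVf// gt_eqF.
  exists ((Num.sqrt (sqnorm x))^-1 *: x); split; first exact: memvZ.
    by rewrite e.
  by move=> _; split=> //; rewrite qZ mulr_ge0_le0// sqr_ge0.
have GP : ProperFilter G := ultra_proper.
have /choice[l l_P] : forall ij : 'I_n * 'I_m, exists l : R,
    x_ t ij.1 ij.2 @[t --> G] --> l.
  move=> [i j]; have [|l _ hl] := @ultra_bounded_cvg R T G
    (fun t => x_ t i j) (-1) 1 GU; last by exists l.
  apply: filterE => t; have [_ h _] := x_P t.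
  by rewrite -ler_norml -[X in _ <= X]normr1 -ler_sqr ?nnegrE// !real_normK ?num_real// expr1n
    (le_trans (entry_le_sqnorm _ _ _)).
pose x : vT := \matrix_(i, j) l (i, j).
have xx i j : x_ t i j @[t --> G] --> x i j by rewrite mxE; exact: (l_P (i, j)).
have xP : x \in P by apply: vspace_closed xx => // t; have [] := x_P t.
have nx : sqnorm x = 1.
  have c1 : sqnorm (x_ t) @[t --> G] --> sqnorm x.
    apply: cvg_bigsum => i; apply: cvg_bigsum => j; rewrite expr2.
    by under eq_cvg do rewrite expr2; apply: cvgM; exact: xx.
  have c2 : sqnorm (x_ t) @[t --> G] --> (1 : R).
    apply: cvg_near_cst; move: GA; apply: filterS => t nAt.
    by have [_ _ /(_ nAt)[]] := x_P t.
  exact: (cvg_unique _ c1 c2).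
have x0 : x != 0.
  apply/eqP => x0; move: nx; rewrite x0 /sqnorm big1; last first.
    by move=> i _; rewrite big1// => j _; rewrite mxE expr0n.
  by move=> /esym/eqP; rewrite oner_eq0.
apply: (H G GU FG x_ x) => //; first by move=> t; have [] := x_P t.
by move: GA; apply: filterS => t nAt; have [_ _ /(_ nAt)[]] := x_P t.
Qed.

End Compactness.

Section NodeForm.
Variables (R : realType) (n p : nat).
Local Notation vT := 'M[R]_(n, p.+1).
Implicit Types (al be : 'I_n -> R) (x y : vT).

Definition nodal x e (i : nat) : R := x e (inord i).
Definition jump x e i := nodal x e i.+1 - nodal x e i.
Definition pairsum x e i := nodal x e i.+1 + nodal x e i.

(* With [al = stiffness s h] and [be = inertance s h], each summand is the form of
   f'^2 - s^2 f^2 for the interpolation a cos(s x) + b sin(s x) between two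
   consecutive nodes at distance h. *)
Definition node_form al be x y : R :=
  \sum_e \sum_(i < p) (al e * (jump x e i * jump y e i)
                     - be e * (pairsum x e i * pairsum y e i)).

Lemma nodalP a x y e i : nodal (a *: x + y) e i = a * nodal x e i + nodal y e i.
Proof. by rewrite /nodal !mxE. Qed.

Lemma jumpP a x y e i : jump (a *: x + y) e i = a * jump x e i + jump y e i.
Proof. by rewrite /jump !nodalP; ring. Qed.

Lemma pairsumP a x y e i :
  pairsum (a *: x + y) e i = a * pairsum x e i + pairsum y e i.
Proof. by rewrite /pairsum !nodalP; ring. Qed.

Lemma node_form_symbilinear al be : symbilinear (node_form al be).
Proof.
split=> [x y|a x y z].
  apply: eq_bigr => e _; apply: eq_bigr => i _.
  by rewrite [jump x e i * _]mulrC [pairsum x e i * _]mulrC.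
rewrite /node_form mulr_sumr -big_split; apply: eq_bigr => e _ /=.
rewrite mulr_sumr -big_split; apply: eq_bigr => i _ /=.
by rewrite jumpP pairsumP; ring.
Qed.

Lemma nodal_eq0 x : (0 < p)%N ->
  (forall e i, (i < p)%N -> jump x e i = 0 /\ pairsum x e i = 0) -> x = 0.
Proof.
move=> p0 h; apply/matrixP => e i; rewrite mxE.
have [ip|pi] := ltnP i p.
  have [] := h e i ip; rewrite /jump /pairsum /nodal inord_val; lra.
have [|] := h e p.-1; first by rewrite prednK.
rewrite /jump /pairsum /nodal prednK// (_ : inord p = i); first by lra.
by apply: val_inj; rewrite /= inordK//; have := ltn_ord i; lia.
Qed.

(** The difference of the two forms is a sum of squares of jumps and pair sums with positive
    weights; if it vanishes, so do all node values. *)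
Lemma node_form_lt al be al' be' x : (0 < p)%N ->
  (forall e, al' e < al e) -> (forall e, be e < be' e) -> x != 0 ->
  node_form al' be' x x < node_form al be x x.
Proof.
move=> p0 lal lbe x0; rewrite -subr_gt0 /node_form -sumrB.
have t_ge0 e (i : 'I_p) :
  0 <= (al e - al' e) * jump x e i ^+ 2 + (be' e - be e) * pairsum x e i ^+ 2.
  by rewrite addr_ge0// mulr_ge0 ?sqr_ge0// subr_ge0 ltW.
have -> : \sum_e (\sum_(i < p) (al e * (jump x e i * jump x e i) -
      be e * (pairsum x e i * pairsum x e i)) -
    \sum_(i < p) (al' e * (jump x e i * jump x e i) -
      be' e * (pairsum x e i * pairsum x e i))) =
  \sum_e \sum_(i < p) ((al e - al' e) * jump x e i ^+ 2
     + (be' e - be e) * pairsum x e i ^+ 2).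
  by apply: eq_bigr => e _; rewrite -sumrB; apply: eq_bigr => i _; ring.
rewrite lt_neqAle; apply/andP; split; last first.
  by apply: sumr_ge0 => e _; apply: sumr_ge0.
rewrite eq_sym; apply: contra_neq x0 => /eqP.
rewrite psumr_eq0 => [/allP h|e _]; last exact: sumr_ge0.
apply: nodal_eq0 => // e i ip; have := h e (mem_index_enum e).
rewrite /= psumr_eq0 => [/allP/(_ (Ordinal ip) (mem_index_enum _))/=|//].
have d1 : 0 < al e - al' e by rewrite subr_gt0.
have d2 : 0 < be' e - be e by rewrite subr_gt0.
rewrite paddr_eq0; last 2 first.
- by rewrite mulr_ge0 ?sqr_ge0 ?ltW.
- by rewrite mulr_ge0 ?sqr_ge0 ?ltW.
by rewrite !mulf_eq0 (gt_eqF d1) (gt_eqF d2) !orbb /= => /andP[/eqP -> /eqP ->].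
Qed.

Lemma node_form_cvg (T : Type) (F : set_system T) {FF : Filter F}
    (al_ be_ : T -> 'I_n -> R) al be (x_ : T -> vT) x :
  (forall e, al_ t e @[t --> F] --> al e) ->
  (forall e, be_ t e @[t --> F] --> be e) ->
  (forall e i, x_ t e i @[t --> F] --> x e i) ->
  node_form (al_ t) (be_ t) (x_ t) (x_ t) @[t --> F] --> node_form al be x x.
Proof.
move=> ca cb cx; apply: cvg_bigsum => e; apply: cvg_bigsum => i.
have cj : jump (x_ t) e i @[t --> F] --> jump x e i by apply: cvgB; exact: cx.
have cs : pairsum (x_ t) e i @[t --> F] --> pairsum x e i.
  by apply: cvgD; exact: cx.
by apply: cvgB; apply: cvgM => //; apply: cvgM.
Qed.

Lemma node_formZ al be c x :
  node_form al be (c *: x) (c *: x) = c ^+ 2 * node_form al be x x.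
Proof.
have h := node_form_symbilinear al be.
by rewrite symbilZ// h.1 symbilZ// mulrA expr2.
Qed.

Lemma node_formN al be x y :
  node_form (fun e => - al e) (fun e => - be e) x y = - node_form al be x y.
Proof.
rewrite /node_form -sumrN; apply: eq_bigr => e _; rewrite -sumrN.
by apply: eq_bigr => i _; ring.
Qed.

Lemma near_node_form_pos (T : Type) (F : set_system T) (al_ be_ : T -> 'I_n -> R)
    al be (P : {vspace vT}) : Filter F ->
  (forall e, al_ t e @[t --> F] --> al e) ->
  (forall e, be_ t e @[t --> F] --> be e) ->
  pos_on (node_form al be) P ->
  \forall t \near F, pos_on (node_form (al_ t) (be_ t)) P.
Proof.
move=> FF ca cb pP.
apply: (near_pos_on (q := fun t x => node_form (al_ t) (be_ t) x x)) => //.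
  by move=> t c x; exact: node_formZ.
move=> G GU FG x_ x xP Px x0 cx le0.
have GP : ProperFilter G := ultra_proper.
have := pP x Px x0; rewrite ltNge => /negP; apply.
apply: cvgr_to_le le0; apply: node_form_cvg => //.
  by move=> e A h; exact/FG/(ca e A h).
by move=> e A h; exact/FG/(cb e A h).
Qed.

Lemma near_node_form_neg (T : Type) (F : set_system T) (al_ be_ : T -> 'I_n -> R)
    al be (P : {vspace vT}) : Filter F ->
  (forall e, al_ t e @[t --> F] --> al e) ->
  (forall e, be_ t e @[t --> F] --> be e) ->
  neg_on (node_form al be) P ->
  \forall t \near F, neg_on (node_form (al_ t) (be_ t)) P.
Proof.
move=> FF ca cb nP.
have pP : pos_on (node_form (fun e => - al e) (fun e => - be e)) P.
  by move=> x xP x0; rewrite node_formN oppr_gt0; exact: nP.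
have := @near_node_form_pos T F (fun t e => - al_ t e) (fun t e => - be_ t e)
  _ _ P FF (fun e => cvgN (ca e)) (fun e => cvgN (cb e)) pP.
move=> /(_ FF FF); apply: filterS => t At x xP x0.
by have := At x xP x0; rewrite node_formN oppr_gt0.
Qed.

End NodeForm.

(** * The coefficients x cot x and x tan x *)

Section Trigo.
Variable R : realType.
Implicit Types x y s h : R.

Lemma MVT_derive (f df : R -> R) x y : x < y ->
  (forall c, x <= c <= y -> is_derive c 1 f (df c)) ->
  exists2 c, x < c < y & f y - f x = df c * (y - x).
Proof.
move=> xy fd; have [||c] := @MVT R f df x y xy.
- by move=> c; rewrite in_itv/= => /andP[xc cy]; apply: fd; rewrite !ltW.
- apply: derivable_within_continuous => c; rewrite in_itv/= => xcy.
  by have [] := fd c xcy.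
by rewrite in_itv/= => xcy e; exists c.
Qed.

Lemma cos_lt1 x : 0 < x -> x < pi / 2 -> cos x < 1.
Proof.
move=> x0 xpi; have s0 : 0 < sin x by apply: sin_gt0_pihalf; rewrite x0.
have := cos2Dsin2 x; have := cos_le1 x; nra.
Qed.

Lemma sin_bounds x : 0 < x -> x < pi / 2 -> x * cos x < sin x <= x.
Proof.
move=> x0 xpi; have [c /andP[c0 cx]] := MVT_derive x0 (fun c _ => is_derive_sin c).
rewrite sin0 !subr0 => ->; have := pi_gt0 R => p0; apply/andP; split; last first.
  by rewrite ler_piMl ?cos_le1// ltW.
by rewrite mulrC ltr_pM2r// ltr_cos// in_itv/=; apply/andP; split; lra.
Qed.

(** The value at 0 is the limit there, so that s = 0 is covered by the same forms. *)
Definition xcotx x : R := if x == 0 then 1 else x * cos x / sin x.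

Lemma xcotx_bounds x : 0 < x -> x < pi / 2 -> cos x <= xcotx x < 1.
Proof.
move=> x0 xpi; have /andP[b1 b2] := sin_bounds x0 xpi.
have s0 : 0 < sin x by apply: sin_gt0_pihalf; rewrite x0.
rewrite /xcotx gt_eqF// ltr_pdivrMr// mul1r b1 andbT ler_pdivlMr// mulrC ler_pM2r//.
by apply: cos_gt0_pihalf; lra.
Qed.

Lemma xcotx_gt0 x : 0 <= x -> x < pi / 2 -> 0 < xcotx x.
Proof.
rewrite le_eqVlt => /orP[/eqP <- _|x0 xpi]; first by rewrite /xcotx eqxx.
have /andP[h _] := xcotx_bounds x0 xpi; apply: lt_le_trans h.
by apply: cos_gt0_pihalf; lra.
Qed.

(** For positive [x] the derivative [(sin c * cos c - c) / sin c ^+ 2] is negative, because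
    [sin c <= c] and [cos c < 1]; for [x = 0] the bound [xcotx y < 1] suffices. *)
Lemma xcotx_decr x y : 0 <= x -> x < y -> y < pi / 2 -> xcotx y < xcotx x.
Proof.
rewrite le_eqVlt => /orP[/eqP <- y0 ypi|x0 xy ypi].
  by rewrite {2}/xcotx eqxx; have /andP[] := xcotx_bounds y0 ypi.
pose df (c : R) := (sin c * cos c - c) / sin c ^+ 2.
have [|c /andP[xc cy]] := @MVT_derive (fun c => c * cos c / sin c) df x y xy.
  move=> c /andP[xc cy].
  have s0 : sin c != 0 by rewrite gt_eqF// sin_gt0_pihalf//; lra.
  have -> : df c = (c * cos c) *: (- sin c ^- 2 *: cos c)
      + (sin c)^-1 *: (c *: (- sin c) + cos c *: 1).
    rewrite /df /GRing.scale/=.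
    have -> : (sin c * cos c - c) = sin c * cos c - c * (cos c ^+ 2 + sin c ^+ 2).
      by rewrite cos2Dsin2 mulr1.
    by field.
  exact: is_deriveM.
rewrite /xcotx !gt_eqF//; last exact: lt_trans xy.
move=> e; rewrite -subr_lt0 e pmulr_llt0 ?subr_gt0// /df.
have c0 : 0 < c by apply: lt_trans xc.
have cpi : c < pi / 2 by apply: lt_trans ypi.
have s0 : 0 < sin c by apply: sin_gt0_pihalf; rewrite c0.
have /andP[_ b2] := sin_bounds c0 cpi.
have := cos_lt1 c0 cpi.
rewrite pmulr_llt0 ?invr_gt0 ?exprn_gt0//; nra.
Qed.

Lemma xcotxN x : xcotx (- x) = xcotx x.
Proof. by rewrite /xcotx oppr_eq0 cosN sinN invrN mulrN mulNr mulNr opprK. Qed.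

Lemma xcotx_cvg x : 0 <= x -> x < pi / 2 -> xcotx y @[y --> x] --> xcotx x.
Proof.
rewrite le_eqVlt => /orP[/eqP <- _|x0 xpi]; last first.
  have s0 : sin x != 0 by rewrite gt_eqF// sin_gt0_pihalf// x0.
  apply: cvg_trans (_ : y * cos y / sin y @[y --> x] --> _).
    apply: near_eq_cvg; near=> y.
    by rewrite /xcotx gt_eqF//; near: y; exact: lt_nbhsr.
  rewrite /xcotx gt_eqF//; apply: cvgM.
    by apply: cvgM; [exact: cvg_id|exact: continuous_cos].
  by apply: cvgV => //; exact: continuous_sin.
have p0 := pi_gt0 R.
(* At 0 the function is squeezed between [cos] and 1; negative arguments reduce to positive ones by
   evenness. *)
rewrite {2}/xcotx eqxx; apply: (@squeeze_cvgr R _ _ R cos (cst 1)).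
- near=> y.
  have yl : `|y| < pi / 2.
    near: y; have p2 : 0 < pi / 2 :> R by lra.
    exact: (@nbhs0_lt R R _ p2).
  case: (ltgtP y 0) => y0.
  + rewrite -xcotxN -cosN; have /andP[-> /ltW ->//] : cos (- y) <= xcotx (- y) < 1.
    by apply: xcotx_bounds; rewrite ?oppr_gt0// -ltr0_norm.
  + have /andP[-> /ltW ->//] : cos y <= xcotx y < 1.
    by apply: xcotx_bounds; rewrite // -(gtr0_norm y0).
  + by rewrite y0 cos0 /xcotx eqxx lexx.
- by rewrite -[X in _ --> X](@cos0 R); exact: continuous_cos.
- exact: cvg_cst.
Unshelve. all: by end_near.
Qed.

(** About the midpoint of a piece of length h, a solution splits into an odd part of energy (s/2)
    cot(s h/2) times the squared jump of the end values, and an even part of energy -(s/2) tan(s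
    h/2) times their squared sum. [stiffness] is the first coefficient, in a form that equals 1/h at
    s = 0; [inertance] is the second one without its sign. *)
Definition stiffness s h : R := xcotx (s * h / 2) / h.
Definition inertance s h : R := s / 2 * tan (s * h / 2).

Lemma stiffness_gt0 s h : 0 <= s -> 0 < h -> s * h < pi -> 0 < stiffness s h.
Proof.
move=> s0 h0 shp; have sh0 : 0 <= s * h by rewrite mulr_ge0// ltW.
by rewrite divr_gt0// xcotx_gt0//; lra.
Qed.

Lemma stiffness_decr s s' h : 0 <= s -> s < s' -> 0 < h -> s' * h < pi ->
  stiffness s' h < stiffness s h.
Proof.
move=> s0 ss' h0 sh; rewrite ltr_pM2r ?invr_gt0//.
have e : s * h < s' * h by rewrite ltr_pM2r.
have sh0 : 0 <= s * h by rewrite mulr_ge0// ltW.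
by apply: xcotx_decr; lra.
Qed.

Lemma inertance_incr s s' h : 0 <= s -> s < s' -> 0 < h -> s' * h < pi ->
  inertance s h < inertance s' h.
Proof.
move=> s0 ss' h0 sh; have e : s * h < s' * h by rewrite ltr_pM2r.
have sh0 : 0 <= s * h by rewrite mulr_ge0// ltW.
have t : tan (s * h / 2) < tan (s' * h / 2).
  by rewrite ltr_tan ?in_itv/=; [lra|apply/andP; split; lra..].
have t0 : 0 <= tan (s * h / 2).
  by apply: divr_ge0; [apply: sin_ge0_pi|apply/ltW/cos_gt0_pihalf]; lra.
rewrite /inertance; nra.
Qed.

Lemma stiffness_cvgs (T : Type) (F : set_system T) {FF : Filter F}
    (s_ h_ : T -> R) s h : 0 <= s -> 0 < h -> s * h < pi ->
  s_ t @[t --> F] --> s -> h_ t @[t --> F] --> h ->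
  stiffness (s_ t) (h_ t) @[t --> F] --> stiffness s h.
Proof.
move=> s0 h0 sh cs ch; apply: cvgM; last by apply: cvgV => //; rewrite gt_eqF.
have sh0 : 0 <= s * h by rewrite mulr_ge0// ltW.
apply: (@cvg_comp _ _ _ (fun t => s_ t * h_ t / 2) xcotx) (xcotx_cvg _ _) => //; try lra.
by apply: cvgMr_tmp; apply: cvgM.
Qed.

Lemma inertance_cvgs (T : Type) (F : set_system T) {FF : Filter F}
    (s_ h_ : T -> R) s h : 0 <= s -> 0 <= h -> s * h < pi ->
  s_ t @[t --> F] --> s -> h_ t @[t --> F] --> h ->
  inertance (s_ t) (h_ t) @[t --> F] --> inertance s h.
Proof.
move=> s0 h0 sh cs ch; have sh0 : 0 <= s * h by rewrite mulr_ge0.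
apply: cvgM; first exact: cvgMr_tmp.
apply: (@cvg_comp _ _ _ (fun t => s_ t * h_ t / 2) tan); last first.
  by apply: continuous_tan; rewrite gt_eqF// cos_gt0_pihalf//; lra.
by apply: cvgMr_tmp; apply: cvgM.
Qed.

(** The stiffness blows up on a vanishing edge. This is what forces a limit of vectors of bounded
    form to be constant there. *)
Lemma stiffness_inv_cvg (T : Type) (F : set_system T) {FF : Filter F}
    (h_ : T -> R) s : 0 <= s -> h_ t @[t --> F] --> 0 ->
  (stiffness s (h_ t))^-1 @[t --> F] --> 0.
Proof.
move=> s0 ch; have p0 := pi_gt0 R.
have c : h_ t * (xcotx (s * h_ t / 2))^-1 @[t --> F] --> 0 * (xcotx (0 : R))^-1.
  apply: cvgM => //; apply: cvgV; first by rewrite /xcotx eqxx oner_eq0.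
  have c0 : s * h_ t / 2 @[t --> F] --> s * 0 / 2.
    by apply: cvgMr_tmp; apply: cvgMl_tmp.
  rewrite mulr0 mul0r in c0.
  by apply: (cvg_comp _ _ c0); apply: xcotx_cvg => //; lra.
rewrite mul0r in c.
by under eq_cvg do rewrite /stiffness invfM invrK mulrC.
Qed.

Lemma stiffness0 h : stiffness 0 h = h^-1.
Proof. by rewrite /stiffness !mul0r /xcotx eqxx mul1r. Qed.

Lemma inertance0 h : inertance 0 h = 0.
Proof. by rewrite /inertance !mul0r. Qed.

Lemma stiffness_scale c s h : c != 0 ->
  stiffness (s / c) (c * h) = stiffness s h / c.
Proof.
move=> c0; rewrite /stiffness mulrA divfK// invfM; ring.
Qed.

Lemma inertance_scale c s h : c != 0 ->
  inertance (s / c) (c * h) = inertance s h / c.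
Proof.
move=> c0; have e : s / c * (c * h) = s * h by rewrite mulrA divfK.
by rewrite /inertance e; ring.
Qed.

(** Half-angle formulas. The right-hand sides are the diagonal entry and minus the off-diagonal
    entry of the Dirichlet-to-Neumann matrix of a piece. *)
Lemma stiffness_inertance s h : 0 < s -> 0 < h -> s * h < pi ->
  stiffness s h - inertance s h = s * cos (s * h) / sin (s * h) /\
  stiffness s h + inertance s h = s / sin (s * h).
Proof.
move=> s0 h0 sh; have sh0 : 0 < s * h by rewrite mulr_gt0.
pose x := s * h / 2; have x0 : 0 < x by rewrite /x; lra.
have xp : x < pi / 2 by rewrite /x; lra.
have sx : 0 < sin x by apply: sin_gt0_pihalf; rewrite x0.
have cx : 0 < cos x by apply: cos_gt0_pihalf; lra.
have -> : s * h = x *+ 2 by rewrite /x mulr2n; lra.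
rewrite cos_mulr2n sin_mulr2n /stiffness /inertance -/x /xcotx gt_eqF// /tan.
have -> : x * cos x / sin x / h = s / 2 * cos x / sin x.
  by rewrite /x; field; rewrite !gt_eqF.
have e := cos2Dsin2 x; have e2 : sin x ^+ 2 = 1 - cos x ^+ 2 by lra.
split.
  rewrite -[cos x ^+ 2 *+ 2 - 1](_ : cos x ^+ 2 - sin x ^+ 2 = _); last by rewrite mulr2n; lra.
  by field; rewrite !gt_eqF.
have -> : s / (cos x * sin x *+ 2) = s * (cos x ^+ 2 + sin x ^+ 2) / (cos x * sin x *+ 2).
  by rewrite e mulr1.
by field; rewrite !gt_eqF.
Qed.

End Trigo.

(** * Integrals on intervals *)

Section IntervalIntegral.
Variable R : realType.
Implicit Types (a b c d x y : R) (f g : R -> R).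

Definition Rint a b f : R := Rintegral lebesgue_measure `[a, b] f.
Definition itg a b f : Prop := lebesgue_measure.-integrable `[a, b] (EFin \o f).

Lemma subset_seg a b c d : a <= c -> d <= b -> `[c, d]%classic `<=` `[a, b]%classic.
Proof.
move=> ac db x /=; rewrite !in_itv/= => /andP[cx xd].
by rewrite (le_trans ac cx) (le_trans xd db).
Qed.

Lemma itgS a b c d f : a <= c -> d <= b -> itg a b f -> itg c d f.
Proof. by move=> ac db; apply: integrableS => //; exact: subset_seg. Qed.

Lemma eq_Rint a b f g : (forall x, a <= x <= b -> f x = g x) -> Rint a b f = Rint a b g.
Proof. by move=> fg; apply: eq_Rintegral => x; rewrite inE/= in_itv/=; exact: fg. Qed.

Lemma eq_itg a b f g : (forall x, a <= x <= b -> f x = g x) -> itg a b f -> itg a b g.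
Proof.
move=> fg; apply: eq_integrable => // x; rewrite inE/= in_itv/= => xab.
by rewrite fg.
Qed.

Lemma Rint_chasles a b c f : a <= c -> c <= b -> itg a b f ->
  Rint a b f = Rint a c f + Rint c b f.
Proof.
move=> ac cb fi.
have := @Rintegral_itvB R f (BLeft a) (BRight b) c fi.
rewrite !bnd_simp => /(_ ac cb); rewrite -/(Rint a b f) -/(Rint a c f) => e.
rewrite -[LHS](subrK (Rint a c f)) e addrC; congr (_ + _).
have := @Rintegral_itv_obnd_cbnd R c (BRight b) f; apply.
apply: (integrableS _ _ _ fi) => //.
  move=> x /=; rewrite !in_itv/= => /andP[cx ->].
  by rewrite (le_trans ac (ltW cx)).
Qed.

Lemma itgD a b f g : itg a b f -> itg a b g -> itg a b (fun x => f x + g x).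
Proof.
by move=> fi gi; apply: (eq_integrable _ _ _ _ (integrableD _ fi gi)).
Qed.

Lemma itgZ a b k f : itg a b f -> itg a b (fun x => k * f x).
Proof.
by move=> fi; apply: (eq_integrable _ _ _ _ (integrableZl _ k fi)).
Qed.

Lemma itgN a b f : itg a b f -> itg a b (fun x => - f x).
Proof. by move=> /(itgZ (-1)); apply: eq_itg => x _; rewrite mulN1r. Qed.

Lemma itgB a b f g : itg a b f -> itg a b g -> itg a b (fun x => f x - g x).
Proof. by move=> fi gi; apply: itgD => //; exact: itgN. Qed.

Lemma RintZ a b k f : itg a b f -> Rint a b (fun x => k * f x) = k * Rint a b f.
Proof. by move=> fi; rewrite /Rint RintegralZl. Qed.

Lemma RintD a b f g : itg a b f -> itg a b g ->
  Rint a b (fun x => f x + g x) = Rint a b f + Rint a b g.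
Proof. by move=> fi gi; rewrite /Rint -RintegralD. Qed.

Lemma RintB a b f g : itg a b f -> itg a b g ->
  Rint a b (fun x => f x - g x) = Rint a b f - Rint a b g.
Proof. by move=> fi gi; rewrite /Rint -RintegralB. Qed.

Lemma itg_norm a b f : itg a b f -> itg a b (fun x => `|f x|).
Proof. by move=> fi; exact: (integrable_abse fi). Qed.

Lemma Rint_norm a b f : itg a b f -> `|Rint a b f| <= Rint a b (fun x => `|f x|).
Proof. by move=> fi; exact: le_normr_Rintegral. Qed.

Lemma le_Rint a b f g : itg a b f -> itg a b g ->
  (forall x, a <= x <= b -> f x <= g x) -> Rint a b f <= Rint a b g.
Proof.
by move=> fi gi fg; apply: le_Rintegral => // x /=; rewrite in_itv/=; exact: fg.
Qed.

Lemma itg_continuous a b f : {within `[a, b], continuous f} -> itg a b f.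
Proof. by move=> cf; apply: continuous_compact_integrable => //; exact: segment_compact. Qed.

Lemma continuous_itg a b f : continuous f -> itg a b f.
Proof. by move=> cf; apply: itg_continuous; exact: continuous_subspaceT. Qed.

Lemma Rint_cst a b k : a <= b -> Rint a b (fun=> k) = k * (b - a).
Proof.
move=> ab; have := @lebesgue_measure_itv R `[a, b].
rewrite /Rint Rintegral_cst//= lte_fin => ->.
case: ltP => // ba; rewrite (_ : b = a) ?subrr//; apply/eqP.
by rewrite eq_le ab ba.
Qed.

Lemma Rint_point a f : Rint a a f = 0.
Proof. by rewrite /Rint set_itv1 Rintegral_set1. Qed.

Lemma Rint_FTC a b (F f : R -> R) : a <= b -> (forall x, is_derive x 1 F (f x)) ->
  continuous f -> Rint a b f = F b - F a.
Proof.
rewrite le_eqVlt => /orP[/eqP <-|ab] dF cf; first by rewrite Rint_point subrr.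
have cF : continuous F.
  move=> x; apply: differentiable_continuous; apply/derivable1_diffP.
  by have [] := dF x.
rewrite /Rint /Rintegral (@continuous_FTC2 _ f F)//.
- exact: continuous_subspaceT.
- split; first by move=> x _; have [] := dF x.
    exact/cvg_at_right_filter/cF.
  exact/cvg_at_left_filter/cF.
- by move=> x _; rewrite derive1E; have [_ ->] := dF x.
Qed.

Lemma itgM_bounded a b f g (M : R) : measurable_fun `[a, b] f ->
  (forall x, a <= x <= b -> `|f x| <= M) -> itg a b g -> itg a b (fun x => f x * g x).
Proof.
move=> mf fM gi.
have := @integrableMr _ _ R lebesgue_measure `[a, b] _ f (EFin \o g) mf _ gi.
apply=> //; exists M; split; first exact: num_real.
move=> N MN x /=; rewrite in_itv/= => xab.
by apply: le_trans (fM x xab) (ltW MN).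
Qed.

Lemma Rint_ge0 a b f : (forall x, a <= x <= b -> 0 <= f x) -> 0 <= Rint a b f.
Proof. by move=> f0; apply: Rintegral_ge0 => x /=; rewrite in_itv/=; exact: f0. Qed.

(* A function whose increments are dominated by products of increments is
   constant: sum over finer and finer subdivisions. *)
Lemma increments_product_cst (F V : R -> R) (C a b : R) : a <= b ->
  (forall c d, a <= c -> c <= d -> d <= b ->
    `|F d - F c| <= C * (d - c) * (V d - V c)) ->
  F b = F a.
Proof.
move=> ab FV.
pose W := C * (b - a) * (V b - V a).
have key n : `|F b - F a| * n.+1%:R <= W.
  pose t (i : nat) := a + (b - a) * (i%:R / n.+1%:R).
  have n0 : (0 : R) < n.+1%:R by rewrite ltr0n.
  have t0 : t 0%N = a by rewrite /t mul0r mulr0 addr0.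
  have tn : t n.+1 = b by rewrite /t divff ?gt_eqF// mulr1 addrC subrK.
  have step i : t i.+1 - t i = (b - a) / n.+1%:R.
    by rewrite /t -[i.+1]addn1 natrD; field; rewrite gt_eqF// ltr_wpDl.
  have tS i : t i <= t i.+1 by rewrite -subr_ge0 step divr_ge0 ?subr_ge0// ltW.
  have tmono : {homo t : i j / (i <= j)%N >-> i <= j}.
    exact/nondecreasing_seqP.
  have -> : F b - F a = \sum_(0 <= i < n.+1) (F (t i.+1) - F (t i)).
    by rewrite telescope_sumr// t0 tn.
  have -> : W = (\sum_(0 <= i < n.+1) C * ((b - a) / n.+1%:R) * (V (t i.+1) - V (t i)))
      * n.+1%:R.
    by rewrite -mulr_sumr telescope_sumr// t0 tn /W; field; rewrite gt_eqF// ltr_wpDl.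
  rewrite ler_pM2r//; apply: le_trans (ler_norm_sum _ _ _) _.
  rewrite !big_nat; apply: ler_sum => i /andP[_ iln]; rewrite -(step i).
  by apply: FV; [rewrite -t0 tmono|exact: tS|rewrite -tn tmono].
apply/eqP; rewrite -subr_eq0 -normr_eq0 eq_le normr_ge0 andbT.
rewrite leNgt; apply/negP => pos; set e := `|_| in pos key.
have := unstable.ltr_norm_bound (W / e); rewrite ltNge => /negP; apply.
case: (Num.Def.archi_bound _) => [|n]; first exact: normr_ge0.
by apply: le_trans (ler_norm _); rewrite ler_pdivlMr// mulrC.
Qed.

Definition primitive_of a b g g' := forall x, a <= x <= b -> g x = g a + Rint a x g'.

Lemma primitive_of_sub a b c d g g' : a <= c -> c <= d -> d <= b -> itg a b g' ->
  primitive_of a b g g' -> primitive_of c d g g'.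
Proof.
move=> ac cd db gi gP x /andP[cx xd].
have xb := le_trans xd db; have ax := le_trans ac cx.
have cb := le_trans cx xb.
rewrite (gP x) ?ax// (gP c) ?ac// -addrA; congr (_ + _).
by apply: Rint_chasles => //; exact: itgS gi.
Qed.

Lemma primitive_continuous a b g g' : a <= b -> itg a b g' ->
  primitive_of a b g g' -> {within `[a, b], continuous g}.
Proof.
move=> ab gi gP.
apply: (@subspace_eq_continuous _ _ _ (fun x => g a + Rint a x g')).
  by move=> x; rewrite inE/= in_itv/= => xab; exact/esym/gP.
move=> x; apply: cvgD; first exact: cvg_cst.
exact: (parameterized_integral_continuous ab gi).
Qed.

Lemma within_mul a b f g : {within `[a, b], continuous f} ->
  {within `[a, b], continuous g} -> {within `[a, b], continuous (fun x => f x * g x)}.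
Proof. by move=> cf cg x; apply: cvgM; [exact: cf|exact: cg]. Qed.

Lemma continuous_itgM a b f g : continuous f -> itg a b g -> itg a b (fun x => f x * g x).
Proof.
move=> cf gi.
have cw : {within `[a, b], continuous f} by exact: continuous_subspaceT.
have : compact (f @` `[a, b]).
  by apply: continuous_compact => //; exact: segment_compact.
move=> /compact_bounded[M [_ Mb]].
apply: (@itgM_bounded _ _ _ _ (M + 1)) => //.
  by apply: measurable_realfun.subspace_continuous_measurable_fun.
by move=> x xab; apply: (Mb (M + 1)); [rewrite ltrDl|exists x; rewrite //= in_itv].
Qed.

(** [g] is only known as the primitive of an integrable function. The difference [F] of both sides,
    as a function of the right end, has increments bounded by the interval length times the
    increment of the integral of |g'|, so [increments_product_cst] applies. *)
Lemma by_parts a b (phi phi' g g' : R -> R) (M : R) : a <= b ->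
  (forall x, is_derive x 1 phi (phi' x)) -> continuous phi' ->
  (forall x, `|phi' x| <= M) ->
  itg a b g' -> primitive_of a b g g' ->
  Rint a b (fun x => phi x * g' x)
    = phi b * g b - phi a * g a - Rint a b (fun x => phi' x * g x).
Proof.
move=> ab dphi cphi' phiM gi gP.
have cphi : continuous phi.
  by move=> x; apply: differentiable_continuous; apply/derivable1_diffP; have [] := dphi x.
have M0 : 0 <= M by apply: le_trans (phiM 0).
have cg := primitive_continuous ab gi gP.
have i1 : itg a b (fun x => phi x * g' x) by exact: continuous_itgM.
have i2 : itg a b (fun x => phi' x * g x).
  by apply: itg_continuous; apply: within_mul => //; exact: continuous_subspaceT.
pose F x := phi x * g x - Rint a x (fun x => phi' x * g x) - Rint a x (fun x => phi x * g' x).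
pose V x := Rint a x (fun x => `|g' x|).
have : F b = F a.
  apply: (@increments_product_cst F V (M + M)) => // c d ac cd db.
  have cb := le_trans cd db; have ad := le_trans ac cd.
  have gcd : itg c d g' by apply: itgS gi.
  have pcd := primitive_of_sub ac cd db gi gP.
  have ch f : itg a b f -> Rint a d f = Rint a c f + Rint c d f.
    by move=> fi; apply: Rint_chasles => //; apply: itgS fi.
  have V0 : 0 <= Rint c d (fun x => `|g' x|) by apply: Rint_ge0.
  have -> : V d - V c = Rint c d (fun x => `|g' x|).
    rewrite /V (ch (fun x => `|g' x|)); first by ring.
    exact: itg_norm.
  (* The increment of [F] over [c, d] is the integral of [H]: inserting the constants [phi d] and
     [g c] makes each term a product of two small factors. Each term contributes one [M] to the
     constant [M + M]. *)
  pose H x := (phi d - phi x) * g' x - phi' x * (g x - g c).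
  have iH1 : itg c d (fun x => (phi d - phi x) * g' x).
    apply: continuous_itgM => // x; apply: cvgB; [exact: cvg_cst|exact: cphi].
  have iH2 : itg c d (fun x => phi' x * (g x - g c)).
    apply: (@eq_itg _ _ (fun x => phi' x * g x - g c * phi' x)).
      by move=> x _; ring.
    apply: itgB; first exact: itgS i2.
    by apply: itgZ; exact: continuous_itg.
  have iH : itg c d H by exact: itgB.
  have -> : F d - F c = Rint c d H.
    rewrite /F (ch _ i1) (ch _ i2) /H RintB//.
    have -> : Rint c d (fun x => (phi d - phi x) * g' x)
        = phi d * Rint c d g' - Rint c d (fun x => phi x * g' x).
      rewrite -RintZ// -RintB; [|exact: itgZ|exact: itgS i1].
      by apply: eq_Rint => x _; ring.
    have -> : Rint c d (fun x => phi' x * (g x - g c))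
        = Rint c d (fun x => phi' x * g x) - g c * (phi d - phi c).
      rewrite -(Rint_FTC cd dphi cphi') -RintZ; last exact: continuous_itg.
      rewrite -RintB; [|exact: itgS i2|by apply: itgZ; exact: continuous_itg].
      by apply: eq_Rint => x _; ring.
    have -> : g d = g c + Rint c d g' by apply: pcd; rewrite cd lexx.
    ring.
  apply: le_trans (Rint_norm iH) _.
  pose B x := M * (d - c) * `|g' x| + M * Rint c d (fun x => `|g' x|).
  have iB : itg c d B.
    apply: itgD; first by apply: itgZ; exact: itg_norm.
    by apply: continuous_itg => x; exact: cvg_cst.
  apply: le_trans (_ : Rint c d B <= _).
    apply: le_Rint => //; first exact: itg_norm.
    move=> x /andP[cx xd]; apply: le_trans (ler_normB _ _) _; apply: lerD.
      rewrite normrM ler_wpM2r//.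
      have := xd; rewrite le_eqVlt => /orP[/eqP ->|xd'].
        by rewrite subrr normr0 mulr_ge0// subr_ge0.
      have [y _ ->] := MVT_derive xd' (fun y _ => dphi y).
      rewrite normrM; apply: ler_pM => //.
      by rewrite ger0_norm ?subr_ge0// lerB.
    rewrite normrM; apply: ler_pM => //.
    have -> : g x - g c = Rint c x g' by rewrite (pcd x) ?cx// addrC addKr.
    apply: le_trans (Rint_norm _) _; first exact: itgS gcd.
    rewrite [leRHS](@Rint_chasles _ _ x)//; last exact: itg_norm.
    by rewrite lerDl; exact: Rint_ge0.
  rewrite /B RintD; [|by apply: itgZ; exact: itg_norm|].
    by rewrite RintZ ?Rint_cst//; [lra|exact: itg_norm].
  by apply: continuous_itg => x; exact: cvg_cst.
by rewrite /F !Rint_point; lra.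
Qed.

End IntervalIntegral.

(** * Sobolev functions and the energy form on an edge *)

Section EdgeSobolev.
Variable R : realType.
Implicit Types (l x y mu s c : R) (f g u : R -> R).

Definition sqint l f := real_square_integrable `[0, l] f.

Definition rH1 l g g' := sqint l g' /\ primitive_of 0 l g g'.

Lemma sqint_mul l f g : sqint l f -> sqint l g -> itg 0 l (fun x => f x * g x).
Proof.
move=> [mf f2] [mg g2].
have f2' : itg 0 l (fun x => f x ^+ 2) by [].
have g2' : itg 0 l (fun x => g x ^+ 2) by [].
apply: (le_integrable _ _ _ (itgD f2' g2')) => //.
  by apply/measurable_realfun.measurable_EFinP; exact: measurable_funM.
move=> x _ /=; rewrite lee_fin normrM.
rewrite [leRHS]ger0_norm ?addr_ge0 ?sqr_ge0//.
rewrite -(real_normK (num_real (f x))) -(real_normK (num_real (g x))).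
by have := normr_ge0 (f x); have := normr_ge0 (g x); nra.
Qed.

Lemma sqint_cst l c : sqint l (fun=> c).
Proof.
split; first exact: measurable_cst.
by apply: (@continuous_itg _ _ _ (fun=> c ^+ 2)) => x; exact: cvg_cst.
Qed.

Lemma sqint_itg l f : sqint l f -> itg 0 l f.
Proof.
move=> lf; apply: eq_itg (sqint_mul lf (sqint_cst l 1)) => x _.
by rewrite mulr1.
Qed.

Lemma sqint_lin l k f g : sqint l f -> sqint l g -> sqint l (fun x => k * f x + g x).
Proof.
move=> lf lg; have [mf f2] := lf; have [mg g2] := lg; split.
  by apply: measurable_funD => //; apply: measurable_funM => //.
have h1 : itg 0 l (fun x => k ^+ 2 * f x ^+ 2) by exact: itgZ.
have h2 : itg 0 l (fun x => (k *+ 2) * (f x * g x)).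
  by apply: itgZ; exact: sqint_mul.
apply: eq_itg (itgD (itgD h1 h2) (g2 : itg 0 l _)) => x _.
by rewrite mulr2n; ring.
Qed.

Lemma sqint_continuous l f : {within `[0, l], continuous f} -> sqint l f.
Proof.
move=> cf; split; first exact: measurable_realfun.subspace_continuous_measurable_fun.
by apply: (@itg_continuous _ _ _ (fun x => f x ^+ 2)); exact: within_mul.
Qed.

Lemma rH1_continuous l g g' : 0 <= l -> rH1 l g g' -> {within `[0, l], continuous g}.
Proof. by move=> l0 [/sqint_itg gi gP]; exact: primitive_continuous gP. Qed.

Lemma rH1_sqint l g g' : 0 <= l -> rH1 l g g' -> sqint l g.
Proof. by move=> l0 gH; apply: sqint_continuous; exact: rH1_continuous gH. Qed.

Lemma rH1_lin l k f f' g g' : rH1 l f f' -> rH1 l g g' ->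
  rH1 l (fun x => k * f x + g x) (fun x => k * f' x + g' x).
Proof.
move=> [sf fP] [sg gP]; split; first exact: sqint_lin.
move=> x x0l; have /andP[x0 xl] := x0l.
have fi : itg 0 x f' by apply: itgS (sqint_itg sf).
have gi : itg 0 x g' by apply: itgS (sqint_itg sg).
by rewrite fP// gP// RintD ?RintZ//; [ring|exact: itgZ].
Qed.

Lemma rH1_cst l c : 0 <= l -> rH1 l (fun=> c) (fun=> 0).
Proof.
move=> l0; split; first exact: sqint_cst.
by move=> x /andP[x0 _]; rewrite Rint_cst// mul0r addr0.
Qed.

Definition energy l mu u u' g g' : R :=
  Rint 0 l (fun x => u' x * g' x) - mu * Rint 0 l (fun x => u x * g x).

Lemma energyC l mu u u' g g' : energy l mu u u' g g' = energy l mu g g' u u'.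
Proof.
by congr (_ - mu * _); apply: eq_Rint => x _; rewrite mulrC.
Qed.

Lemma energy_lin l mu k u u' v v' g g' : 0 <= l ->
  rH1 l u u' -> rH1 l v v' -> rH1 l g g' ->
  energy l mu (fun x => k * u x + v x) (fun x => k * u' x + v' x) g g'
    = k * energy l mu u u' g g' + energy l mu v v' g g'.
Proof.
move=> l0 hu hv hg; rewrite /energy.
have e f f2 f3 : sqint l f -> sqint l f2 -> sqint l f3 ->
    Rint 0 l (fun x => (k * f x + f2 x) * f3 x)
    = k * Rint 0 l (fun x => f x * f3 x) + Rint 0 l (fun x => f2 x * f3 x).
  move=> h1 h2 h3; rewrite -RintZ -?RintD//; try exact: sqint_mul.
    by apply: eq_Rint => x _; ring.
  by apply: itgZ; exact: sqint_mul.
rewrite (e u' v' g' hu.1 hv.1 hg.1).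
rewrite (e u v g (rH1_sqint l0 hu) (rH1_sqint l0 hv) (rH1_sqint l0 hg)).
by ring.
Qed.

Definition trunc y f x : R := (y <= x)%R%:R * f x.

Lemma measurable_step l y : measurable_fun `[0, l] (fun x => (y <= x)%R%:R : R).
Proof.
rewrite (_ : (fun x => _) = (\1_(`[y, +oo[%classic : set R) : R -> R)).
  by apply: measurable_realfun.measurable_indic.
by apply/funext => x; rewrite indicE; congr (_%:R); rewrite mem_setE in_itv/= andbT.
Qed.

Lemma itg_trunc l y f : itg 0 l f -> itg 0 l (trunc y f).
Proof.
apply: (@itgM_bounded _ _ _ _ _ 1); first exact: measurable_step.
by move=> x _; case: (y <= x); rewrite ?normr1 ?normr0.
Qed.

Lemma sqint_trunc l y f : sqint l f -> sqint l (trunc y f).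
Proof.
move=> [mf f2]; split; first by apply: measurable_funM => //; exact: measurable_step.
have := @itg_trunc l y (fun x => f x ^+ 2) f2; apply: eq_itg => x _.
by rewrite /trunc exprMn; case: (y <= x); rewrite ?expr1n// expr0n.
Qed.

Lemma Rint_trunc l y f : 0 <= y -> y <= l -> itg 0 l f ->
  Rint 0 l (trunc y f) = Rint y l f.
Proof.
move=> y0 yl fi; have ti := itg_trunc y fi.
rewrite (Rint_chasles y0 yl ti) [X in _ + X](@eq_Rint _ _ _ _ f); last first.
  by move=> x /andP[yx _]; rewrite /trunc yx mul1r.
rewrite (_ : Rint 0 y _ = 0) ?add0r//.
have tiy : itg 0 y (trunc y f) by apply: itgS ti.
rewrite /Rint -(@Rintegral_itv_bndo_bndc R (BLeft 0) y (trunc y f)).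
  rewrite (@eq_Rintegral _ _ _ _ _ (fun=> 0)); last first.
    by move=> x; rewrite inE/= in_itv/= => /andP[_ xy]; rewrite /trunc leNgt xy mul0r.
  by rewrite /Rintegral integral0.
by apply: (integrableS _ _ _ tiy) => //; apply: subset_itvl; rewrite bnd_simp.
Qed.

(** The truncation creates no jump: either nothing is cut off, or the cut is at a zero of [phi]. *)
Lemma trunc_rH1 l y phi phi' : 0 <= y -> y <= l ->
  (forall x, is_derive x 1 phi (phi' x)) -> continuous phi' ->
  y = 0 \/ phi y = 0 -> rH1 l (trunc y phi) (trunc y phi').
Proof.
move=> y0 yl dphi cphi yphi.
have sq : sqint l phi' by apply: sqint_continuous; exact: continuous_subspaceT.
split; first exact: sqint_trunc.
move=> x /andP[x0 xl]; case: (leP y x) => yx.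
  rewrite Rint_trunc//; last exact: continuous_itg.
  rewrite (Rint_FTC yx dphi cphi) /trunc yx mul1r.
  have [y00|y00] := leP y 0; last first.
    case: yphi => [y00'|->]; first by rewrite y00' ltxx in y00.
    by rewrite mul0r subr0 add0r.
  have -> : y = 0 by apply/eqP; rewrite eq_le y00.
  by rewrite mul1r addrC subrK.
rewrite /trunc [y <= x]leNgt yx mul0r (@eq_Rint _ _ _ _ (fun=> 0)); last first.
  move=> z /andP[_ zx]; rewrite leNgt (_ : z < y) ?mul0r//.
  exact: le_lt_trans zx yx.
rewrite Rint_cst// mul0r addr0; case: (leP y 0) => y0'; last by rewrite mul0r.
by have := lt_le_trans yx y0'; rewrite ltNge x0.
Qed.

(** Since phi'' = - mu phi, integration by parts of phi' against g' cancels the mass term and leaves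
    the boundary terms at [y] and [l]. *)
Lemma energy_trunc l y mu phi phi' (M : R) g g' : 0 <= y -> y <= l ->
  (forall x, is_derive x 1 phi (phi' x)) ->
  (forall x, is_derive x 1 phi' (- mu * phi x)) ->
  (forall x, `|- mu * phi x| <= M) -> rH1 l g g' ->
  energy l mu (trunc y phi) (trunc y phi') g g' = phi' l * g l - phi' y * g y.
Proof.
move=> y0 yl dphi dphi' phiM [sg gP]; have l0 := le_trans y0 yl.
have dc (h h' : R -> R) : (forall x, is_derive x 1 h (h' x)) -> continuous h.
  by move=> dh x; apply: differentiable_continuous; apply/derivable1_diffP; have [] := dh x.
have cphi := dc _ _ dphi; have cphi' := dc _ _ dphi'.
have gi := sqint_itg sg.
have cg := primitive_continuous l0 gi gP.
have ig : itg 0 l g by exact: itg_continuous.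
rewrite /energy.
have te f1 f2 : continuous f1 -> itg 0 l f2 ->
    Rint 0 l (fun x => trunc y f1 x * f2 x) = Rint y l (fun x => f1 x * f2 x).
  move=> c1 i2; rewrite -(Rint_trunc y0 yl (continuous_itgM c1 i2)).
  by apply: eq_Rint => x _; rewrite /trunc mulrA.
rewrite !te//.
have gyl := primitive_of_sub y0 yl (lexx l) gi gP.
have giy : itg y l g' by apply: itgS gi.
have cmu : continuous (fun x => - mu * phi x).
  by move=> x; apply: cvgMl_tmp; exact: cphi.
rewrite (by_parts yl dphi' cmu phiM giy gyl).
have -> : Rint y l (fun x => - mu * phi x * g x) = - mu * Rint y l (fun x => phi x * g x).
  rewrite -RintZ; first by apply: eq_Rint => x _; rewrite mulrA.
  by apply: continuous_itgM => //; apply: itgS ig.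
by ring.
Qed.

(** The phase [pi / 2] gives the cosine, the phase [- (s * y)] the sine that vanishes at [y]. *)
Definition wave s c x : R := sin (s * x + c).
Definition dwave s c x : R := s * cos (s * x + c).

Lemma is_derive_wave s c x : is_derive x 1 (wave s c) (dwave s c x).
Proof.
have h : is_derive x 1 (fun x => s * x + c) (s * 1 + 0).
  apply: is_deriveD.
have -> : dwave s c x = cos (s * x + c) * (s * 1 + 0) by rewrite /dwave; ring.
exact: (@is_derive1_comp _ sin (fun x => s * x + c) x _ _ (is_derive_sin _) h).
Qed.

Lemma is_derive_dwave s c x : is_derive x 1 (dwave s c) (- s ^+ 2 * wave s c x).
Proof.
have h : is_derive x 1 (fun x => s * x + c) (s * 1 + 0).
  apply: is_deriveD.
have := @is_derive1_comp _ cos (fun x => s * x + c) x _ _ (is_derive_cos _) h.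
move=> h2; have := is_deriveZ s h2.
rewrite mulr1 addr0 /GRing.scale/= /wave => h3.
by rewrite (_ : - s ^+ 2 * _ = s * (- sin (s * x + c) * s))//; ring.
Qed.

Lemma continuous_dwave s c : continuous (dwave s c).
Proof.
move=> x; apply: differentiable_continuous; apply/derivable1_diffP.
by have [] := is_derive_dwave s c x.
Qed.

Lemma energy_wave l s y c g g' : 0 <= y -> y <= l -> rH1 l g g' ->
  energy l (s ^+ 2) (trunc y (wave s c)) (trunc y (dwave s c)) g g'
    = dwave s c l * g l - dwave s c y * g y.
Proof.
move=> y0 yl; apply: (@energy_trunc _ _ _ _ _ (s ^+ 2)) => //.
- by move=> x; exact: is_derive_wave.
- by move=> x; exact: is_derive_dwave.
- move=> x; rewrite normrM normrN (ger0_norm (sqr_ge0 s)).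
  by apply: ler_piMr; [exact: sqr_ge0|exact: sin_max].
Qed.

Lemma wave_rH1 l s y c : 0 <= y -> y <= l -> y = 0 \/ wave s c y = 0 ->
  rH1 l (trunc y (wave s c)) (trunc y (dwave s c)).
Proof.
move=> y0 yl h; apply: trunc_rH1 => //; last exact: continuous_dwave.
by move=> x; exact: is_derive_wave.
Qed.

End EdgeSobolev.

(** * Trigonometric interpolation on an edge *)

Section Interpolation.
Variable R : realType.
Implicit Types (l x y mu s c h : R) (f g u : R -> R) (a b : nat -> R).

Lemma energy_sum l mu (I : Type) (r : seq I) (k : I -> R) (F F' : I -> R -> R) :
  0 <= l -> (forall i, rH1 l (F i) (F' i)) ->
  rH1 l (fun x => \sum_(i <- r) k i * F i x) (fun x => \sum_(i <- r) k i * F' i x) /\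
  forall g g', rH1 l g g' ->
  energy l mu (fun x => \sum_(i <- r) k i * F i x) (fun x => \sum_(i <- r) k i * F' i x) g g'
  = \sum_(i <- r) k i * energy l mu (F i) (F' i) g g'.
Proof.
move=> l0 FH; elim: r => [|i r [IH1 IH2]].
  have -> : (fun x => \sum_(i <- [::]) k i * F i x) = fun=> 0.
    by apply/funext => x; rewrite big_nil.
  have -> : (fun x => \sum_(i <- [::]) k i * F' i x) = fun=> 0.
    by apply/funext => x; rewrite big_nil.
  split; first exact: rH1_cst.
  move=> g g' gH; rewrite big_nil /energy.
  have e f : Rint 0 l (fun x => 0 * f x) = 0.
    by rewrite (@eq_Rint _ _ _ _ (fun=> 0)) ?Rint_cst ?mul0r// => x _; rewrite mul0r.
  by rewrite !e mulr0 subr0.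
have e (f : I -> R -> R) : (fun x => \sum_(j <- i :: r) k j * f j x)
    = (fun x => k i * f i x + \sum_(j <- r) k j * f j x).
  by apply/funext => x; rewrite big_cons.
rewrite !e; split; first exact: rH1_lin.
by move=> g g' gH; rewrite big_cons energy_lin// IH2.
Qed.

Definition tsin s y := trunc y (wave s (- (s * y))).
Definition dtsin s y := trunc y (dwave s (- (s * y))).

Lemma tsinE s y x : y <= x -> tsin s y x = sin (s * x - s * y).
Proof. by move=> yx; rewrite /tsin /trunc yx mul1r. Qed.

Lemma tsin_lt s y x : x < y -> tsin s y x = 0.
Proof. by move=> xy; rewrite /tsin /trunc leNgt xy mul0r. Qed.

Lemma tsin_le s y x : x <= y -> tsin s y x = 0.
Proof.
rewrite le_eqVlt => /orP[/eqP ->|]; last exact: tsin_lt.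
by rewrite tsinE// subrr sin0.
Qed.

Lemma tsin_rH1 l s y : 0 <= y -> y <= l -> rH1 l (tsin s y) (dtsin s y).
Proof.
by move=> y0 yl; apply: wave_rH1 => //; right; rewrite /wave subrr sin0.
Qed.

Lemma energy_tsin l s y g g' : 0 <= y -> y <= l -> rH1 l g g' ->
  energy l (s ^+ 2) (tsin s y) (dtsin s y) g g'
    = s * (cos (s * l - s * y) * g l - g y).
Proof.
move=> y0 yl gH; rewrite energy_wave// /dwave subrr cos0.
by ring.
Qed.

(* The test function is continuous, solves the eigenvalue equation except at
   x, y, z, and is supported in [x, z]; testing with it recovers the value of an
   eigenfunction at y from those at x and z. *)
Lemma kink_test l s x y z : 0 <= x -> x <= y -> y <= z -> z <= l ->
  exists k k', [/\ rH1 l k k', k 0 = 0, k l = 0 & forall g g', rH1 l g g' ->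
    energy l (s ^+ 2) k k' g g' = s * (sin (s * z - s * x) * g y
       - sin (s * z - s * y) * g x - sin (s * y - s * x) * g z)].
Proof.
move=> x0 xy yz zl.
have y0 := le_trans x0 xy; have z0 := le_trans y0 yz.
have l0 := le_trans z0 zl; have yl := le_trans yz zl; have xl := le_trans xy yl.
pose A := sin (s * z - s * y); pose B := - sin (s * z - s * x).
pose C := sin (s * y - s * x).
have hx := @tsin_rH1 l s x x0 xl.
have hy := @tsin_rH1 l s y y0 yl.
have hz := @tsin_rH1 l s z z0 zl.
exists (fun t => A * tsin s x t + (B * tsin s y t + (C * tsin s z t + 0))).
exists (fun t => A * dtsin s x t + (B * dtsin s y t + (C * dtsin s z t + 0))).
have h0 := @rH1_cst R l 0 l0.
have h1 := rH1_lin C hz h0.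
have h2 := rH1_lin B hy h1.
have h3 := rH1_lin A hx h2.
split => //.
- by rewrite !tsin_le// !mulr0 !addr0.
- rewrite !tsinE// /A /B /C !sinB; ring.
move=> g g' gH; rewrite energy_lin// energy_lin// energy_lin// !energy_tsin//.
have -> : energy l (s ^+ 2) (fun=> 0) (fun=> 0) g g' = 0.
  rewrite /energy.
  have e f : Rint 0 l (fun x => 0 * f x) = 0.
    by rewrite (@eq_Rint _ _ _ _ (fun=> 0)) ?Rint_cst ?mul0r// => t _; rewrite mul0r.
  by rewrite !e mulr0 subr0.
rewrite /A /B /C !sinB !cosB; ring.
Qed.

Variables (s h : R) (p : nat).
Local Notation l := (p%:R * h).
Local Notation theta := (s * h).

(* The interpolation of [a] is a cosine plus sines [tsin s y] truncated to the right
   of the nodes; the jump of its derivative at an inner node is [s * coef a i]. *)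
Definition coef a i : R :=
  if i is i'.+1 then (a i.+1 + a i' - 2 * cos theta * a i) / sin theta
  else (a 1%N - cos theta * a 0%N) / sin theta.

Definition interp a x : R := a 0%N * trunc 0 (wave s (pi / 2)) x
  + \sum_(i <- iota 0 p) coef a i * tsin s (i%:R * h) x.

Definition dinterp a x : R := a 0%N * trunc 0 (dwave s (pi / 2)) x
  + \sum_(i <- iota 0 p) coef a i * dtsin s (i%:R * h) x.

Lemma coef_lin k a b i :
  coef (fun j => k * a j + b j) i = k * coef a i + coef b i.
Proof. by case: i => [|i] /=; ring. Qed.

Lemma interp_lin k a b x :
  interp (fun j => k * a j + b j) x = k * interp a x + interp b x.
Proof.
rewrite /interp; under eq_bigr do rewrite coef_lin mulrDl -mulrA.
by rewrite big_split/= -mulr_sumr; ring.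
Qed.

Hypotheses (s0 : 0 < s) (h0 : 0 < h) (sh : s * h < pi).

Let theta0 : 0 < theta. Proof. exact: mulr_gt0. Qed.
Let st : 0 < sin theta. Proof. by apply: sin_gt0_pi; rewrite theta0. Qed.
Let l0 : 0 <= l. Proof. by rewrite mulr_ge0// ltW. Qed.

Let node_ge0 i : 0 <= i%:R * h. Proof. by rewrite mulr_ge0// ltW. Qed.
Let node_le i j : (i <= j)%N -> i%:R * h <= j%:R * h.
Proof. by move=> ij; rewrite ler_pM2r// ler_nat. Qed.

(* Values and derivatives (divided by [s]) at the nodes of the partial sums. *)
Let P a j : R := a 0%N * cos (j%:R * theta)
  + \sum_(0 <= i < j) coef a i * sin ((j%:R - i%:R) * theta).
Let Q a j : R := - a 0%N * sin (j%:R * theta)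
  + \sum_(0 <= i < j) coef a i * cos ((j%:R - i%:R) * theta).

Let PS a j : P a j.+1 = P a j * cos theta + Q a j * sin theta + coef a j * sin theta.
Proof.
rewrite /P /Q big_nat_recr//= -[j.+1]addn1 natrD.
have e (i : nat) : (j%:R + 1 - i%:R) * theta = (j%:R - i%:R) * theta + theta by ring.
under eq_bigr => i _ do rewrite e sinD mulrDr 2!(mulrA (coef a i)).
rewrite big_split/= -!mulr_suml [(j%:R + 1) * theta]mulrDl mul1r cosD.
by rewrite [j%:R + 1 - _]addrAC subrr add0r mul1r; ring.
Qed.

Let QS a j : Q a j.+1 = Q a j * cos theta - P a j * sin theta + coef a j * cos theta.
Proof.
rewrite /P /Q big_nat_recr//= -[j.+1]addn1 natrD.
have e (i : nat) : (j%:R + 1 - i%:R) * theta = (j%:R - i%:R) * theta + theta by ring.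
under eq_bigr => i _ do rewrite e cosD mulrBr 2!(mulrA (coef a i)).
rewrite sumrB/= -!mulr_suml [(j%:R + 1) * theta]mulrDl mul1r sinD.
by rewrite [j%:R + 1 - _]addrAC subrr add0r mul1r; ring.
Qed.

(** Up to the factor [s], [Q a j + coef a j] is the right derivative at node j and [Q a j.+1] the
    left derivative at node j + 1. By the addition theorems, passing to the next node rotates value
    and derivative by theta, and [coef] is such that the next value is [a j.+1]. *)
Let PQE a j : P a j = a j /\
  Q a j + coef a j = (a j.+1 - cos theta * a j) / sin theta /\
  Q a j.+1 = (cos theta * a j.+1 - a j) / sin theta.
Proof.
have sn0 : sin theta != 0 by rewrite gt_eqF.
have e2 := cos2Dsin2 theta.
have key i : P a i = a i ->
    Q a i + coef a i = (a i.+1 - cos theta * a i) / sin theta ->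
    P a i.+1 = a i.+1 /\ Q a i.+1 = (cos theta * a i.+1 - a i) / sin theta.
  move=> Pi Qi; rewrite PS QS Pi; split.
    rewrite -addrA -mulrDl Qi; field; exact: sn0.
  rewrite addrAC -mulrDl Qi.
  have -> : a i * sin theta = a i * (1 - cos theta ^+ 2) / sin theta.
    by rewrite -e2; field; exact: sn0.
  by field; exact: sn0.
elim: j => [|j [Pj [Qj Qj1]]].
  have P0 : P a 0 = a 0%N by rewrite /P big_geq// mul0r cos0 mulr1 addr0.
  have Q0 : Q a 0 + coef a 0 = (a 1%N - cos theta * a 0%N) / sin theta.
    by rewrite /Q big_geq// mul0r sin0 mulr0 !add0r.
  by split=> //; split=> //; have [] := key _ P0 Q0.
have [P1 Q1] := key _ Pj Qj.
have Q2 : Q a j.+1 + coef a j.+1 = (a j.+2 - cos theta * a j.+1) / sin theta.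
  by rewrite Q1 /=; field; exact: sn0.
by split=> //; split=> //; have [] := key _ P1 Q2.
Qed.

Lemma interp_node a j : (j <= p)%N -> interp a (j%:R * h) = a j.
Proof.
move=> jp; rewrite -[RHS](PQE a j).1 /interp /P /trunc node_ge0 mul1r /wave sinDpihalf.
rewrite mulrCA; congr (_ + _).
rewrite -{1}(subnKC jp) iotaD big_cat/= add0n [X in _ + X]big1_seq ?addr0; last first.
  move=> i /andP[_]; rewrite mem_iota => /andP[ji _].
  by rewrite tsin_le ?mulr0// node_le.
rewrite /index_iota subn0 big_seq [RHS]big_seq; apply: eq_bigr => i.
rewrite mem_iota => /andP[_ ij]; rewrite tsinE ?node_le// 1?ltnW//.
by congr (_ * sin _); ring.
Qed.

Let hcos : rH1 l (trunc 0 (wave s (pi / 2))) (trunc 0 (dwave s (pi / 2))).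
Proof. by apply: wave_rH1 => //; left. Qed.

(* The conditional keeps the summands in [H^1] outside the range of the sum. *)
Let F (i : nat) := if (i <= p)%N then tsin s (i%:R * h) else fun=> 0.
Let F' (i : nat) := if (i <= p)%N then dtsin s (i%:R * h) else fun=> 0.

Let FH i : rH1 l (F i) (F' i).
Proof.
rewrite /F /F'; case: leqP => ip; last exact: rH1_cst.
by apply: tsin_rH1; rewrite ?node_ge0 ?node_le.
Qed.

Let interpE a : interp a = (fun x => a 0%N * trunc 0 (wave s (pi / 2)) x
  + \sum_(i <- iota 0 p) coef a i * F i x).
Proof.
apply/funext => x; rewrite /interp; congr (_ + _).
rewrite big_seq [RHS]big_seq; apply: eq_bigr => i; rewrite mem_iota add0n => /andP[_ ip].
by rewrite /F ltnW.
Qed.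

Let dinterpE a : dinterp a = (fun x => a 0%N * trunc 0 (dwave s (pi / 2)) x
  + \sum_(i <- iota 0 p) coef a i * F' i x).
Proof.
apply/funext => x; rewrite /dinterp; congr (_ + _).
rewrite big_seq [RHS]big_seq; apply: eq_bigr => i; rewrite mem_iota add0n => /andP[_ ip].
by rewrite /F' ltnW.
Qed.

Lemma interp_rH1 a : rH1 l (interp a) (dinterp a).
Proof.
rewrite interpE dinterpE; apply: rH1_lin => //.
by have [] := @energy_sum l 0 nat (iota 0 p) (coef a) F F' l0 FH.
Qed.

(** Each building block solves the eigenvalue equation to the right of its starting node, so only
    values of [g] at the nodes enter. They are then regrouped piece by piece. *)
Lemma interp_energy a g g' : rH1 l g g' ->
  energy l (s ^+ 2) (interp a) (dinterp a) g g' =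
  \sum_(i < p) (stiffness s h * ((a i.+1 - a i) * (g (i.+1%:R * h) - g (i%:R * h)))
    - inertance s h * ((a i.+1 + a i) * (g (i.+1%:R * h) + g (i%:R * h)))).
Proof.
move=> gH; rewrite interpE dinterpE.
have [sH sE] := @energy_sum l (s ^+ 2) nat (iota 0 p) (coef a) F F' l0 FH.
rewrite energy_lin// sE// energy_wave// /dwave.
have -> : \sum_(i <- iota 0 p) coef a i * energy l (s ^+ 2) (F i) (F' i) g g'
  = s * ((\sum_(0 <= i < p) coef a i * cos ((p%:R - i%:R) * theta)) * g l
     - \sum_(0 <= i < p) coef a i * g (i%:R * h)).
  rewrite mulr_suml -sumrB mulr_sumr /index_iota subn0 big_seq [RHS]big_seq.
  apply: eq_bigr => i; rewrite mem_iota add0n => /andP[_ ip].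
  rewrite /F /F' (ltnW ip) energy_tsin//; last by rewrite node_le// ltnW.
  rewrite (_ : s * l - s * (i%:R * h) = (p%:R - i%:R) * theta); last by ring.
  by ring.
rewrite !cosDpihalf mulr0 sin0 oppr0 mulr0 mul0r subr0.
have -> : s * l = p%:R * theta by ring.
transitivity (s * (Q a p * g l - \sum_(0 <= i < p) coef a i * g (i%:R * h))).
  by rewrite /Q; ring.
have [e1 e2] := stiffness_inertance s0 h0 sh.
have sn0 : sin theta != 0 by rewrite gt_eqF.
(* The left side collects the boundary terms of the first p pieces; each induction step adds the
   Dirichlet-to-Neumann form of one more piece. *)
elim: p => [|q IHq].
  by rewrite big_geq// big_ord0 /Q big_geq// mul0r sin0; ring.
rewrite big_ord_recr -IHq big_nat_recr//=.
have [_ [Qc Q1]] := PQE a q.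
have -> : stiffness s h * ((a q.+1 - a q) * (g (q.+1%:R * h) - g (q%:R * h)))
  - inertance s h * ((a q.+1 + a q) * (g (q.+1%:R * h) + g (q%:R * h))) =
  (stiffness s h - inertance s h) * (a q.+1 * g (q.+1%:R * h) + a q * g (q%:R * h))
  - (stiffness s h + inertance s h) * (a q.+1 * g (q%:R * h) + a q * g (q.+1%:R * h)).
  by ring.
rewrite e1 e2 Q1.
have -> : coef a q = (a q.+1 - cos theta * a q) / sin theta - Q a q.
  by rewrite -Qc; ring.
by field; exact: sn0.
Qed.

End Interpolation.

(** * Reduction to the nodes *)

Section NodeSpace.
Variables (R : realType) (nv n p : nat) (en : 'I_n -> bool -> 'I_nv) (D : {set 'I_nv}).
Local Notation vT := 'M[R]_(n, p.+1).

Definition end_value (x : vT) e (b : bool) : R := x e (if b then ord_max else ord0).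

Definition node_domain (x : vT) : Prop :=
  (forall e b e' b', en e b = en e' b' -> end_value x e b = end_value x e' b') /\
  (forall e b, en e b \in D -> end_value x e b = 0).

Definition node_space : {vspace vT} := 
  xget 0%VS [set U : {vspace vT} | forall x, x \in U <-> node_domain x].

Lemma node_spaceP x : x \in node_space <-> node_domain x.
Proof.
rewrite /node_space; case: xgetP => [U -> //|].
have [||U UP] := @vspace_of_pred R vT node_domain; last by move/(_ U).
- by split=> [e b e' b' _|e b _]; rewrite /end_value !mxE.
- move=> a y z [y1 y2] [z1 z2]; split=> [e b e' b' h|e b h]; move: y1 y2 z1 z2;
    rewrite /end_value => y1 y2 z1 z2; rewrite !mxE.
    by rewrite (y1 _ _ _ _ h) (z1 _ _ _ _ h).
  by rewrite y2// z2// mulr0 addr0.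
Qed.

End NodeSpace.

(** For every d > 0 one has |f| <= d + f^2 / d, so the integral of |f| over [0, x] is at most d
    x. *)
Lemma Rint_eq0_of_sqr (R : realType) (l x : R) (f : R -> R) : sqint l f -> Rint 0 l (fun x => f x * f x) = 0 ->
  0 <= x -> x <= l -> Rint 0 x f = 0.
Proof.
move=> sf f0 x0 xl.
have fi : itg 0 x f by apply: itgS (sqint_itg sf).
have f2i : itg 0 l (fun x => f x * f x) by exact: sqint_mul.
have f2x : itg 0 x (fun x => f x * f x) by apply: itgS f2i.
have f2x0 : Rint 0 x (fun x => f x * f x) <= 0.
  have : 0 <= Rint x l (fun x => f x * f x).
    by apply: Rint_ge0 => y _; rewrite -expr2 sqr_ge0.
  by have := Rint_chasles x0 xl f2i; rewrite f0; lra.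
apply/eqP; rewrite -normr_eq0 eq_le normr_ge0 andbT.
apply/ler_addgt0Pr => eps eps0; rewrite add0r.
have [d d0 dx] : exists2 d : R, 0 < d & d * x <= eps.
  exists (eps / (x + 1)); first by rewrite divr_gt0// ltr_wpDl.
  rewrite mulrAC ler_pdivrMr ?ltr_wpDl// ler_pM2l// lerDl//.
apply: le_trans (Rint_norm fi) _.
have bi : itg 0 x (fun y => d^-1 * (f y * f y)) by exact: itgZ.
have ci : itg 0 x (fun=> d).
  by apply: continuous_itg => y; exact: cvg_cst.
apply: le_trans (le_Rint (itg_norm fi) (itgD bi ci) _) _.
  move=> y _; have : `|f y| * `|f y| = f y * f y by rewrite -normrM ger0_norm -?expr2 ?sqr_ge0.
  move=> <-; have [h|h] := leP `|f y| d.
    by apply: le_trans h _; rewrite lerDr mulr_ge0 ?invr_ge0 ?mulr_ge0// ltW.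
  rewrite -[leLHS]addr0 lerD ?(ltW d0)// mulrA ler_peMl//.
  by rewrite ler_pdivlMl// mulr1 ltW.
rewrite RintD// RintZ// Rint_cst// subr0.
apply: le_trans (_ : 0 + eps <= _); last by rewrite add0r.
apply: lerD => //; rewrite mulr_ge0_le0// invr_ge0 ltW//.
Qed.

Section RealWeak.
Variables (R : realType) (G : qgraph R).
Local Notation rgfun := (edge G -> R -> R).

Definition rform (f f' : rgfun) : Prop :=
  [/\ forall e, rH1 (len e) (f e) (f' e),
      forall e b e' b', ends e b = ends e' b' ->
        f e (end_pos e b) = f e' (end_pos e' b') &
      forall e b, ends e b \in dirichlet G -> f e (end_pos e b) = 0].

(** The eigenvalue equation for real functions. As [mu] is real, the complex equation splits into
    this one for the real and the imaginary part. *)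
Definition rweak (mu : R) (f : rgfun) : Prop :=
  exists2 f', rform f f' & forall g g', rform g g' ->
    \sum_e energy (len e) mu (f e) (f' e) (g e) (g' e) = 0.

Lemma len_ge0 (e : edge G) : 0 <= len e.
Proof. exact/ltW/len_gt0. Qed.

(** Testing with [f] itself, every term is nonnegative and so vanishes. This settles the kernel
    ([mu = 0]) and excludes negative eigenvalues. *)
Lemma rweak_le0 mu f : mu <= 0 -> rweak mu f ->
  (forall e x, 0 <= x <= len e -> f e x = f e 0) /\
  (mu < 0 -> forall e x, 0 <= x <= len e -> f e x = 0).
Proof.
move=> mu0 [f' ff' /(_ _ _ ff')]; case: ff' => fH _ _ E0.
have t0 e : 0 <= energy (len e) mu (f e) (f' e) (f e) (f' e).
  rewrite /energy -mulNr addr_ge0 ?mulr_ge0 ?oppr_ge0//;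
  by apply: Rint_ge0 => y _; rewrite -expr2 sqr_ge0.
move/eqP: E0; rewrite psumr_eq0// => /allP E0.
have {}E0 e : Rint 0 (len e) (fun x => f' e x * f' e x) = 0
    /\ mu * Rint 0 (len e) (fun x => f e x * f e x) = 0.
  have /eqP := E0 e (mem_index_enum e); rewrite /energy => E1.
  have p1 : 0 <= Rint 0 (len e) (fun x => f' e x * f' e x).
    by apply: Rint_ge0 => y _; rewrite -expr2 sqr_ge0.
  have p2 : mu * Rint 0 (len e) (fun x => f e x * f e x) <= 0.
    by rewrite mulr_le0_ge0//; apply: Rint_ge0 => y _; rewrite -expr2 sqr_ge0.
  by split; lra.
have cst e x : 0 <= x <= len e -> f e x = f e 0.
  move=> /[dup] xl /andP[x0 xle]; have [sq fP] := fH e; have [E1 _] := E0 e.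
  by rewrite fP// (Rint_eq0_of_sqr sq E1)// addr0.
split=> // mu_lt0 e x xl; rewrite cst//.
have [_ /eqP] := E0 e; rewrite mulf_eq0 lt_eqF//= => /eqP.
rewrite (@eq_Rint _ _ _ _ (fun=> f e 0 * f e 0)); last by move=> y yl; rewrite cst.
rewrite Rint_cst ?len_ge0// subr0 => /eqP.
by rewrite !mulf_eq0 (gt_eqF (len_gt0 e)) orbF orbb => /eqP.
Qed.

Section Discretization.
Variables (p : nat) (p_gt0 : (0 < p)%N).
Local Notation vT := 'M[R]_(nedges G, p.+1).
Implicit Types (x y : vT) (s : R).

Definition step (e : edge G) : R := len e / p%:R.

Lemma step_gt0 e : 0 < step e.
Proof. by rewrite divr_gt0 ?len_gt0// ltr0n. Qed.

Lemma stepE e : p%:R * step e = len e.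
Proof. by rewrite mulrC divfK// pnatr_eq0 -lt0n. Qed.

Lemma node_in e (i : nat) : (i <= p)%N -> 0 <= i%:R * step e <= len e.
Proof.
move=> ip; apply/andP; split; first by rewrite mulr_ge0// ltW// step_gt0.
by rewrite -stepE ler_pM2r ?step_gt0// ler_nat.
Qed.

Definition gform s := node_form (p := p) (fun e => stiffness s (step e)) (fun e => inertance s (step e)).
Definition gspace : {vspace vT} := node_space R p (@ends R G) (dirichlet G).

Definition sample (f : rgfun) : vT := \matrix_(e, i) f e (i%:R * step e).

(** At s = 0 the trigonometric interpolation degenerates, as it divides by [sin 0]. The constant
    extension serves there, because by [radical0_const] the vectors in the radical are constant
    along each edge. *)
Definition ginterp s x : rgfun := fun e t =>
  if s == 0 then x e ord0 else interp s (step e) p (nodal x e) t.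
Definition dginterp s x : rgfun := fun e t =>
  if s == 0 then 0 else dinterp s (step e) p (nodal x e) t.

Definition fine_step s := 0 <= s /\ forall e, s * step e < pi.

Lemma nodal0 x e : nodal x e 0 = x e ord0.
Proof. by rewrite /nodal; congr (x e _); apply: val_inj; rewrite /= inordK. Qed.

Lemma nodal_last x e : nodal x e p = x e ord_max.
Proof. by rewrite /nodal; congr (x e _); apply: val_inj; rewrite /= inordK. Qed.

Lemma nodal_sample f e i : (i <= p)%N -> nodal (sample f) e i = f e (i%:R * step e).
Proof. by move=> ip; rewrite /nodal mxE inordK. Qed.

Lemma sample_end f e b : end_value (sample f) e b = f e (end_pos e b).
Proof. by rewrite /end_value mxE /end_pos; case: b; rewrite /= ?stepE ?mul0r. Qed.

Lemma sample_gspace f f' : rform f f' -> sample f \in gspace.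
Proof.
move=> [_ c d]; apply/node_spaceP; split=> [e b e' b' h|e b h]; rewrite !sample_end.
  exact: c.
exact: d.
Qed.

Lemma ginterp_node s x e (i : 'I_p.+1) : fine_step s -> 0 < s ->
  ginterp s x e (i%:R * step e) = x e i.
Proof.
move=> [_ sp] s0; rewrite /ginterp gt_eqF//.
by rewrite interp_node ?step_gt0 -1?ltnS// /nodal inord_val.
Qed.

Lemma ginterp_end s x e b : fine_step s -> 0 < s ->
  ginterp s x e (end_pos e b) = end_value x e b.
Proof.
move=> fs s0; rewrite /end_value -(ginterp_node x e _ fs s0); congr ginterp.
by rewrite /end_pos; case: b; rewrite /= ?stepE ?mul0r.
Qed.

Lemma ginterp_rform s x : fine_step s -> 0 < s -> x \in gspace ->
  rform (ginterp s x) (dginterp s x).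
Proof.
move=> fs s0 /node_spaceP[c d]; split=> [e|e b e' b' h|e b h]; rewrite ?ginterp_end//.
- rewrite /ginterp /dginterp gt_eqF// -stepE.
  by apply: interp_rH1; rewrite ?step_gt0//; have [] := fs.
- exact: c.
- exact: d.
Qed.

(** The test function [g] is arbitrary, yet only its samples enter. Hence [ginterp s x] is a weak
    eigenfunction as soon as [x] is in the radical. *)
Lemma ginterp_energy s x g g' : fine_step s -> 0 < s -> rform g g' ->
  \sum_e energy (len e) (s ^+ 2) (ginterp s x e) (dginterp s x e) (g e) (g' e)
    = gform s x (sample g).
Proof.
move=> [_ sp] s0 [gH _ _]; apply: eq_bigr => e _.
have -> : ginterp s x e = interp s (step e) p (nodal x e).
  by apply/funext => t; rewrite /ginterp gt_eqF.
have -> : dginterp s x e = dinterp s (step e) p (nodal x e).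
  by apply/funext => t; rewrite /dginterp gt_eqF.
have := gH e; rewrite -stepE => geH; rewrite interp_energy ?step_gt0//.
apply: eq_bigr => i _.
by rewrite /jump /pairsum !nodal_sample// ltnW.
Qed.

Lemma gform_symbilinear s : symbilinear (gform s).
Proof. exact: node_form_symbilinear. Qed.

Lemma radical0_const x : radical (gform 0) gspace x ->
  forall e i, (i <= p)%N -> nodal x e i = x e ord0.
Proof.
move=> [xU /(_ x xU)]; rewrite /gform /node_form => /eqP.
have t0 e (i : 'I_p) : stiffness 0 (step e) * (jump x e i * jump x e i)
  - inertance 0 (step e) * (pairsum x e i * pairsum x e i)
  = (step e)^-1 * jump x e i ^+ 2.
  by rewrite stiffness0 inertance0 mul0r subr0 expr2.
under eq_bigr do under eq_bigr do rewrite t0.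
have tp e (i : 'I_p) : 0 <= (step e)^-1 * jump x e i ^+ 2.
  by rewrite mulr_ge0 ?sqr_ge0// invr_ge0 ltW// step_gt0.
rewrite psumr_eq0 => [/allP h e|e _]; last exact: sumr_ge0.
have := h e (mem_index_enum e); rewrite /= psumr_eq0// => /allP {}h.
elim=> [|i IHi] ip; first exact: nodal0.
rewrite -IHi; last exact: ltnW.
have /= := h (Ordinal ip) (mem_index_enum _).
rewrite mulf_eq0 invr_eq0 (gt_eqF (step_gt0 e)) sqrf_eq0 /jump subr_eq0 /=.
by move=> /eqP.
Qed.

Lemma radical_rweak s x : fine_step s -> radical (gform s) gspace x ->
  rweak (s ^+ 2) (ginterp s x) /\
  forall e (i : 'I_p.+1), ginterp s x e (i%:R * step e) = x e i.
Proof.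
move=> fs xr; have := fs.1; rewrite le_eqVlt => /orP[/eqP s0|s0]; last first.
  split; last by move=> e i; exact: ginterp_node.
  exists (dginterp s x); first by apply: ginterp_rform; case: xr.
  by move=> g g' gH; rewrite ginterp_energy//; apply: xr.2; apply: sample_gspace gH.
move: xr; rewrite -s0 => xr; have xc := radical0_const xr.
have xE e (i : 'I_p.+1) : x e i = x e ord0.
  by rewrite -(xc e i) -1?ltnS// /nodal inord_val.
split; last by move=> e i; rewrite /ginterp eqxx xE.
exists (dginterp 0 x).
  split=> [e|e b e' b' h|e b h]; rewrite /ginterp /dginterp eqxx.
  - exact/rH1_cst/len_ge0.
  - have [/node_spaceP[+ _] _] := xr; move=> /(_ _ _ _ _ h).
    by rewrite /end_value !(xE _ (if _ then _ else _)).
  - have [/node_spaceP[_ +] _] := xr; move=> /(_ _ _ h).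
    by rewrite /end_value !(xE _ (if _ then _ else _)).
move=> g g' [gH _ _]; apply: big1 => e _.
rewrite /energy /dginterp eqxx expr0n mul0r subr0.
rewrite (@eq_Rint _ _ _ _ (fun=> 0)) ?Rint_cst ?len_ge0 ?mul0r// => t _.
by rewrite mul0r.
Qed.

Lemma segment_piece (h t : R) : 0 < h -> 0 <= t -> t <= p%:R * h ->
  exists2 i, (i < p)%N & i%:R * h <= t <= i.+1%:R * h.
Proof.
move=> h0 t0; move: p_gt0; elim: p => // q IHq _ tq.
have [q0|q0] := posnP q; first by exists 0%N => //; move: tq; rewrite q0 mul0r t0.
have [tq'|tq'] := leP t (q%:R * h).
  by have [i iq it] := IHq q0 tq'; exists i => //; rewrite ltnW.
by exists q => //; rewrite (ltW tq') tq.
Qed.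

(** The kink function of [e] vanishes at both ends, so its extension by 0 to the other edges
    satisfies all vertex conditions and is a legitimate test function. *)
Lemma rweak_kink s f (e : edge G) (x y z : R) : rweak (s ^+ 2) f ->
  0 <= x -> x <= y -> y <= z -> z <= len e -> s != 0 ->
  sin (s * z - s * x) * f e y
    = sin (s * z - s * y) * f e x + sin (s * y - s * x) * f e z.
Proof.
move=> [f' ff' fw] x0 xy yz zl s0.
have [k [k' [kH k0 kl kE]]] := kink_test s x0 xy yz zl.
have [fH _ _] := ff'.
pose g (e' : edge G) := if e' == e then k else fun=> 0.
pose g' (e' : edge G) := if e' == e then k' else fun=> 0.
have g0 e' b : g e' (end_pos e' b) = 0.
  by rewrite /g /end_pos; case: eqP => // ->; case: b.
have gg' : rform g g'.
  split=> [e'|e1 b1 e2 b2 _|e' b _]; rewrite ?g0//.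
  rewrite /g /g'; case: eqP => [->//|_]; exact/rH1_cst/len_ge0.
have := fw _ _ gg'; rewrite (bigD1 e)//= big1 => [|e' e'e].
  rewrite /g /g' eqxx addr0 energyC kE// => /eqP.
  by rewrite mulf_eq0 (negPf s0) /= => /eqP; lra.
rewrite /g /g' (negPf e'e) /energy.
have c0 (u : R -> R) : Rint 0 (len e') (fun t => u t * 0) = 0.
  by rewrite (@eq_Rint _ _ _ _ (fun=> 0)) ?Rint_cst ?len_ge0 ?mul0r// => t _; rewrite mulr0.
by rewrite !c0 mulr0 subr0.
Qed.

(** For positive [s], [f] and the interpolation of its samples agree at the nodes and satisfy the
    same three-point identity with the two nodes around [t]; since the sine of [s * step e] is
    nonzero, they agree at [t]. For [s = 0] both are constant on each edge. *)
Lemma rweak_radical s f : fine_step s -> rweak (s ^+ 2) f ->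
  radical (gform s) gspace (sample f) /\
  forall e t, 0 <= t <= len e -> f e t = ginterp s (sample f) e t.
Proof.
move=> fs fw; have [f' ff' fE] := fw; have sU := sample_gspace ff'.
have := fs.1; rewrite le_eqVlt => /orP[/eqP s0|s0]; last first.
  have rad : radical (gform s) gspace (sample f).
    split=> // y yU; rewrite (gform_symbilinear s).1 -(ginterp_energy y fs s0 ff').
    have := fE _ _ (ginterp_rform fs s0 yU) => E0; rewrite -[RHS]E0.
    by apply: eq_bigr => e _; rewrite energyC.
  split=> // e t /andP[t0 tl]; have [iw _] := radical_rweak fs rad.
  have [i ip /andP[it ti]] : exists2 i, (i < p)%N & i%:R * step e <= t <= i.+1%:R * step e.
    by apply: segment_piece; rewrite ?step_gt0 ?stepE.
  have /andP[i0 _] := node_in e (ltnW ip); have /andP[_ i1] := node_in e ip.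
  have kf := rweak_kink fw i0 it ti i1 (lt0r_neq0 s0).
  have ki := rweak_kink iw i0 it ti i1 (lt0r_neq0 s0).
  have nd j : (j <= p)%N -> ginterp s (sample f) e (j%:R * step e) = f e (j%:R * step e).
    move=> jp; have := ginterp_node (sample f) e (inord j) fs s0.
    by rewrite inordK// mxE inordK.
  move: ki; rewrite (nd i (ltnW ip)) (nd i.+1 ip) -kf => /esym/mulfI; apply.
  have -> : s * (i.+1%:R * step e) - s * (i%:R * step e) = s * step e.
    by rewrite -[i.+1]addn1 natrD; ring.
  by rewrite gt_eqF// sin_gt0_pi// mulr_gt0 ?step_gt0//=; have [] := fs.
move: fw; rewrite -s0 expr0n => /(rweak_le0 (lexx 0))[fc _].
split.
  split=> // y yU; rewrite /gform /node_form big1// => e _; rewrite big1// => i _.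
  rewrite inertance0 mul0r subr0 /jump !nodal_sample// 1?ltnW//.
  by rewrite !fc ?node_in// 1?ltnW// subrr mul0r mulr0.
move=> e t tl; rewrite /ginterp eqxx mxE mul0r; exact: fc.
Qed.

Lemma ginterp_lin s k x y e t :
  ginterp s (k *: x + y) e t = k * ginterp s x e t + ginterp s y e t.
Proof.
rewrite /ginterp; case: eqP => _; first by rewrite !mxE.
rewrite -interp_lin; congr interp; apply/funext => i; exact: nodalP.
Qed.

Lemma ginterp_sum s (I : Type) (r : seq I) (c : I -> R) (X : I -> vT) e t :
  ginterp s (\sum_(i <- r) c i *: X i) e t = \sum_(i <- r) c i * ginterp s (X i) e t.
Proof.
elim: r => [|i r IHr]; last by rewrite !big_cons ginterp_lin IHr.
rewrite !big_nil; have := ginterp_lin s (-1) 0 0 e t.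
by rewrite scaler0 addr0; lra.
Qed.

End Discretization.
End RealWeak.

Arguments gform {R} G p s.
Arguments gspace {R} G p.
Arguments fine_step {R} G p s.

(** * Complex eigenspaces *)

Section Complexification.
Variables (R : realType) (G : qgraph R).
Local Notation rgfun := (edge G -> R -> R).
Local Open Scope complex_scope.
Implicit Types (f g u : gfun G).

Definition gRe f : rgfun := fun e x => complex.Re (f e x).
Definition gIm f : rgfun := fun e x => complex.Im (f e x).
Definition gcomplex (u : rgfun) : gfun G := fun e x => (u e x)%:C.

Lemma complex_eq (z w : R[i]) :
  complex.Re z = complex.Re w -> complex.Im z = complex.Im w -> z = w.
Proof. by case: z w => [a b] [c d] /= -> ->. Qed.

Lemma ReD (z w : R[i]) : complex.Re (z + w) = complex.Re z + complex.Re w.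
Proof. by case: z w => [a b] [c d]. Qed.

Lemma ImD (z w : R[i]) : complex.Im (z + w) = complex.Im z + complex.Im w.
Proof. by case: z w => [a b] [c d]. Qed.

Lemma Re_sum (I : Type) (r : seq I) (F : I -> R[i]) :
  complex.Re (\sum_(i <- r) F i) = \sum_(i <- r) complex.Re (F i).
Proof. by elim: r => [|i r IHr]; rewrite ?big_nil// !big_cons ReD IHr. Qed.

Lemma Im_sum (I : Type) (r : seq I) (F : I -> R[i]) :
  complex.Im (\sum_(i <- r) F i) = \sum_(i <- r) complex.Im (F i).
Proof. by elim: r => [|i r IHr]; rewrite ?big_nil// !big_cons ImD IHr. Qed.

Lemma ReMr (z : R[i]) (a : R) : complex.Re (z * a%:C) = complex.Re z * a.
Proof. by case: z => [x y] /=; rewrite mulr0 subr0. Qed.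

Lemma ImMr (z : R[i]) (a : R) : complex.Im (z * a%:C) = complex.Im z * a.
Proof. by case: z => [x y] /=; rewrite mulr0 add0r. Qed.

Lemma form_domain_rform f f' :
  form_domain f f' <-> rform (gRe f) (gRe f') /\ rform (gIm f) (gIm f').
Proof.
split.
  move=> [[fH fc] fd]; split; split.
  - move=> e; have [[s1 s2] fP] := fH e; split=> // x x0l.
    by rewrite /gRe fP ?in_itv// ReD.
  - by move=> e b e' b' h; rewrite /gRe (fc _ _ _ _ h).
  - by move=> e b h; rewrite /gRe fd.
  - move=> e; have [[s1 s2] fP] := fH e; split=> // x x0l.
    by rewrite /gIm fP ?in_itv// ImD.
  - by move=> e b e' b' h; rewrite /gIm (fc _ _ _ _ h).
  - by move=> e b h; rewrite /gIm fd.
move=> [[rH rc rd] [iH ic id]]; split; first split.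
- move=> e; have [s1 P1] := rH e; have [s2 P2] := iH e; split; first by split.
  move=> x; rewrite in_itv/= => x0l; apply: complex_eq.
    by rewrite ReD; exact: P1.
  by rewrite ImD; exact: P2.
- by move=> e b e' b' h; apply: complex_eq; [exact: rc|exact: ic].
- by move=> e b h; apply: complex_eq; [exact: rd|exact: id].
Qed.

Lemma rform0 : rform (G := G) (fun _ _ => 0) (fun _ _ => 0).
Proof. by split=> // e; exact/rH1_cst/len_ge0. Qed.

Lemma form_domain_gcomplex (u u' : rgfun) : rform u u' ->
  form_domain (gcomplex u) (gcomplex u').
Proof. by move=> uu'; apply/form_domain_rform; split; [|exact: rform0]. Qed.

Lemma Re_ginner f g : complex.Re (ginner f g)
  = \sum_e Rint 0 (len e) (fun x => complex.Re (f e x * conjc (g e x))).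
Proof. by rewrite Re_sum. Qed.

Lemma Im_ginner f g : complex.Im (ginner f g)
  = \sum_e Rint 0 (len e) (fun x => complex.Im (f e x * conjc (g e x))).
Proof. by rewrite Im_sum. Qed.

Lemma eigenspace_rweak mu f : eigenspace_at mu f ->
  rweak mu (gRe f) /\ rweak mu (gIm f).
Proof.
move=> [hL2 [f' /form_domain_rform[ffR ffI] fE]].
have conjC (a : R) : conjc (a%:C) = a%:C by rewrite /= oppr0.
split; [exists (gRe f') => //|exists (gIm f') => //]; move=> g g' gg';
  have gH := fun e => (let: And3 h _ _ := gg' in h) e.
- have := congr1 (@complex.Re R) (fE _ _ (form_domain_gcomplex gg')).
  rewrite !Re_ginner /gcomplex => /eqP; rewrite -subr_eq0 -sumrB => /eqP E0.
  rewrite -[RHS]E0; apply: eq_bigr => e _.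
  have hf : rH1 (len e) (gRe f e) (gRe f' e) by case: ffR.
  rewrite /energy -RintZ; last first.
    by apply: sqint_mul; [apply: rH1_sqint hf|apply: rH1_sqint (gH e)]; exact: len_ge0.
  congr (_ - _); apply: eq_Rint => x _; rewrite conjC ReMr// /gRe.
  by rewrite mulrC [mu%:C * _]mulrC ReMr mulrC -mulrA mulrCA.
- have := congr1 (@complex.Im R) (fE _ _ (form_domain_gcomplex gg')).
  rewrite !Im_ginner /gcomplex => /eqP; rewrite -subr_eq0 -sumrB => /eqP E0.
  rewrite -[RHS]E0; apply: eq_bigr => e _.
  have hf : rH1 (len e) (gIm f e) (gIm f' e) by case: ffI.
  rewrite /energy -RintZ; last first.
    by apply: sqint_mul; [apply: rH1_sqint hf|apply: rH1_sqint (gH e)]; exact: len_ge0.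
  congr (_ - _); apply: eq_Rint => x _; rewrite conjC ImMr// /gIm.
  by rewrite mulrC [mu%:C * _]mulrC ImMr mulrC -mulrA mulrCA.
Qed.

Lemma rweak_eigenspace mu (u : rgfun) : rweak mu u -> eigenspace_at mu (gcomplex u).
Proof.
move=> [u' uu' uE]; have uH := fun e => (let: And3 h _ _ := uu' in h) e.
split.
  move=> e; split.
    have := sqint_lin mu (rH1_sqint (len_ge0 e) (uH e)) (sqint_cst (len e) 0).
    congr (sqint _ _); apply/funext => x.
    by rewrite /gcomplex /= mul0r subr0 addr0.
  have := sqint_cst (len e) (0 : R); congr (sqint _ _); apply/funext => x.
  by rewrite /gcomplex /= mulr0 mul0r addr0.
exists (gcomplex u'); first exact: form_domain_gcomplex.
move=> g g' /form_domain_rform[gR gI].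
have key (v v' : rgfun) : rform v v' ->
    \sum_e Rint 0 (len e) (fun x => u' e x * v' e x)
    = \sum_e Rint 0 (len e) (fun x => mu * u e x * v e x).
  move=> vv'; have vH := fun e => (let: And3 h _ _ := vv' in h) e.
  apply/eqP; rewrite -subr_eq0 -sumrB; apply/eqP.
  rewrite -[RHS](uE _ _ vv'); apply: eq_bigr => e _.
  rewrite /energy -RintZ; last first.
    by apply: sqint_mul; [apply: rH1_sqint (uH e)|apply: rH1_sqint (vH e)]; exact: len_ge0.
  by congr (_ - _); apply: eq_Rint => x _; rewrite mulrA.
have ReE (a : R) (z : R[i]) : complex.Re (a%:C * conjc z) = a * complex.Re z.
  by case: z => x y /=; rewrite mul0r subr0.
have ImE (a : R) (z : R[i]) : complex.Im (a%:C * conjc z) = - (a * complex.Im z).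
  by case: z => x y /=; rewrite mul0r addr0 mulrN.
have rcM (a b : R) : a%:C * b%:C = (a * b)%:C :> R[i].
  by apply: complex_eq; rewrite /= ?mulr0 ?mul0r ?subr0 ?addr0.
have RN (l : R) (h h2 : R -> R) : (forall x, h x = - h2 x) -> itg 0 l h2 -> Rint 0 l h = - Rint 0 l h2.
  by move=> hh ih; rewrite -mulN1r -RintZ//; apply: eq_Rint => x _; rewrite hh mulN1r.
apply: complex_eq.
  rewrite !Re_ginner /gcomplex.
  transitivity (\sum_e Rint 0 (len e) (fun x => u' e x * gRe g' e x)).
    by apply: eq_bigr => e _; apply: eq_Rint => x _; rewrite ReE.
  rewrite (key _ _ gR); apply: eq_bigr => e _; apply: eq_Rint => x _.
  by rewrite rcM ReE.
rewrite !Im_ginner /gcomplex.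
have gIH := fun e => (let: And3 h _ _ := gI in h) e.
transitivity (- \sum_e Rint 0 (len e) (fun x => u' e x * gIm g' e x)).
  rewrite -sumrN; apply: eq_bigr => e _; apply: RN => [x|]; first by rewrite ImE.
  by apply: sqint_mul; [have [] := uH e|have [] := gIH e].
rewrite (key _ _ gI) -sumrN; apply: eq_bigr => e _; apply/esym/RN => [x|].
  by rewrite rcM ImE.
have : itg 0 (len e) (fun x => mu * (u e x * gIm g e x)).
  by apply: itgZ; apply: sqint_mul; [apply: rH1_sqint (uH e)|apply: rH1_sqint (gIH e)]; exact: len_ge0.
by apply: eq_itg => x _; rewrite mulrA.
Qed.

(** A real basis of the radical yields a complex basis of the eigenspace: evaluation at the nodes
    gives independence, and real and imaginary parts of an eigenfunction come from the radical. *)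
Lemma has_multiplicity_nullity p s : (0 < p)%N -> fine_step G p s ->
  has_multiplicity G (s ^+ 2) (nullity (gform G p s) (gspace G p)).
Proof.
move=> p0 fs.
have [_ [K [_ [_ [_ _ KP] [_ <- _] _ _]]]] := inertia (gspace G p) (@gform_symbilinear R G p s).
pose X := vbasis K.
have XK i : X`_i \in K.
  have [iK|Ki] := ltnP i (\dim K); last by rewrite nth_default ?mem0v// size_tuple.
  by apply: vbasis_mem; apply: mem_nth; rewrite size_tuple.
exists (fun i => gcomplex (ginterp s X`_i)); split.
- move=> i; apply: rweak_eigenspace.
  by have [] := radical_rweak p0 fs ((KP _).1 (XK i)).
- move=> c c0.
  have node e (j : 'I_p.+1) i : ginterp s X`_i e (j%:R * step p e) = X`_i e j.
    by have [_] := radical_rweak p0 fs ((KP _).1 (XK i)); apply.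
  have z e (j : 'I_p.+1) : \sum_i c i * (X`_i e j)%:C = 0.
    have := c0 e (j%:R * step p e); rewrite in_itv/= node_in -1?ltnS// => /(_ isT) E0.
    rewrite -[RHS]E0 /lincomb.
    by apply: eq_bigr => i _; rewrite /gcomplex node.
  have fr : free X by apply: basis_free (vbasisP K).
  have zR : \sum_i complex.Re (c i) *: X`_i = 0.
    apply/matrixP => e j; rewrite summxE mxE -[RHS](congr1 (@complex.Re R) (z e j)).
    by rewrite Re_sum; apply: eq_bigr => i _; rewrite mxE ReMr.
  have zI : \sum_i complex.Im (c i) *: X`_i = 0.
    apply/matrixP => e j; rewrite summxE mxE -[RHS](congr1 (@complex.Im R) (z e j)).
    by rewrite Im_sum; apply: eq_bigr => i _; rewrite mxE ImMr.
  move=> i; apply: complex_eq => /=.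
    by have /freeP/(_ _ zR i) := fr.
  by have /freeP/(_ _ zI i) := fr.
- move=> f /eigenspace_rweak[fR fI].
  have [rR eR] := rweak_radical p0 fs fR; have [rI eI] := rweak_radical p0 fs fI.
  have kR := (KP _).2 rR; have kI := (KP _).2 rI.
  exists (fun i => Complex (coord X i (sample p (gRe f))) (coord X i (sample p (gIm f)))).
  move=> e x; rewrite in_itv/= => xl; apply: complex_eq.
    transitivity (ginterp s (sample p (gRe f)) e x); first exact: eR.
    rewrite /lincomb Re_sum {1}(coord_vbasis kR) ginterp_sum.
    by apply: eq_bigr => i _; rewrite ReMr.
  transitivity (ginterp s (sample p (gIm f)) e x); first exact: eI.
  rewrite /lincomb Im_sum {1}(coord_vbasis kI) ginterp_sum.
  by apply: eq_bigr => i _; rewrite ImMr.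
Qed.

Lemma has_multiplicity_neg mu : mu < 0 -> has_multiplicity G mu 0.
Proof.
move=> mu0; exists (fun _ _ _ => 0); split=> [[]//|c _ []//|f /eigenspace_rweak[fR fI]].
have [_ /(_ mu0) eR] := rweak_le0 (ltW mu0) fR.
have [_ /(_ mu0) eI] := rweak_le0 (ltW mu0) fI.
exists (fun=> 0) => e x; rewrite in_itv/= => xl; rewrite /lincomb big_ord0.
by apply: complex_eq; [exact: eR|exact: eI].
Qed.

(** The matrix expressing [u] through [v] has no left kernel, as a row in it would be a linear
    relation among the [u i]; its rank [d] is at most [d']. *)
Lemma has_multiplicity_le mu d d' :
  has_multiplicity G mu d -> has_multiplicity G mu d' -> (d <= d')%N.
Proof.
move=> [u [u1 u2 u3]] [v [v1 v2 v3]].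
have /choice[A AP] : forall i, exists c, gfun_eq (u i) (lincomb c v).
  by move=> i; exact/v3/u1.
pose M : 'M[R[i]]_(d, d') := \matrix_(i, j) A i j.
suff : row_free M by move=> /eqP <-; exact: rank_leq_col.
rewrite -kermx_eq0; apply/eqP/row_matrixP => k; rewrite row0.
set w := row k _; have wM : w *m M = 0 by apply/sub_kermxP; exact: row_sub.
apply/rowP => i; rewrite [RHS]mxE; apply: (u2 (fun i => w 0 i)) => e x xl.
rewrite /lincomb.
transitivity (\sum_i \sum_j w 0 i * A i j * v j e x).
  apply: eq_bigr => i' _; rewrite (AP i' e x xl) /lincomb mulr_sumr.
  by apply: eq_bigr => j _; rewrite mulrA.
rewrite exchange_big big1//= => j _; rewrite -mulr_suml.
have /rowP/(_ j) := wM; rewrite !mxE => wj.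
rewrite (_ : \sum_(i' < d) w 0 i' * A i' j = 0) ?mul0r//.
by rewrite -[RHS]wj; apply: eq_bigr => i' _; rewrite !mxE.
Qed.

Lemma has_multiplicity_uniq mu d d' :
  has_multiplicity G mu d -> has_multiplicity G mu d' -> d = d'.
Proof.
by move=> h h'; apply/eqP; rewrite eqn_leq !(@has_multiplicity_le mu).
Qed.

End Complexification.

(** * The counting function *)

Section CountingFunction.
Variables (R : realType) (N M : R -> nat).
Hypotheses (N0 : N 0 = 0%N)
  (N_jump : forall s t, 0 <= s -> s < t -> (N s + M s <= N t)%N)
  (N_near : forall s, 0 <= s -> exists2 d : R, 0 < d &
     forall t, 0 <= t -> `|t - s| < d -> (N s <= N t <= N s + M s)%N)
  (N_unbounded : forall k, exists2 s, 0 <= s & (k <= N s)%N).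

(** [N s] stands for the number of frequencies strictly below [s], and [M s] for the multiplicity of
    [s]. Indices start at 0. *)
Definition level (k : nat) : R := sup [set s | 0 <= s /\ (N s <= k)%N].

Let N_mono s t : 0 <= s -> s <= t -> (N s <= N t)%N.
Proof.
move=> s0; rewrite le_eqVlt => /orP[/eqP -> //|st].
exact: leq_trans (leq_addr _ _) (N_jump s0 st).
Qed.

Let level_has_sup k : has_sup [set s | 0 <= s /\ (N s <= k)%N].
Proof.
split; first by exists 0; rewrite /= N0.
have [s s0 ks] := N_unbounded k.+1; exists s => t [t0 tk].
by rewrite leNgt; apply/negP => /ltW/(N_mono s0); move: ks tk; lia.
Qed.

Lemma level_ge0 k : 0 <= level k.
Proof. by apply: ub_le_sup; [have [] := level_has_sup k|rewrite /= N0]. Qed.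

(** The supremum is attained since [N] is left continuous: slightly below [s], [N_near] bounds [N]
    from below by [N s]. *)
Lemma level_ge k s : 0 <= s -> (N s <= k)%N = (s <= level k).
Proof.
move=> s0; apply/idP/idP => [ks|].
  by apply: ub_le_sup; [have [] := level_has_sup k|].
have below t : t < level k -> exists u, [/\ 0 <= u, (N u <= k)%N & t < u].
  rewrite -subr_gt0 => tl; have [u [u0 uk]] := sup_adherent tl (level_has_sup k).
  by rewrite -/(level k) subKr; exists u.
rewrite le_eqVlt => /orP[/eqP sl|/below[u [u0 uk su]]]; last first.
  exact: leq_trans (N_mono s0 (ltW su)) uk.
have [d d0 near_s] := N_near s0.
have [|u [u0 uk su]] := below (s - d); first by rewrite sl gtrBl.
apply: leq_trans uk; have [us|su'] := leP u s; last by exact/N_mono/ltW.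
suff /andP[] : (N s <= N u <= N s + M s)%N by [].
by apply: near_s => //; rewrite distrC ger0_norm ?subr_ge0//; lra.
Qed.

(** By [N_jump] and [N_near], the value of [N] just to the right of [s] is exactly [N s + M s]. *)
Lemma level_le k s : 0 <= s -> (k < N s + M s)%N = (level k <= s).
Proof.
move=> s0; apply/idP/idP; last first.
  move=> ls; rewrite ltnNge; apply/negP => Nk.
  have [d d0 near_s] := N_near s0.
  have sd : 0 <= s + d / 2 by rewrite addr_ge0// divr_ge0// ltW.
  have : (N (s + d / 2) <= N s + M s)%N.
    suff /andP[] : (N s <= N (s + d / 2) <= N s + M s)%N by [].
    by apply: near_s => //; rewrite addrC addKr ger0_norm; lra.
  by move=> /leq_trans/(_ Nk); rewrite level_ge//; lra.
move=> kN; rewrite leNgt; apply/negP => sl.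
have := N_jump s0 sl; rewrite leqNgt => /negP; apply.
by apply: leq_ltn_trans kN; rewrite level_ge ?level_ge0.
Qed.

Lemma level_eq k s : 0 <= s -> (level k = s) <-> (N s <= k < N s + M s)%N.
Proof.
move=> s0; rewrite level_ge// level_le//; split=> [->|]; first by rewrite lexx.
by move=> h; apply/eqP; rewrite eq_le andbC.
Qed.

Lemma level_homo : {homo level : n q / (n <= q)%N >-> n <= q}.
Proof.
move=> n q nq; rewrite -level_ge ?level_ge0//; apply: leq_trans nq.
by rewrite level_ge ?level_ge0.
Qed.

Lemma level_card s : 0 <= s -> ([set k | level k = s] #= `I_(M s))%card.
Proof.
move=> s0; have -> : [set k | level k = s] = [set (N s + i)%N | i in `I_(M s)].
  apply/seteqP; split=> k /=.
    move=> /(level_eq k s0)/andP[Nk kM]; exists (k - N s)%N; last by rewrite subnKC.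
    by rewrite ltn_subLR.
  by move=> [i iM <-]; apply/level_eq => //; rewrite leq_addr ltn_add2l.
by apply: inj_card_eq => i i' _ _ /addnI.
Qed.

End CountingFunction.

(** * Morse indices of the graph as eigenvalue counts *)

Section Inertia.
Variables (R : realType) (G : qgraph R).
Implicit Types (p : nat) (s t : R).

Definition graph_morse p s := morse (gform G p s) (gspace G p).
Definition graph_nullity p s := nullity (gform G p s) (gspace G p).

Lemma fine_step_le p s t : 0 <= s -> s <= t -> (0 < p)%N -> fine_step G p t -> fine_step G p s.
Proof.
move=> s0 st p0 [_ h]; split=> // e; apply: le_lt_trans (h e).
by rewrite ler_pM2r ?step_gt0.
Qed.

Lemma graph_morse_jump p s t : (0 < p)%N -> 0 <= s -> s < t -> fine_step G p t ->
  (graph_morse p s + graph_nullity p s <= graph_morse p t)%N.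
Proof.
move=> p0 s0 st [_ h]; apply: morse_nullity_le; first exact: gform_symbilinear.
move=> x xU x0; apply: node_form_lt => // e.
  by apply: stiffness_decr; rewrite ?step_gt0.
by apply: inertance_incr; rewrite ?step_gt0.
Qed.

(** Under a small change of [s], [Wm] stays negative and [Wp] stays positive, so the index can grow
    by at most the dimension of the radical. *)
Lemma graph_morse_near p s : (0 < p)%N -> fine_step G p s ->
  \forall t \near s, (graph_morse p s <= graph_morse p t <= graph_morse p s + graph_nullity p s)%N.
Proof.
move=> p0 [s0 h].
have [Wm [K [Wp [[mU _ pU] [nm pp _] [dm _ dd] _ _]]]] :=
  inertia (gspace G p) (@gform_symbilinear R G p s).
have ca (e : edge G) : stiffness t (step p e) @[t --> s] --> stiffness s (step p e).
  by apply: stiffness_cvgs => //; [exact: step_gt0|exact: cvg_cst].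
have cb (e : edge G) : inertance t (step p e) @[t --> s] --> inertance s (step p e).
  by apply: inertance_cvgs => //; [exact/ltW/step_gt0|exact: cvg_cst].
have n1 := near_node_form_neg (nbhs_filter s) ca cb nm.
have n2 := near_node_form_pos (nbhs_filter s) ca cb pp.
apply: filterS2 n1 n2 => t nt pt; apply/andP; split.
  by rewrite /graph_morse -dm; exact: morse_ge.
rewrite -(leq_add2r (\dim Wp)) dd; apply: morse_le => // x xW.
case: (eqVneq x 0) => [->|x0]; last exact/ltW/pt.
by rewrite symbil0//; exact: gform_symbilinear.
Qed.

Lemma graph_morse0 p : (0 < p)%N -> graph_morse p 0 = 0%N.
Proof.
move=> p0; have := @morse_le R _ (gform G p 0) (gspace G p) (gspace G p) (subvv _).
move=> h; apply/eqP; rewrite -leqn0 -(leq_add2r (\dim (gspace G p))) add0n.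
apply: h => x _.
apply: sumr_ge0 => e _; apply: sumr_ge0 => i _.
rewrite inertance0 mul0r subr0 stiffness0; apply: mulr_ge0.
  by rewrite invr_ge0 ltW// step_gt0.
by rewrite -expr2 sqr_ge0.
Qed.

Lemma graph_nullity_uniq p q s : (0 < p)%N -> (0 < q)%N -> fine_step G p s -> fine_step G q s ->
  graph_nullity p s = graph_nullity q s.
Proof.
move=> p0 q0 fp fq.
exact: has_multiplicity_uniq (has_multiplicity_nullity p0 fp) (has_multiplicity_nullity q0 fq).
Qed.

(* Both sides vanish at 0 and have the same jumps, hence they never separate. *)
Lemma graph_morse_uniq p q s : (0 < p)%N -> (0 < q)%N -> fine_step G p s -> fine_step G q s ->
  graph_morse p s = graph_morse q s.
Proof.
move=> p0 q0 fp fq; have s0 := fp.1.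
pose E := [set t | 0 <= t <= s /\ graph_morse p t <> graph_morse q t].
apply: contrapT => ne.
have Einf : has_inf E.
  by split; [exists s; rewrite /E/= lexx s0|exists 0 => t [/andP[]]].
pose t0 := inf E.
have t00 : 0 <= t0 by apply: lb_le_inf; [exists s; rewrite /E/= lexx s0|move=> t [/andP[]]].
have t0s : t0 <= s by apply: ge_inf; [case: Einf|rewrite /E/= lexx s0].
have fpt t : 0 <= t -> t <= s -> fine_step G p t by move=> ? ?; exact: fine_step_le fp.
have fqt t : 0 <= t -> t <= s -> fine_step G q t by move=> ? ?; exact: fine_step_le fq.
have good t : 0 <= t -> t < t0 -> graph_morse p t = graph_morse q t.
  move=> t_0 tt0; apply: contrapT => nt.
  have : t0 <= t by apply: ge_inf; [case: Einf|rewrite /E/= t_0 (ltW (lt_le_trans tt0 t0s))].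
  by rewrite leNgt tt0.
have /nbhs_ballP[d /= d0 near0] : \forall t \near t0, (graph_morse p t0 <= graph_morse p t <= graph_morse p t0 + graph_nullity p t0)%N
    /\ (graph_morse q t0 <= graph_morse q t <= graph_morse q t0 + graph_nullity q t0)%N.
  by apply: filterS2 (graph_morse_near p0 (fpt t0 t00 t0s)) (graph_morse_near q0 (fqt t0 t00 t0s)).
have near1 t : `|t0 - t| < d -> _ := near0 t.
(* Just below [t0] the two indices agree, and by left continuity each of them equals its value at
   [t0]. The maximum with [t0 / 2] keeps [t] nonnegative. *)
have eq0 : graph_morse p t0 = graph_morse q t0.
  move: t00; rewrite le_eqVlt => /orP[/eqP <-|t0_gt0]; first by rewrite !graph_morse0.
  pose t := Num.max (t0 / 2) (t0 - d / 2).
  have tt0 : t < t0 by rewrite gt_max; apply/andP; split; lra.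
  have t_0 : 0 <= t by rewrite le_max; apply/orP; left; lra.
  have [|/andP[h1 _] /andP[h2 _]] := near1 t.
    rewrite ger0_norm ?subr_ge0 ?ltW//.
    have : t0 - d / 2 <= t by rewrite le_max lexx orbT.
    lra.
  have := good t t_0 tt0.
  have := graph_morse_jump p0 t_0 tt0 (fpt t0 (ltW t0_gt0) t0s).
  have := graph_morse_jump q0 t_0 tt0 (fqt t0 (ltW t0_gt0) t0s).
  by move: h1 h2; lia.
have [t [/andP[t_0 ts] tne]] := inf_adherent d0 Einf; rewrite -/t0 => td.
have tt0 : t0 <= t by apply: ge_inf; [case: Einf|split=> //; rewrite t_0].
have {}tt0 : t0 < t.
  by rewrite lt_neqAle tt0 andbT; apply/eqP => e; apply: tne; rewrite -e.
(* Just above [t0] each index is its value at [t0] plus the nullity there, and the nullity, being a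
   multiplicity, is independent of the subdivision. *)
apply: tne; have [|/andP[_ h1] /andP[_ h2]] := near1 t.
  by rewrite distrC ger0_norm ?subr_ge0 ?ltW//; lra.
have := graph_morse_jump p0 t00 tt0 (fpt t t_0 ts).
have := graph_morse_jump q0 t00 tt0 (fqt t t_0 ts).
have := graph_nullity_uniq p0 q0 (fpt t0 t00 t0s) (fqt t0 t00 t0s).
by move: h1 h2; rewrite eq0; lia.
Qed.

Lemma fine_step_exists s : 0 <= s -> exists p, [/\ (0 < p)%N & fine_step G p s].
Proof.
move=> s0; pose L := \sum_(e : edge G) len e.
have L0 : 0 <= L by apply: sumr_ge0 => e _; exact: len_ge0.
have p0 := pi_gt0 R.
exists (Num.Def.archi_bound (s * L / pi)).+1; split=> //; split=> // e.
have sL : 0 <= s * L / pi by apply: divr_ge0; [exact: mulr_ge0|exact: ltW].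
have := archi_boundP sL; rewrite ltr_pdivrMr// => h.
rewrite /step mulrA ltr_pdivrMr ?ltr0n//.
have : s * len e <= s * L.
  by rewrite ler_wpM2l// /L (bigD1 e)//= lerDl sumr_ge0// => e' _; exact: len_ge0.
move=> /le_lt_trans; apply; apply: lt_le_trans h _.
by rewrite mulrC ler_pM2l// ler_nat.
Qed.

(* The test functions alternate between arbitrary values at odd nodes and zero
   at even nodes of a longest edge. *)
Lemma graph_morse_large (e0 : edge G) k : (forall e : edge G, len e <= len e0) -> (0 < k)%N ->
  let s := 3 / 4 * pi * (k.*2)%:R / len e0 in
  fine_step G k.*2 s /\ (k <= graph_morse k.*2 s)%N.
Proof.
case: k => // k emax _ s; have p0 := pi_gt0 R.
have kk : 0 < (k.+1.*2)%:R :> R by rewrite ltr0n double_gt0.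
have le0 := len_gt0 e0.
have s0 : 0 < s by rewrite /s divr_gt0 ?mulr_gt0//; lra.
(* The angle 3/4 pi is below pi, so the subdivision is fine on every edge, and above pi/2, so its
   cosine and hence [al - be] are negative. *)
have sh : s * step k.+1.*2 e0 = 3 / 4 * pi by rewrite /s /step; field; rewrite !gt_eqF.
have fs : fine_step G k.+1.*2 s.
  split; first exact: ltW.
  move=> e; apply: (@le_lt_trans _ _ (s * step k.+1.*2 e0)); last by rewrite sh; lra.
  by rewrite ler_pM2l// ler_pM2r ?invr_gt0.
split=> //.
pose f (x : 'rV[R]_k.+1) : 'M[R]_(nedges G, k.+1.*2.+1) :=
  \matrix_(e, i) (if (e == e0) && odd i then x 0 (inord i./2) else 0).
have lf : linear f.
  move=> a x y; apply/matrixP => e i; rewrite !mxE; case: ifP => // _.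
  by rewrite mulr0 addr0.
have nodf x e i : (i <= k.+1.*2)%N ->
    nodal (f x) e i = if (e == e0) && odd i then x 0 (inord i./2) else 0.
  by move=> ik; rewrite /nodal mxE inordK.
pose b' (x y : 'rV[R]_k.+1) := gform G k.+1.*2 s (f x) (f y).
have end0 x e b : end_value (f x) e b = 0.
  by rewrite /end_value mxE; case: b; rewrite /= ?odd_double andbF.
have fU x : f x \in gspace G k.+1.*2.
  by apply/node_spaceP; split=> [e b e' b1 _|e b _]; rewrite !end0.
have finj x : f x = 0 -> x = 0.
  move=> /matrixP fx; apply/matrixP => z i; rewrite ord1 mxE.
  have := fx e0 (inord i.*2.+1); have ik : (i.*2.+1 < k.+1.*2.+1)%N.
    by have := ltn_ord i; lia.
  rewrite !mxE inordK// eqxx /= odd_double /= uphalf_double.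
  by rewrite inord_val.
have sth : 0 < step k.+1.*2 e0 by exact: step_gt0.
have st : s * step k.+1.*2 e0 < pi by have [] := fs.
have [e1 _] := stiffness_inertance s0 sth st.
set al := stiffness s _ in e1; set be := inertance s _ in e1.
have albe : al - be < 0.
  rewrite e1 sh pmulr_llt0; last first.
    by rewrite invr_gt0; apply: sin_gt0_pi; apply/andP; split; lra.
  rewrite pmulr_rlt0//.
  have -> : 3 / 4 * pi = pi / 4 + pi / 2 :> R by lra.
  by rewrite cosDpihalf oppr_lt0; apply: sin_gt0_pi; apply/andP; split; lra.
have neg : neg_on b' fullv.
  move=> x _ x0; rewrite /b' /gform /node_form (bigD1 e0)//= [X in _ + X]big1; last first.
    move=> e ee0; apply: big1 => i _; have := ltn_ord i => ik.
    by rewrite /jump /pairsum !nodf ?(negPf ee0) ?subrr ?addr0 ?mul0r ?mulr0 ?subr0// ltnW.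
  rewrite addr0.
  (* One end value of every piece is 0, so the squared jump and the squared pair sum coincide. *)
  have -> : \sum_(i < k.+1.*2) (stiffness s (step k.+1.*2 e0) * (jump (f x) e0 i * jump (f x) e0 i)
     - inertance s (step k.+1.*2 e0) * (pairsum (f x) e0 i * pairsum (f x) e0 i))
    = (al - be) * \sum_(i < k.+1.*2) (x 0 (inord i./2)) ^+ 2.
    rewrite mulr_sumr; apply: eq_bigr => i _; have := ltn_ord i => ik.
    rewrite -/al -/be /jump /pairsum !nodf ?(ltnW ik)// eqxx /= uphalf_half.
    by case: (odd i); rewrite /= ?add0n; ring.
  rewrite nmulr_rlt0//.
  have sq (i : 'I_k.+1.*2) : 0 <= (x 0 (inord i./2)) ^+ 2 by exact: sqr_ge0.
  rewrite lt_neqAle sumr_ge0 ?andbT; last by move=> i _.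
  rewrite eq_sym; apply: contra_neq x0 => /eqP; rewrite psumr_eq0; last by move=> i _.
  move=> /allP h; apply/matrixP => z j; rewrite ord1 mxE.
  have jk : (j.*2 < k.+1.*2)%N by have := ltn_ord j; lia.
  have /= := h (Ordinal jk) (mem_index_enum _).
  by rewrite doubleK sqrf_eq0 inord_val => /eqP.
apply: leq_trans (_ : morse b' fullv <= _)%N.
  by have := morse_ge (subvv _) neg; rewrite dimvf /dim /= mul1n.
apply: (@morse_transport _ _ _ _ _ _ _ f) => // x _; first exact: finj.
Qed.

(** No single subdivision is fine for all [s], so one is chosen for each [s]; by [graph_morse_uniq]
    the value does not depend on it. *)
Definition eigcount s : nat := graph_morse (xget 0%N [set p | (0 < p)%N /\ fine_step G p s]) s.
Definition eigmult s : nat := graph_nullity (xget 0%N [set p | (0 < p)%N /\ fine_step G p s]) s.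

Lemma eigcountE p s : (0 < p)%N -> fine_step G p s ->
  eigcount s = graph_morse p s /\ eigmult s = graph_nullity p s.
Proof.
move=> p0 fp; rewrite /eigcount /eigmult; case: xgetP => [q -> [q0 fq]|/(_ p)[]//].
by split; [exact: graph_morse_uniq|exact: graph_nullity_uniq].
Qed.

Lemma eigcount0 : eigcount 0 = 0%N.
Proof.
have [p [p0 fp]] := fine_step_exists (lexx 0).
by rewrite (eigcountE p0 fp).1 graph_morse0.
Qed.

Lemma eigcount_jump s t : 0 <= s -> s < t -> (eigcount s + eigmult s <= eigcount t)%N.
Proof.
move=> s0 st; have [p [p0 fp]] := fine_step_exists (le_trans s0 (ltW st)).
have fs := fine_step_le s0 (ltW st) p0 fp.
have [-> ->] := eigcountE p0 fs; have [-> _] := eigcountE p0 fp.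
exact: graph_morse_jump.
Qed.

Lemma eigcount_near s : 0 <= s -> exists2 d : R, 0 < d &
  forall t, 0 <= t -> `|t - s| < d -> (eigcount s <= eigcount t <= eigcount s + eigmult s)%N.
Proof.
move=> s0; have s10 : 0 <= s + 1 by rewrite addr_ge0.
have [p [p0 fp]] := fine_step_exists s10.
have fs : fine_step G p s by apply: fine_step_le fp => //; rewrite lerDl.
have /nbhs_ballP[d /= d0 h] := graph_morse_near p0 fs.
exists (Num.min d 1); first by rewrite lt_min d0 ltr01.
move=> t t0; rewrite lt_min => /andP[td t1].
have ft : fine_step G p t.
  by apply: fine_step_le fp => //; move: t1; rewrite ltr_norml => /andP[]; lra.
have [-> ->] := eigcountE p0 fs; have [-> _] := eigcountE p0 ft; apply: h.
by rewrite /ball/= distrC.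
Qed.

Lemma longest_edge : exists e0 : edge G, forall e : edge G, len e <= len e0.
Proof.
have [e _ h] := @arg_maxP _ _ _ (Ordinal (nedges_gt0 G)) xpredT (@len R G) isT.
by exists e => e'; exact: h.
Qed.

Lemma eigcount_unbounded k : exists2 s, 0 <= s & (k <= eigcount s)%N.
Proof.
case: k => [|k]; first by exists 0.
have [e0 emax] := longest_edge; have [fs km] := graph_morse_large emax (ltn0Sn k).
by eexists; [exact: fs.1|rewrite (eigcountE _ fs).1].
Qed.

(** The square root of the k-th eigenvalue, numbered from 1, whereas [level] is numbered from 0. *)
Definition freq (k : nat) : R := level eigcount k.-1.

Lemma freq_lt p k s : (0 < k)%N -> (0 < p)%N -> fine_step G p s ->
  (k <= graph_morse p s)%N = (freq k < s).
Proof.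
move=> k0 p0 fp; rewrite ltNge -(level_ge eigcount0 eigcount_jump eigcount_near eigcount_unbounded) ?fp.1//.
by rewrite (eigcountE p0 fp).1 -ltnNge prednK.
Qed.

Lemma freq_le p k s : (0 < k)%N -> (0 < p)%N -> fine_step G p s ->
  (k <= graph_morse p s + graph_nullity p s)%N = (freq k <= s).
Proof.
move=> k0 p0 fp; rewrite -(level_le eigcount0 eigcount_jump eigcount_near eigcount_unbounded) ?fp.1//.
by have [-> ->] := eigcountE p0 fp; rewrite prednK.
Qed.

Lemma freq_ge0 k : 0 <= freq k.
Proof. exact: level_ge0 eigcount0 eigcount_jump eigcount_unbounded _. Qed.

Lemma freq_spectrum : is_spectrum G (fun k => level eigcount k ^+ 2).
Proof.
have lge0 := level_ge0 eigcount0 eigcount_jump eigcount_unbounded.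
split.
  move=> n q nq; rewrite ler_sqr ?nnegrE//.
  exact: level_homo eigcount0 eigcount_jump eigcount_near eigcount_unbounded _ _ nq.
move=> mu; have [mu0|mu0] := ltP mu 0.
  exists 0%N; first exact: has_multiplicity_neg.
  rewrite II0; have -> : [set n | level eigcount n ^+ 2 = mu] = set0; last exact: card_eqxx.
  by apply/seteqP; split=> // n /= h; move: mu0; rewrite -h ltNge sqr_ge0.
pose s := Num.sqrt mu; have s0 : 0 <= s by exact: sqrtr_ge0.
have s2 : s ^+ 2 = mu by exact: sqr_sqrtr.
exists (eigmult s).
  have [p [p0 fp]] := fine_step_exists s0.
  by rewrite -s2 (eigcountE p0 fp).2; exact: has_multiplicity_nullity.
have -> : [set n | level eigcount n ^+ 2 = mu] = [set n | level eigcount n = s].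
  apply/seteqP; split=> n /= => [h|->//]; apply/eqP.
  by rewrite -(eqrXn2 (n := 2))// h s2.
exact: level_card eigcount0 eigcount_jump eigcount_near eigcount_unbounded _ s0.
Qed.

(** Suppose l1 n < l2 n at the first index of disagreement. Then l2 takes the value l1 n only below
    n, where it agrees with l1, hence strictly less often than l1, although both take it as often as
    its multiplicity. *)
Lemma is_spectrum_uniq (la la' : nat -> R) :
  is_spectrum G la -> is_spectrum G la' -> la = la'.
Proof.
suff key l1 l2 n : is_spectrum G l1 -> is_spectrum G l2 ->
    (forall i, (i < n)%N -> l1 i = l2 i) -> l2 n <= l1 n.
  move=> s1 s2; apply/funext => n; elim/ltn_ind: n => n IHn.
  apply/eqP; rewrite eq_le; apply/andP; split; apply: key => //.
  by move=> i /IHn.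
move=> [h1 c1] [h2 c2] e12; rewrite leNgt; apply/negP => l12.
have [d m1 A1] := c1 (l1 n); have [d' m2 A2] := c2 (l1 n).
rewrite (has_multiplicity_uniq m2 m1) in A2.
have f1 : finite_set [set i | l1 i = l1 n] by exists d.
have f2 : finite_set [set i | l2 i = l1 n] by exists d.
have n1 := card_fset_set A1; have n2 := card_fset_set A2.
have sub i : l2 i = l1 n -> (i < n)%N.
  by move=> l2i; rewrite ltnNge; apply/negP => /h2; rewrite l2i leNgt l12.
have : finmap.fproper (fset_set [set i | l2 i = l1 n]) (fset_set [set i | l1 i = l1 n]).
  rewrite finmap.fproperE; apply/andP; split.
    apply/finmap.fsubsetP => i; rewrite !in_fset_set// !inE/= => l2i.
    by rewrite e12//; exact: sub.
  apply/negP => /finmap.fsubsetP/(_ n); rewrite !in_fset_set// !inE/= => /(_ erefl).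
  by move=> /sub; rewrite ltnn.
by move=> /finmap.fproper_ltn_card; rewrite n1 n2 ltnn.
Qed.

Lemma eigval_freq k : eigval G k = freq k ^+ 2.
Proof.
rewrite /eigval; case: xgetP => [la -> sl|/(_ _ freq_spectrum)//].
by rewrite (is_spectrum_uniq sl freq_spectrum).
Qed.

End Inertia.

(** * Scaling and connectedness *)

Section Scaling.
Variables (R : realType) (G : qgraph R) (c : R) (c_gt0 : 0 < c).

Definition scale_graph : qgraph R :=
  @QGraph R (nvertices G) (nedges G) (@ends R G) (fun e => c * len e) (dirichlet G)
    (nedges_gt0 G) (fun e => mulr_gt0 c_gt0 (len_gt0 e)).

(** The form of the scaled graph at [s / c] is that of [G] at [s] divided by [c], so the Morse
    indices agree; the frequency is recovered from the thresholds [freq _ k < s]. *)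
Lemma freq_scale k : (0 < k)%N -> freq scale_graph k = freq G k / c.
Proof.
move=> k0.
have st p e : step (G := scale_graph) p e = c * step (G := G) p e by rewrite /step/= mulrA.
have key s : 0 <= s -> (freq G k < s) = (freq scale_graph k < s / c).
  move=> s0; have [p [p0 fp]] := fine_step_exists G s0.
  have fp' : fine_step scale_graph p (s / c).
    split; first by rewrite divr_ge0// ltW.
    by move=> e; rewrite st mulrA divfK ?gt_eqF//; exact: fp.2.
  rewrite -(freq_lt k0 p0 fp) -(freq_lt k0 p0 fp'); congr (_ <= _)%N.
  apply: morse_ext => x _.
  have -> : gform scale_graph p (s / c) x x = gform G p s x x / c.
    rewrite /gform /node_form mulr_suml; apply: eq_bigr => e _.
    rewrite mulr_suml; apply: eq_bigr => i _.
    by rewrite st stiffness_scale ?inertance_scale ?gt_eqF//; ring.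
  by rewrite pmulr_llt0 ?invr_gt0.
have c0 : c != 0 by rewrite gt_eqF.
apply/eqP; rewrite eq_le; apply/andP; split; rewrite leNgt; apply/negP => h.
  have := key (c * freq scale_graph k); rewrite mulr_ge0 ?freq_ge0 ?ltW// => /(_ isT).
  by rewrite mulrC mulfK// ltxx -ltr_pdivrMr// h.
by have := key _ (freq_ge0 G k); rewrite ltxx h.
Qed.

End Scaling.

Section Connected.
Variables (R : realType) (G : qgraph R).
Hypothesis Gc : connected_qgraph G.

(** As there is an edge, connectedness excludes isolated vertices. *)
Lemma vertex_end (v : vertex G) : exists (e : edge G) b, ends e b = v.
Proof.
pose e0 : edge G := Ordinal (nedges_gt0 G).
have /connectP[[|w q] /=] := Gc v (ends e0 false); first by exists e0, false.
by move=> /andP[/existsP[e /existsP[b /andP[/eqP <- _]]] _] _; exists e, b.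
Qed.

Lemma radical0_vertex p (x : 'M[R]_(nedges G, p.+1)) (e0 : edge G) : (0 < p)%N ->
  radical (gform G p 0) (gspace G p) x ->
  forall e b, end_value x e b = x e0 ord0.
Proof.
move=> p0 xr; have xc := radical0_const p0 xr.
have [/node_spaceP[xe _] _] := xr.
have ee (e : edge G) b : end_value x e b = x e ord0.
  by rewrite /end_value; case: b => //; rewrite -nodal_last xc.
pose Q v := forall (e : edge G) b, ends e b = v -> end_value x e b = x e0 ord0.
have Q0 : Q (ends e0 false) by move=> e b h; rewrite (xe _ _ _ _ h) ee.
have QS u v : vertex_adj u v -> Q u -> Q v.
  move=> /existsP[e /existsP[b /andP[/eqP eu /eqP ev]]] Qu e' b' h.
  by rewrite -ev in h; rewrite (xe _ _ _ _ h) ee -(ee e b) Qu.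
have Qpath q u : path (@vertex_adj R G) u q -> Q u -> Q (last u q).
  by elim: q u => [//|w q IHq] u /= /andP[uw wq] /(QS _ _ uw); exact: IHq.
move=> e b; have /connectP[q qp ql] := Gc (ends e0 false) (ends e b).
by have /(_ _ _ ql) := Qpath _ _ qp Q0; apply.
Qed.

(** The kernel at s = 0 consists of constants, and of 0 alone if there is a Dirichlet vertex, so
    fewer than [j] eigenvalues vanish. At s = 0 one piece per edge is fine. *)
Lemma freq_gt0 j : (1 <= j)%N -> (j = 1%N -> exists v : vertex G, v \in dirichlet G) ->
  0 < freq G j.
Proof.
move=> j1 jD; have f1 : fine_step G 1 0 by split=> // e; rewrite mul0r pi_gt0.
rewrite ltNge -(freq_le j1 (ltn0Sn 0) f1) graph_morse0// add0n -ltnNge.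
have [_ [K [_ [_ [_ _ KP] [_ dK _] _ _]]]] := inertia (gspace G 1) (@gform_symbilinear R G 1 0).
rewrite /graph_nullity -dK; pose e0 : edge G := Ordinal (nedges_gt0 G).
have Kc x : x \in K -> forall e i, x e i = x e0 ord0.
  move=> /KP xr e i; have := radical0_vertex e0 (ltn0Sn 0) xr e (i == 1%N :> nat).
  rewrite /end_value => <-; congr (x e _); apply: val_inj => /=.
  by case: i => [[|[|i]]].
have K1 : (K <= <[const_mx 1]>)%VS.
  apply/subvP => x xK; apply/vlineP; exists (x e0 ord0); apply/matrixP => e i.
  by rewrite !mxE mulr1 Kc.
have dK1 : (\dim K <= 1)%N.
  by apply: leq_trans (dimvS K1) _; rewrite dim_vline; case: (_ != 0).
case: (eqVneq j 1%N) => [j1'|jn1]; last first.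
  by apply: leq_ltn_trans dK1 _; rewrite ltn_neqAle eq_sym jn1.
have [v vD] := jD j1'; have [e [b eb]] := vertex_end v.
have -> : K = 0%VS.
  apply/eqP; rewrite -subv0; apply/subvP => x xK; rewrite memv0; apply/eqP/matrixP => e' i.
  rewrite (Kc x xK) mxE; have xr := (KP x).1 xK.
  rewrite -(radical0_vertex e0 (ltn0Sn 0) xr e b).
  by have [/node_spaceP[_ d] _] := xr; apply: d; rewrite eb.
by rewrite dimv0.
Qed.

End Connected.

(** * Contraction of vanishing edges *)

(** The bookkeeping of [near_morse_le]: [m1] and [m2] are the Morse indices of the family and of the
    contraction, [u0] and [us] the dimensions of their node spaces, [z] and [c] those of the flat
    vectors and of a complement, [nl + w] that of the nonnegative part [K + Wp]. *)
Lemma dimension_count (m1 nl w c u0 z us m2 : nat) :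
  (m1 + (nl + w + c) <= u0)%N -> (z + c = u0)%N -> (z <= us)%N ->
  (m2 + nl + w = us)%N -> (m1 <= m2)%N.
Proof. lia. Qed.

Section Contraction.
Variables (R : realType) (nv n : nat) (en : 'I_n.+1 -> bool -> 'I_nv) (D : {set 'I_nv}).
Variables (T : Type) (U : set_system T) (l_ : T -> 'I_n.+1 -> R) (l : 'I_n.+1 -> R).
Variable e1 : 'I_n.+1.
Hypotheses (UU : UltraFilter U) (l_gt0 : forall t e, 0 < l_ t e)
  (l_le1 : forall t e, l_ t e <= 1) (l_cvg : forall e, l_ t e @[t --> U] --> l e)
  (le1 : 0 < l e1).

Let UP : ProperFilter U := @ultra_proper _ _ UU.

Definition family_graph (t : T) : qgraph R := @QGraph R nv n.+1 en (l_ t) D isT (l_gt0 t).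

Hypothesis en_connected : exists t, connected_qgraph (family_graph t).

Lemma limit_len_ge0 e : 0 <= l e.
Proof. by apply: (cvgr_to_ge (@l_cvg e)); apply: filterE => t; exact/ltW. Qed.

Lemma limit_len_le1 e : l e <= 1.
Proof. by apply: (cvgr_to_le (@l_cvg e)); apply: filterE => t. Qed.

Definition kept : {set 'I_n.+1} := [set e | 0 < l e].

Lemma contracted_len e : e \notin kept -> l e = 0.
Proof. by rewrite inE -leNgt => h; apply/eqP; rewrite eq_le h limit_len_ge0. Qed.

Lemma e1_kept : e1 \in kept. Proof. by rewrite inE. Qed.

Definition contracted_adj : rel 'I_nv := fun u v =>
  [exists e, (e \notin kept) && [exists b, (en e b == u) && (en e (~~ b) == v)]].

Lemma contracted_sym : connect_sym contracted_adj.
Proof.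
apply: sym_connect_sym => u v; apply/existsP/existsP => -[e /andP[eP /existsP[b /andP[eu ev]]]];
  by exists e; rewrite eP; apply/existsP; exists (~~ b); rewrite negbK ev eu.
Qed.

(** Components of the graph of vanishing edges, each represented by its root, so that they can be
    numbered by an ordinal type. *)
Definition classes : {set 'I_nv} := [set v | fingraph.root contracted_adj v == v].

Lemma root_class v : fingraph.root contracted_adj v \in classes.
Proof. by rewrite inE (root_root contracted_sym). Qed.

Definition vclass (v : 'I_nv) : 'I_#|classes| :=
  enum_rank_in (root_class (en e1 false)) (fingraph.root contracted_adj v).

Lemma vclass_eq u v : vclass u = vclass v <-> connect contracted_adj u v.
Proof.
rewrite -(root_connect contracted_sym); split => [h|/eqP e]; last by rewrite /vclass e.
by apply/eqP/(enum_rank_in_inj (root_class u) (root_class v) h).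
Qed.

Lemma vclass_surj w : exists v, vclass v = w.
Proof.
exists (enum_val w); rewrite /vclass.
have := enum_valP w; rewrite inE => /eqP ->; exact: enum_valK_in.
Qed.

Lemma kept_gt0 : (0 < #|kept|)%N.
Proof. by apply/card_gt0P; exists e1; exact: e1_kept. Qed.

Lemma kept_len_gt0 (i : 'I_#|kept|) : 0 < l (enum_val i).
Proof. by have := enum_valP i; rewrite inE. Qed.

Definition contraction : qgraph R :=
  @QGraph R #|classes| #|kept| (fun i b => vclass (en (enum_val i) b))
    (fun i => l (enum_val i)) [set vclass v | v in D] kept_gt0 kept_len_gt0.

Lemma contraction_connected : connected_qgraph contraction.
Proof.
have [t tc] := en_connected.
move=> w w'; have [v <-] := vclass_surj w; have [v' <-] := vclass_surj w'.
have /connectP[q qp ->] := tc v v'.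
elim: q v qp => [v _|u q IHq v /= /andP[vu uq]]; first exact: connect0.
apply: connect_trans (IHq u uq).
have /existsP[e /existsP[b /andP[/eqP ev /eqP eu]]] := vu.
case: (boolP (e \in kept)) => ek.
  apply: connect1; apply/existsP; exists (enum_rank_in e1_kept e).
  apply/existsP; exists b; rewrite /= enum_rankK_in//.
  by rewrite -[en e b]/(@ends R (family_graph t) e b) ev
    -[en e (~~ b)]/(@ends R (family_graph t) e (~~ b)) eu !eqxx.
rewrite (_ : vclass v = vclass u) ?connect0//; apply/vclass_eq/connect1.
by apply/existsP; exists e; rewrite ek; apply/existsP; exists b; rewrite -ev -eu !eqxx.
Qed.

Lemma contraction_dirichlet :
  (exists v, v \in D) -> exists v : vertex contraction, v \in dirichlet contraction.
Proof. by move=> [v vD]; exists (vclass v); exact: imset_f. Qed.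

Section Forms.
Variables (p : nat) (p_gt0 : (0 < p)%N).
Local Notation vT := 'M[R]_(n.+1, p.+1).
Local Notation wT := 'M[R]_(#|kept|, p.+1).
Local Notation U0 := (node_space R p en D).
Local Notation Us := (gspace contraction p).

(** The node vectors that descend to the contraction: [restr] and [extend] identify the flat part of
    [U0] with [Us]. *)
Definition flat (x : vT) := forall e, e \notin kept -> forall i, x e i = x e ord0.

(** The predicate [Q] lets one induction along vanishing edges serve both continuity, with [Q]
    equality to a given value, and the Dirichlet condition, with [Q] equality to 0. *)
Lemma flat_spread (x : vT) (Q : R -> Prop) u v : x \in U0 -> flat x ->
  connect contracted_adj u v ->
  (forall e b, en e b = u -> Q (end_value x e b)) ->
  forall e b, en e b = v -> Q (end_value x e b).
Proof.
move=> /node_spaceP[xe _] xf /connectP[q qp ->].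
elim: q u qp => [//|w q IHq u /= /andP[uw wq] Qu]; apply: (IHq w) => // e b h.
have /existsP[e' /andP[ek /existsP[b' /andP[/eqP eu /eqP ev]]]] := uw.
rewrite -ev in h; rewrite (xe _ _ _ _ h).
have flat_end b1 : end_value x e' b1 = x e' ord0 by rewrite /end_value; case: b1; rewrite ?xf.
by rewrite flat_end -(flat_end b'); exact: Qu.
Qed.

Definition restr (x : vT) : wT := \matrix_(i, j) x (enum_val i) j.

Lemma restr_linear : linear restr.
Proof. by move=> a x y; apply/matrixP => i j; rewrite !mxE. Qed.

Lemma end_value_restr x i b : end_value (restr x) i b = end_value x (enum_val i) b.
Proof. by rewrite /end_value mxE. Qed.

Lemma flat_vclass x e b e' b' : x \in U0 -> flat x ->
  vclass (en e b) = vclass (en e' b') -> end_value x e b = end_value x e' b'.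
Proof.
move=> xU xf /vclass_eq h; apply/esym.
apply: (@flat_spread x (fun z => z = end_value x e b) _ _ xU xf h) => // e2 b2 h2.
by have /node_spaceP[+ _] := xU; apply.
Qed.

Lemma restr_space x : x \in U0 -> flat x -> restr x \in Us.
Proof.
move=> xU xf; apply/node_spaceP; split=> [i b i' b' h|i b].
  by rewrite !end_value_restr; exact: flat_vclass.
move=> /imsetP[v vD /esym/vclass_eq h]; rewrite end_value_restr.
apply: (@flat_spread x (fun z => z = 0) _ _ xU xf h) => // e2 b2 h2.
by have /node_spaceP[_ +] := xU; apply; rewrite h2.
Qed.

(** The contraction is connected and has an edge, so every class touches a kept edge, from which the
    value at the class can be read. *)
Lemma class_end v : exists ib : 'I_#|kept| * bool, vclass (en (enum_val ib.1) ib.2) == vclass v.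
Proof.
have [i [b h]] := vertex_end contraction_connected (vclass v).
by exists (i, b); apply/eqP.
Qed.

Definition class_repr v := xchoose (class_end v).
Lemma class_reprP v : vclass (en (enum_val (class_repr v).1) (class_repr v).2) = vclass v.
Proof. exact/eqP/(xchooseP (class_end v)). Qed.

Lemma restr_inj x : x \in U0 -> flat x -> restr x = 0 -> x = 0.
Proof.
move=> xU xf /matrixP r0.
have k0 e : e \in kept -> forall i, x e i = 0.
  by move=> ek i; have := r0 (enum_rank_in e1_kept e) i; rewrite !mxE enum_rankK_in.
apply/matrixP => e i; rewrite mxE; have [ek|ek] := boolP (e \in kept); first exact: k0.
rewrite xf// -[x e ord0]/(end_value x e false).
rewrite -(flat_vclass xU xf (class_reprP (en e false))).
by rewrite /end_value k0// enum_valP.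
Qed.

Definition class_value (y : wT) v := end_value y (class_repr v).1 (class_repr v).2.

Definition extend (y : wT) : vT := \matrix_(e, i)
  if e \in kept then y (enum_rank_in e1_kept e) i else class_value y (en e false).

Lemma extend_linear : linear extend.
Proof.
move=> a x y; apply/matrixP => e i; by rewrite !mxE; case: ifP => _ //; rewrite /class_value /end_value !mxE.
Qed.

Lemma extend0 : extend 0 = 0.
Proof.
by apply/matrixP => e i; rewrite !mxE; case: ifP => _ //; rewrite /class_value /end_value mxE.
Qed.

Lemma extend_flat y : flat (extend y).
Proof. by move=> e /negPf ek i; rewrite !mxE ek. Qed.

Lemma restr_extend y : restr (extend y) = y.
Proof. by apply/matrixP => i j; rewrite !mxE enum_valP enum_valK_in. Qed.

Lemma class_value_eq y u v : y \in Us -> vclass u = vclass v ->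
  class_value y u = class_value y v.
Proof.
move=> /node_spaceP[ye _] uv; apply: ye; rewrite /=.
by rewrite !class_reprP.
Qed.

Lemma extend_end y e b : y \in Us -> end_value (extend y) e b = class_value y (en e b).
Proof.
move=> yU; have [ek|ek] := boolP (e \in kept).
  have [ye _] := (node_spaceP _ _ _).1 yU.
  rewrite {1}/end_value mxE ek; apply: (ye (enum_rank_in e1_kept e) b).
  by rewrite /= class_reprP enum_rankK_in.
rewrite {1}/end_value mxE (negPf ek); apply: class_value_eq => //.
apply/vclass_eq; case: b; last exact: connect0.
apply/connect1/existsP; exists e; rewrite ek; apply/existsP; exists false.
by rewrite !eqxx.
Qed.

Lemma extend_space y : y \in Us -> extend y \in U0.
Proof.
move=> yU; apply/node_spaceP; split=> [e b e' b' h|e b h]; rewrite !extend_end ?h//.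
have [_ yd] := (node_spaceP _ _ _).1 yU; apply: yd.
by rewrite /= class_reprP imset_f.
Qed.

(** The diverging stiffness of a vanishing edge is replaced by 0. This changes nothing on flat
    vectors and can only lower the form on the others. *)
Definition al0 s e : R := if e \in kept then stiffness s (l e / p%:R) else 0.
Definition be0 s e : R := inertance s (l e / p%:R).

Lemma limit_formE s x :
  node_form (al0 s) (be0 s) x x = gform contraction p s (restr x) (restr x).
Proof.
rewrite /gform /node_form (bigID (mem kept))/= [X in _ + X]big1 ?addr0; last first.
  move=> e ek; apply: big1 => i _; have b0 : be0 s e = 0.
    by rewrite /be0 (contracted_len ek) /inertance mul0r mulr0 mul0r tan0 mulr0.
  by rewrite /al0 (negPf ek) b0 !mul0r subrr.
rewrite big_enum_val; apply: eq_bigr => i _; apply: eq_bigr => j _.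
by rewrite /al0 enum_valP /jump /pairsum /nodal !mxE.
Qed.

Variable s : R.
Hypotheses (s0 : 0 <= s) (sp : s / p%:R < pi).

Let p0 : (0 : R) < p%:R. Proof. by rewrite ltr0n. Qed.

Lemma scaled_lt_pi x : 0 <= x -> x <= 1 -> s * (x / p%:R) < pi.
Proof.
move=> x0 x1; apply: le_lt_trans sp; rewrite mulrCA ler_piMl//.
by rewrite divr_ge0// ltW.
Qed.

Lemma family_fine t : fine_step (family_graph t) p s.
Proof. by split=> // e; apply: scaled_lt_pi => //=; exact/ltW. Qed.

Lemma contraction_fine : fine_step contraction p s.
Proof.
by split=> // i; apply: scaled_lt_pi; rewrite /= ?limit_len_ge0 ?limit_len_le1.
Qed.

Let alt t e : R := if e \in kept then stiffness s (l_ t e / p%:R) else 0.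
Let bet t e : R := inertance s (l_ t e / p%:R).

Let alt_cvg e : alt t e @[t --> U] --> al0 s e.
Proof.
rewrite /alt /al0; case: ifP => ek; last exact: cvg_cst.
apply: stiffness_cvgs => //.
- by rewrite divr_gt0//; move: ek; rewrite inE.
- by apply: scaled_lt_pi; rewrite ?limit_len_ge0 ?limit_len_le1.
- exact: cvg_cst.
- by apply: cvgMr_tmp; exact: l_cvg.
Qed.

Let bet_cvg e : bet t e @[t --> U] --> be0 s e.
Proof.
apply: inertance_cvgs => //.
- by rewrite divr_ge0 ?limit_len_ge0// ltW.
- by apply: scaled_lt_pi; rewrite ?limit_len_ge0 ?limit_len_le1.
- exact: cvg_cst.
- by apply: cvgMr_tmp; exact: l_cvg.
Qed.

Lemma flat_form t x : flat x ->
  gform (family_graph t) p s x x = node_form (alt t) (bet t) x x.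
Proof.
move=> xf; apply: eq_bigr => e _; apply: eq_bigr => i _; rewrite /alt.
case: ifP => // /negbT ek.
by rewrite /jump /nodal !(xf _ ek) subrr mulr0 !mulr0.
Qed.

(** A negative subspace of the contraction extends to flat vectors, on which the diverging
    coefficients multiply zero jumps; the remaining coefficients converge, and negativity
    persists. *)
Lemma near_morse_ge : \forall t \near U, (graph_morse contraction p s <= graph_morse (family_graph t) p s)%N.
Proof.
have [W [WU dW nW]] := morse_witness (gform contraction p s) Us.
have [L LE] := hom_of_linear extend_linear.
have inj y : extend y = 0 -> y = 0.
  by move=> h; rewrite -(restr_extend y) h; apply/matrixP => i j; rewrite !mxE.
have dLW : \dim (L @: W) = \dim W.
  apply: limg_dim_eq; apply/eqP; rewrite -subv0; apply/subvP => y /memv_capP[_].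
  by rewrite memv_ker LE memv0 => /eqP/inj ->.
have LW x : x \in (L @: W)%VS -> x \in U0 /\ flat x.
  move=> /memv_imgP[y yW ->]; rewrite LE; split; last exact: extend_flat.
  exact/extend_space/(subvP WU).
have nL : neg_on (node_form (al0 s) (be0 s)) (L @: W)%VS.
  move=> x /memv_imgP[y yW ->]; rewrite LE => ly0.
  rewrite limit_formE restr_extend; apply: nW => //.
  by apply: contraNneq ly0 => ->; rewrite extend0.
have := near_node_form_neg (@filter_filter _ _ UP) (@alt_cvg) (@bet_cvg) nL.
apply: filterS => t nt; rewrite /graph_morse -dW -dLW; apply: morse_ge.
  by apply/subvP => x /LW[].
by move=> x xL x0; rewrite flat_form; [exact: nt|have [] := LW x xL].
Qed.

(** The gap between [s] and [s'] makes the form at [s] positive on [K + Wp], radical included. Its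
    extension [P], enlarged by a complement [C] of the flat vectors, stays positive for the family:
    a limit of violating unit vectors is flat, hence in [P], where the limit form is positive. The
    codimension of [P + C] bounds the index. *)
Lemma near_morse_le s' : s < s' -> fine_step contraction p s' ->
  \forall t \near U, (graph_morse (family_graph t) p s <= graph_morse contraction p s')%N.
Proof.
move=> ss' fs'.
have [_ [K [Wp [[_ KU WpU] [_ _ _] [_ _ dd] _ [dKW ge0]]]]] :=
  inertia Us (@gform_symbilinear R contraction p s').
have KWU : (K + Wp <= Us)%VS by rewrite subv_add KU.
have posP : pos_on (gform contraction p s) (K + Wp)%VS.
  move=> y yP y0; apply: le_lt_trans (ge0 y yP) _; apply: node_form_lt => // e.
    by apply: stiffness_decr; rewrite ?step_gt0//; exact: fs'.2.
  by apply: inertance_incr; rewrite ?step_gt0//; exact: fs'.2.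
have [L LE] := hom_of_linear extend_linear.
have [Rs RsE] := hom_of_linear restr_linear.
have [||Z ZP] := @vspace_of_pred R vT (fun x => x \in U0 /\ flat x).
- by split; [exact: mem0v|move=> e _ i; rewrite !mxE].
- move=> a x y [xU xf] [yU yf]; split; first by rewrite memvD ?memvZ.
  by move=> e ek i; rewrite !mxE xf// yf.
have ZU : (Z <= U0)%VS by apply/subvP => x /ZP[].
have dZ : (\dim Z <= \dim Us)%N.
  have <- : \dim (Rs @: Z) = \dim Z.
    apply: limg_dim_eq; apply/eqP; rewrite -subv0; apply/subvP => x /memv_capP[xZ].
    rewrite memv_ker RsE memv0 => /eqP h; have [xU xf] := (ZP x).1 xZ.
    by rewrite (restr_inj xU xf h).
  apply: dimvS; apply/subvP => _ /memv_imgP[x /ZP[xU xf] ->].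
  by rewrite RsE; exact: restr_space.
pose P := (L @: (K + Wp))%VS.
have PZ x : x \in P -> x \in Z.
  move=> /memv_imgP[y yW ->]; apply/ZP; rewrite LE; split; last exact: extend_flat.
  exact/extend_space/(subvP KWU).
have dP : \dim P = \dim (K + Wp).
  apply: limg_dim_eq; apply/eqP; rewrite -subv0; apply/subvP => y /memv_capP[_].
  rewrite memv_ker LE memv0 => /eqP h.
  by rewrite -(restr_extend y) h; apply/eqP/matrixP => i j; rewrite !mxE.
have pos0 x : x \in P -> x != 0 -> 0 < node_form (al0 s) (be0 s) x x.
  move=> /memv_imgP[y yW ->]; rewrite LE => ly0.
  rewrite limit_formE restr_extend; apply: posP => //.
  by apply: contraNneq ly0 => ->; rewrite extend0.
pose C := (U0 :\: Z)%VS.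
have CU : (C <= U0)%VS by exact: diffvSl.
have ZC x : x \in Z -> x \in C -> x = 0.
  by move=> xZ xC; apply/eqP; rewrite -memv0 -(capv_diff U0 Z) memv_cap; apply/andP.
have dPC : \dim (P + C) = (\dim P + \dim C)%N.
  rewrite dimv_disjoint_sum//; apply/eqP; rewrite -subv0; apply/subvP => x.
  by move=> /memv_capP[/PZ xZ xC]; rewrite memv0 (ZC x).
have PCU : (P + C <= U0)%VS.
  by rewrite subv_add CU andbT; apply/subvP => x /PZ; exact: subvP.
have dC : (\dim Z + \dim C)%N = \dim U0.
  by rewrite -(dimv_cap_compl U0 Z) (capv_idPr ZU).
suff : \forall t \near U, forall x, x \in (P + C)%VS -> x != 0 ->
    0 < gform (family_graph t) p s x x.
  apply: filterS => t pt; rewrite /graph_morse.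
  have h : (morse (gform (family_graph t) p s) U0 + \dim (P + C) <= \dim U0)%N.
    apply: morse_le => // x xP; case: (eqVneq x 0) => [->|x0]; last exact/ltW/pt.
    by rewrite symbil0//; exact: gform_symbilinear.
  rewrite dPC dP dKW in h.
  exact: dimension_count h dC dZ dd.
apply: (near_pos_on (q := fun t x => gform (family_graph t) p s x x)).
  by move=> t c x; exact: node_formZ.
move=> G GU UG x_ x xP xPC x0 cx le0.
have GP : ProperFilter G := @ultra_proper _ _ GU.
have cG f a : f t @[t --> U] --> (a : R) -> f t @[t --> G] --> a.
  by move=> fa B Ba; exact/UG/fa.
have ltpi t e : s * (l_ t e / p%:R) < pi by apply: scaled_lt_pi => //; exact/ltW.
have lp t e : 0 < l_ t e / p%:R by rewrite divr_gt0.
(* Dropping the nonnegative stiffness terms of the vanishing edges leaves a lower bound whose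
   coefficients converge. *)
have bound t : node_form (alt t) (bet t) (x_ t) (x_ t) <= gform (family_graph t) p s (x_ t) (x_ t).
  apply: ler_sum => e _; apply: ler_sum => i _; apply: lerB => //.
  rewrite /alt; case: ifP => // _; rewrite mul0r -expr2 mulr_ge0 ?sqr_ge0//.
  exact: (ltW (stiffness_gt0 s0 (lp t e) (ltpi t e))).
have c1 : node_form (alt t) (bet t) (x_ t) (x_ t) @[t --> G] --> node_form (al0 s) (be0 s) x x.
  by apply: node_form_cvg => // e; apply: cG; [exact: alt_cvg|exact: bet_cvg].
have q0x : node_form (al0 s) (be0 s) x x <= 0.
  apply: (cvgr_to_le c1); move: le0; apply: filterS => t; apply: le_trans; exact: bound.
have flatx : flat x.
  move=> e ek.
  have jump0 i : (i < p)%N -> jump x e i = 0.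
    move=> ip.
    have cj : jump (x_ t) e i ^+ 2 @[t --> G] --> jump x e i ^+ 2.
      have cj : jump (x_ t) e i @[t --> G] --> jump x e i by apply: cvgB; exact: cx.
      by rewrite expr2; under eq_cvg do rewrite expr2; exact: cvgM.
    (* As the form is nonpositive, all stiffness terms together are at most [B t]. So a squared jump
       is at most [B t] over the stiffness, where [B t] converges and the stiffness diverges. *)
    pose B t := \sum_e \sum_(i < p) bet t e * (pairsum (x_ t) e i * pairsum (x_ t) e i).
    have cB : B t @[t --> G] --> \sum_e \sum_(i < p) be0 s e * (pairsum x e i * pairsum x e i).
      apply: cvg_bigsum => e'; apply: cvg_bigsum => i'.
      have cs : pairsum (x_ t) e' i' @[t --> G] --> pairsum x e' i' by apply: cvgD; exact: cx.
      by apply: cvgM; [apply: cG; exact: bet_cvg|exact: cvgM].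
    have cs0 : (stiffness s (l_ t e / p%:R))^-1 @[t --> G] --> (0 : R).
      apply: cG; apply: stiffness_inv_cvg => //.
      rewrite (_ : 0 = l e / p%:R); last by rewrite (contracted_len ek) mul0r.
      by apply: cvgMr_tmp; exact: l_cvg.
    have : jump x e i ^+ 2 <= 0.
      have cd : jump (x_ t) e i ^+ 2 - B t * (stiffness s (l_ t e / p%:R))^-1 @[t --> G]
          --> jump x e i ^+ 2 - (\sum_e \sum_(i < p) be0 s e * (pairsum x e i * pairsum x e i)) * 0.
        by apply: cvgB => //; exact: cvgM.
      rewrite mulr0 subr0 in cd.
      apply: (cvgr_to_le cd); move: le0; apply: filterS => t qt.
      have sg : 0 < stiffness s (l_ t e / p%:R) by exact: (stiffness_gt0 s0 (lp t e) (ltpi t e)).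
      rewrite /= subr_le0 ler_pdivlMr//; apply: (@le_trans _ _
        (\sum_e \sum_(i < p) stiffness s (l_ t e / p%:R) * (jump (x_ t) e i * jump (x_ t) e i))).
        rewrite (bigD1 e)//= (bigD1 (Ordinal ip))//= mulrC expr2 -addrA lerDl addr_ge0//.
          by apply: sumr_ge0 => i' _; rewrite -expr2 mulr_ge0 ?sqr_ge0// ltW.
        apply: sumr_ge0 => e' _; apply: sumr_ge0 => i' _.
        by rewrite -expr2 mulr_ge0 ?sqr_ge0// (ltW (stiffness_gt0 s0 (lp t e') (ltpi t e'))).
      rewrite -subr_le0; apply: le_trans qt; rewrite /gform /node_form /B -sumrB.
      apply: ler_sum => e' _; rewrite -sumrB; exact: ler_sum.
    by move=> h; apply/eqP; rewrite -sqrf_eq0 eq_le h sqr_ge0.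
  have nod i : (i <= p)%N -> nodal x e i = x e ord0.
    elim: i => [|i IHi] ip; first by rewrite /nodal; congr (x e _); apply: val_inj; rewrite /= inordK.
    have /eqP := jump0 i ip; rewrite /jump subr_eq0 => /eqP ->; exact/IHi/ltnW.
  by move=> i; rewrite -(nod i) -1?ltnS// /nodal inord_val.
have xZ : x \in Z by apply/ZP; split=> //; exact: (subvP PCU).
(* The component of [x] in [C] is a difference of flat vectors, hence flat, and so 0. *)
have xP' : x \in P.
  have /memv_addP[u uP [c cC xuc]] := xPC.
  have cE : c = x - u by rewrite xuc addrAC subrr add0r.
  have cZ : c \in Z by rewrite cE memvB// PZ.
  by rewrite xuc (ZC c cZ cC) addr0.
by have := pos0 x xP' x0; rewrite ltNge q0x.
Qed.

End Forms.

(** With f the limit frequency, [near_morse_ge] at f + d bounds the frequencies of the family from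
    above, and [near_morse_le] between f - d and f bounds them from below. *)
Lemma freq_contraction_cvg k : (0 < k)%N ->
  freq (family_graph t) k @[t --> U] --> freq contraction k.
Proof.
move=> k0; set f := freq contraction k; have f0 : 0 <= f by exact: freq_ge0.
have pi0 := pi_gt0 R.
(* One subdivision must serve the whole family and all frequencies up to f + 1; this is possible
   because all lengths are at most 1. Hence also [d <= 1] below. *)
pose p := (Num.Def.archi_bound ((f + 1) / pi)).+1.
have pp : (0 : R) < p%:R by rewrite ltr0n.
have fp : (f + 1) / p%:R < pi.
  have f1 : 0 <= (f + 1) / pi by apply: divr_ge0; [exact: addr_ge0|exact: ltW].
  have := archi_boundP f1; rewrite !ltr_pdivrMr// => h; apply: lt_le_trans h _.
  by rewrite mulrC ler_pM2l// ler_nat.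
have p0 : (0 < p)%N by [].
have spi s : s <= f + 1 -> s / p%:R < pi.
  by move=> sf; apply: le_lt_trans fp; rewrite ler_pM2r ?invr_gt0.
have fine_f : fine_step contraction p f by apply: contraction_fine => //; apply: spi; lra.
apply/cvgrPdist_le => eps eps0; pose d := Num.min eps 1.
have d0 : 0 < d by rewrite lt_min eps0 ltr01.
have dle : d <= eps by rewrite ge_min lexx.
have d1 : d <= 1 by rewrite ge_min lexx orbT.
have up : \forall t \near U, freq (family_graph t) k < f + d.
  have s0 : 0 <= f + d by lra.
  have sp : (f + d) / p%:R < pi by apply: spi; lra.
  apply: filterS (near_morse_ge p0 s0 sp) => t; apply: contraTT.
  rewrite -(freq_lt k0 p0 (family_fine s0 sp t)) -!ltnNge => /leq_trans; apply.
  by rewrite freq_lt ?ltrDl//; exact: contraction_fine.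
have low : \forall t \near U, f - d <= freq (family_graph t) k.
  have [fd|fd] := leP (f - d) 0.
    by apply: filterE => t; apply: le_trans fd _; exact: freq_ge0.
  have sp : (f - d) / p%:R < pi by apply: spi; lra.
  have lt_f : f - d < f by lra.
  apply: filterS (near_morse_le p0 (ltW fd) sp lt_f fine_f) => t h.
  rewrite leNgt -(freq_lt k0 p0 (family_fine (ltW fd) sp t)) -ltnNge.
  by apply: leq_ltn_trans h _; rewrite ltnNge freq_lt// ltxx.
apply: filterS2 up low => t h1 h2; rewrite ler_norml; apply/andP; split; lra.
Qed.

End Contraction.

(** * Existence of extremal graphs *)

(** If no fibre belonged to [U], the finitely many complements of the fibres would, together with
    their empty intersection. *)
Lemma ultra_fin_cst (T : Type) (U : set_system T) (I : finType) (f : T -> I) :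
  UltraFilter U -> exists i, \forall t \near U, f t = i.
Proof.
move=> UU; have UP : ProperFilter U := @ultra_proper _ _ UU.
apply: contrapT => nex.
have ne i : \forall t \near U, f t <> i.
  case: (in_ultra_setVsetC [set t | f t = i] UU) => // h.
  by exfalso; apply: nex; exists i.
have /filter_ex[t ht] : \forall t \near U, forall i, i \in enum I -> f t <> i.
  elim: (enum I) => [|i r IHr]; first by apply: filterE.
  apply: filterS2 (ne i) IHr => t ti tr i'; rewrite inE => /orP[/eqP -> //|].
  exact: tr.
by apply: (ht (f t)) => //; rewrite mem_enum.
Qed.

Section Shapes.
Variable R : realType.

(** The combinatorial type of a connected graph with at most m edges, hence at most 2 m vertices.
    The end map is an uncurried finite function and the edge number is a successor, so that this is
    a finite type of graphs with at least one edge. *)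
Definition shape (m : nat) := {nv : 'I_(m.*2).+1 &
  {n : 'I_m & ({ffun 'I_n.+1 * bool -> 'I_nv} * {set 'I_nv})%type}}.

(** The lengths are indexed by [nat], so that their type does not vary with the shape along a
    sequence of graphs. *)
Definition shape_graph m (t : shape m) (l : nat -> R) (l_gt0 : forall i, 0 < l i) : qgraph R :=
  @QGraph R (tag t) (tag (tagged t)).+1 (fun e b => (tagged (tagged t)).1 (e, b))
    (fun e => l e) (tagged (tagged t)).2 isT (fun e => l_gt0 e).

Lemma qgraph_eq nv n (en en' : 'I_n -> bool -> 'I_nv) (l l' : 'I_n -> R) (D : {set 'I_nv})
    (n0 n0' : (0 < n)%N) (l0 : forall e, 0 < l e) (l0' : forall e, 0 < l' e) :
  en =2 en' -> l =1 l' -> @QGraph R nv n en l D n0 l0 = @QGraph R nv n en' l' D n0' l0'.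
Proof.
move=> een ll; have ee : en = en' by apply/funext => e; apply/funext => b.
have le : l = l' by apply/funext.
by subst en' l'; rewrite (Prop_irrelevance n0 n0') (Prop_irrelevance l0 l0').
Qed.

Lemma nvertices_le (G : qgraph R) : connected_qgraph G -> (nvertices G <= (nedges G).*2)%N.
Proof.
move=> Gc; have /choice[f fP] : forall v : vertex G, exists eb : edge G * bool, ends eb.1 eb.2 = v.
  by move=> v; have [e [b h]] := vertex_end Gc v; exists (e, b).
have finj : injective f by move=> u v uv; rewrite -(fP u) -(fP v) uv.
have := leq_card f finj; rewrite card_ord card_prod card_ord card_bool.
by rewrite muln2.
Qed.

Lemma shape_exists (G : qgraph R) m : connected_qgraph G -> (nedges G <= m)%N ->
  exists (t : shape m) (l : nat -> R) (l0 : forall i, 0 < l i), G = shape_graph t l0.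
Proof.
move=> Gc Gm; have := nvertices_le Gc.
case: G Gc Gm => nv [//|n] en l D n0 l0 /= Gc nm nvn.
have nvm : (nv < (m.*2).+1)%N by rewrite ltnS (leq_trans nvn)// leq_double.
pose i1 := Ordinal nvm; pose i2 := Ordinal nm.
pose g : {ffun 'I_i2.+1 * bool -> 'I_i1} := [ffun p => en p.1 p.2].
pose t : shape m := Tagged (fun nv : 'I_(m.*2).+1 =>
  {n : 'I_m & ({ffun 'I_n.+1 * bool -> 'I_nv} * {set 'I_nv})%type})
  (Tagged (fun n : 'I_m => ({ffun 'I_n.+1 * bool -> 'I_i1} * {set 'I_i1})%type) (g, D : {set 'I_i1})).
have l0' (i : nat) : 0 < l (inord i) by [].
exists t, (fun i => l (inord i)), l0'.
by apply: qgraph_eq => [e b|e]; rewrite ?ffunE ?inord_val.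
Qed.

End Shapes.

(** * Limits of admissible graphs and of their ratios *)

Section Limits.
Variable R : realType.

Lemma eigratio_freq (G : qgraph R) k j : eigratio G k j = freq G k ^+ 2 / freq G j ^+ 2.
Proof. by rewrite /eigratio !eigval_freq. Qed.

Lemma eigratio_scale (G : qgraph R) c (c0 : 0 < c) k j : (0 < k)%N -> (0 < j)%N ->
  eigratio (scale_graph G c0) k j = eigratio G k j.
Proof.
move=> k0 j0; rewrite !eigratio_freq !freq_scale// !expr_div_n.
by rewrite invf_div mulrA divfK// expf_neq0// gt_eqF.
Qed.

Lemma shape_limit (m j : nat) (G_ : nat -> qgraph R) (U : set_system nat) : UltraFilter U ->
  (forall i, admissible (G_ i) m j) ->
  (forall i (e : edge (G_ i)), len e <= 1) ->
  (forall i, exists e : edge (G_ i), len e = 1) ->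
  exists2 Gs, weakly_admissible Gs m j & forall k, (0 < k)%N ->
    freq (G_ i) k @[i --> U] --> freq Gs k.
Proof.
move=> UU Gadm Gle1 G1; have UP : ProperFilter U := @ultra_proper _ _ UU.
have /choice[t tP] : forall i, exists t : shape m, exists (l : nat -> R) (l0 : forall i, 0 < l i),
    G_ i = shape_graph t l0.
  by move=> i; have [c nm _ _] := Gadm i; exact: shape_exists.
have {tP}/choice[l lP] := tP.
have [t0 tt0] := ultra_fin_cst t UU.
case: t0 tt0 => nv [n [en D]] tt0.
(* Indices of another shape are not seen by the ultrafilter; length 1 makes them satisfy the bounds
   required for every index. *)
pose l_ (i : nat) (e : 'I_n.+1) := if t i == existT _ nv (existT _ n (en, D)) then l i e else 1.
have [l_gt0 l_le1] : (forall i e, 0 < l_ i e) /\ (forall i e, l_ i e <= 1).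
  split=> i e; rewrite /l_; case: eqP => // ti; have [l0 Gi] := lP i; first exact: l0.
  by have := Gle1 i; rewrite Gi ti => /(_ e).
pose en' e b := en (e, b).
have near_fam : \forall i \near U, G_ i = family_graph en' D l_gt0 i.
  move: tt0; apply: filterS => i ti; have [l0 ->] := lP i.
  rewrite ti; apply: qgraph_eq => // e; by rewrite /l_ ti eqxx.
(* An edge of length 1 is eventually the same one along [U], so its limit length is 1 and the
   contraction keeps it. *)
have /choice[e_ e_P] : forall i, exists e, G_ i = family_graph en' D l_gt0 i -> l_ i e = 1.
  move=> i; case: (pselect (G_ i = family_graph en' D l_gt0 i)) => Gi.
    by have := G1 i; rewrite Gi => -[e e1]; exists e.
  by exists ord0.
have [e1 ee1] := ultra_fin_cst e_ UU.
have /choice[ll llP] : forall e, exists x : R, l_ i e @[i --> U] --> x.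
  move=> e; have [|x _ h] := @ultra_bounded_cvg R nat U (fun i => l_ i e) 0 1 UU.
    by apply: filterE => i; rewrite l_le1 ltW.
  by exists x.
have lle1 : 0 < ll e1.
  have c1 : l_ i e1 @[i --> U] --> (1 : R).
    apply: cvg_near_cst; apply: filterS2 ee1 near_fam => i <-; exact: e_P.
  by rewrite (cvg_unique _ (llP e1) c1).
have [i0 [Gi0 _]] := filter_ex (filterI near_fam tt0).
have conn : exists i, connected_qgraph (family_graph en' D l_gt0 i).
  by exists i0; rewrite -Gi0; have [] := Gadm i0.
have h1 : connected_qgraph (contraction en' D lle1) by exact: contraction_connected conn.
exists (contraction en' D lle1).
  split.
  - exact: h1.
  - by rewrite /=; apply: leq_trans (max_card _) _; rewrite card_ord; exact: ltn_ord.
  - move=> j1; have [_ _ _ hD] := Gadm i0; have := hD j1; rewrite Gi0 /= => vD.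
    exact: contraction_dirichlet.
move=> k k0.
apply: cvg_trans (freq_contraction_cvg UU l_le1 llP (le1 := lle1) conn k0).
by apply: near_eq_cvg; move: near_fam; apply: filterS => i ->.
Qed.

Lemma limit_graph (m j k : nat) (G_ : nat -> qgraph R) (U : set_system nat) : UltraFilter U ->
  (0 < j)%N -> (0 < k)%N -> (forall i, admissible (G_ i) m j) ->
  exists2 Gs, weakly_admissible Gs m j & eigratio (G_ i) k j @[i --> U] --> eigratio Gs k j.
Proof.
move=> UU j0 k0 Gadm; have UP : ProperFilter U := @ultra_proper _ _ UU.
have /choice[e0 e0P] : forall i, exists e0, forall e : edge (G_ i), len e <= e0 /\
    exists e1 : edge (G_ i), len e1 = e0.
  by move=> i; have [e1 h] := longest_edge (G_ i); exists (len e1) => e; split=> //; exists e1.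
have e0_gt0 i : 0 < e0 i.
  by have [_ [e1 <-]] := e0P i (Ordinal (nedges_gt0 (G_ i))); exact: len_gt0.
have c0 i : 0 < (e0 i)^-1 by rewrite invr_gt0.
pose H i := scale_graph (G_ i) (c0 i).
have [|||Gs Gw Gcvg] := @shape_limit m j H U UU.
- by move=> i; have [h1 h2 h3 h4] := Gadm i; split.
- by move=> i e; rewrite /= mulrC ler_pdivrMr// mul1r; have [] := e0P i e.
- move=> i; have [_ [e1 h]] := e0P i (Ordinal (nedges_gt0 (G_ i))); exists e1.
  by rewrite /= h mulVf// gt_eqF.
exists Gs => //; have [Gc _ GD] := Gw.
(* The denominator has a nonzero limit, so the quotient converges to a finite ratio. *)
have fj : 0 < freq Gs j by exact: freq_gt0.
rewrite eigratio_freq.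
have e i : eigratio (G_ i) k j = freq (H i) k ^+ 2 / freq (H i) j ^+ 2.
  by rewrite -(eigratio_scale (G_ i) (c0 i) k0 j0) eigratio_freq.
under eq_cvg do rewrite e.
have c2 i0 : (0 < i0)%N -> freq (H i) i0 ^+ 2 @[i --> U] --> freq Gs i0 ^+ 2.
  by move=> h; rewrite expr2; under eq_cvg do rewrite expr2; apply: cvgM; exact: Gcvg.
apply: cvgM; first exact: c2.
by apply: cvgV; [rewrite expf_neq0// gt_eqF|exact: c2].
Qed.

(** With one Dirichlet and one Neumann end, the interval shows that the admissible class is
    nonempty, also for j = 1. *)
Definition interval_graph : qgraph R :=
  @QGraph R 2 1 (fun _ b => if b then ord_max else ord0) (fun=> 1) [set ord0] isT
    (fun=> ltr01).

Lemma interval_admissible m j : (2 <= m)%N -> admissible interval_graph m j.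
Proof.
move=> m2; split.
- have adj : vertex_adj (G := interval_graph) ord0 ord_max.
    by apply/existsP; exists ord0; apply/existsP; exists false; rewrite !eqxx.
  have adj' : vertex_adj (G := interval_graph) ord_max ord0.
    by apply/existsP; exists ord0; apply/existsP; exists true; rewrite !eqxx.
  have o2 (u : 'I_2) : u = ord0 \/ u = ord_max.
    by case: u => [[|[|//]] h]; [left|right]; apply: val_inj.
  by move=> u v; have [->|->] := o2 u; have [->|->] := o2 v; rewrite ?connect0// connect1.
- exact: ltnW.
- move=> v; rewrite inE => /eqP ->; rewrite /leaf /degree; apply/eqP.
  apply: (fintype.eq_card1 (x := (ord0, false))) => -[e b].
  by rewrite !inE /= (ord1 e); case: b.
- by move=> _; exists ord0; rewrite inE.
Qed.

(** Stated for any extended real limit of admissible ratios, it covers both the infimum and the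
    supremum and shows in particular that they are finite. *)
Lemma extremal_graph (m j k : nat) (x : \bar R) (u : nat -> \bar R) :
  (0 < j)%N -> (0 < k)%N ->
  (forall i, [set (eigratio G k j)%:E | G in [set G : qgraph R | admissible G m j]] (u i)) ->
  u i @[i --> \oo] --> x ->
  exists2 Gs : qgraph R, weakly_admissible Gs m j & (eigratio Gs k j)%:E = x.
Proof.
move=> j0 k0 uS ux.
have /choice[G_ GP] : forall i, exists G : qgraph R, admissible G m j /\ (eigratio G k j)%:E = u i.
  by move=> i; have [G Gadm Gu] := uS i; exists G.
have [U [UU oU]] := @ultraFilterLemma nat \oo _.
have UP : ProperFilter U := @ultra_proper _ _ UU.
have [Gs Gw Gc] := @limit_graph m j k G_ U UU j0 k0 (fun i => (GP i).1).
exists Gs => //.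
have c1 : u i @[i --> U] --> x by move=> B Bx; exact/oU/ux.
have c2 : u i @[i --> U] --> (eigratio Gs k j)%:E.
  have -> : u = (fun i => (eigratio (G_ i) k j)%:E) by apply/funext => i; rewrite (GP i).2.
  by apply: cvg_EFin; [apply: filterE|exact: Gc].
exact: (cvg_unique (@ereal_hausdorff R) c2 c1).
Qed.

End Limits.

Theorem theorem1p10 (R : realType) (m j k : nat)
    (hm : (2 <= m)%N) (hj : (1 <= j)%N) (hjk : (j < k)%N) :
  (exists2 Gmin : qgraph R, weakly_admissible Gmin m j &
     (eigratio Gmin k j)%:E =
       ereal_inf [set (eigratio G k j)%:E | G in [set G : qgraph R | admissible G m j]]) /\
  (exists2 Gmax : qgraph R, weakly_admissible Gmax m j &
     (eigratio Gmax k j)%:E =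
       ereal_sup [set (eigratio G k j)%:E | G in [set G : qgraph R | admissible G m j]]).
Proof.
set S := [set (eigratio G k j)%:E | G in _].
have S0 : S != set0.
  by apply/set0P; exists (eigratio (interval_graph R) k j)%:E;
    exists (interval_graph R) => //; exact: interval_admissible.
have k0 : (0 < k)%N by apply: leq_trans hjk.
split; first by have [u uS ux] := ereal_inf_seq S0; exact: extremal_graph ux.
by have [u uS ux] := ereal_sup_seq S0; exact: extremal_graph ux.
Qed.
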